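(* Let $\mathfrak{A}$ be an infinite-dimensional elementary $C^*$-algebra. Then the weak* topology on $\mathscr{P}(\mathfrak{A})$ coincides with the norm topology on $\mathscr{P}(\mathfrak{A})$, and $\mathscr{P}(\mathfrak{A})$ is an Eilenberg-MacLane space of type $K(\mathbb{Z},2)$.
   Context: $\mathscr{P}(\mathfrak{A})$ denotes the set of pure states of $\mathfrak{A}$. A $C^*$-algebra is called elementary if it is $*$-isomorphic to the algebra of compact operators on some (complex, not necessarily separable) Hilbert space. A space is an Eilenberg-MacLane space of type $K(\mathbb{Z},2)$ if it is path-connected, its second homotopy group is isomorphic to $\mathbb{Z}$, and all its other homotopy groups are trivial. *)

(* Defs.v *)
From HB Require Import structures.
From mathcomp Require Import all_boot all_order all_algebra.
From mathcomp Require Import sesquilinear.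
From mathcomp Require Import all_classical all_reals all_analysis.
From mathcomp Require Import complex.

Set Implicit Arguments.
Unset Strict Implicit.
Unset Printing Implicit Defensive.

Import Order.TTheory GRing.Theory Num.Theory.
Import numFieldNormedType.Exports.

Local Open Scope classical_set_scope.
Local Open Scope ring_scope.

(* The multiplication is not required to have a unit: infinite-dimensional
   elementary algebras have none, hence no use of the ring structures. *)
HB.mixin Record isCStarAlgebra (R : realType) A
    & CompleteNormedModule R[i] A := {
  cmul : A -> A -> A ;
  cadj : A -> A ;
  cmulA : associative cmul ;
  cmul_linearl : forall b, linear (fun a => cmul a b) ;
  cmul_linearr : forall a, linear (cmul a) ;
  cadj_antilinear : forall (k : R[i]) (a b : A),
    cadj (k *: a + b) = Num.conj k *: cadj a + cadj b ;
  cadjK : involutive cadj ;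
  cadjM : forall a b, cadj (cmul a b) = cmul (cadj b) (cadj a) ;
  cmul_norm : forall a b, `|cmul a b| <= `|a| * `|b| ;
  cstar_norm : forall a, `|cmul (cadj a) a| = `|a| ^+ 2
}.

#[short(type="cstarAlgType")]
HB.structure Definition CStarAlgebra (R : realType) :=
  {A of isCStarAlgebra R A & CompleteNormedModule R[i] A}.

HB.mixin Record isHilbert (R : realType) H
    & CompleteNormedModule R[i] H := {
  hdot : {dot H for (@Num.conj R[i])} ;
  hdot_norm : forall x : H, `|x| ^+ 2 = hdot x x
}.

#[short(type="hilbertType")]
HB.structure Definition Hilbert (R : realType) :=
  {H of isHilbert R H & CompleteNormedModule R[i] H}.

Section CStar.
Variable R : realType.
Implicit Types A : cstarAlgType R.

(* Boundedness is implied by compactness. *)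
Definition compact_operator (H : hilbertType R) : set (H -> H) :=
  [set T | linear T /\ precompact (T @` [set x : H | `|x| <= 1])].

(* A *-isomorphism onto K(H), with the pointwise linear structure on operators,
   composition as product and the Hilbert space adjoint as involution. *)
Definition star_iso_compact A (H : hilbertType R) (phi : A -> H -> H) : Prop :=
  [/\ set_bij setT (@compact_operator H) phi,
      forall (k : R[i]) a b x, phi (k *: a + b) x = k *: phi a x + phi b x,
      forall a b x, phi (cmul a b) x = phi a (phi b x) &
      forall a x y, hdot (phi (cadj a) x) y = hdot x (phi a y)].

Definition elementary A : Prop :=
  exists (H : hilbertType R) (phi : A -> H -> H), star_iso_compact phi.

Definition finite_dimensional (V : lmodType R[i]) : Prop :=
  exists (n : nat) (e : 'I_n -> V),
    forall v, exists c : 'I_n -> R[i], v = \sum_(i < n) c i *: e i.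

(* [sup] is 0 on unbounded sets, so this is the norm of the dual space only for
   bounded functionals; positive functionals are bounded. *)
Definition dual_norm A (f : A -> R[i]) : R :=
  sup [set Normc.normc (f a) | a in [set a : A | `|a| <= 1]].

Definition state A (f : A -> R[i]) : Prop :=
  [/\ scalar f, forall a, 0 <= f (cmul (cadj a) a) & dual_norm f = 1].

(* The extreme points of the set of states.  As a type, this subset of
   {ptws A -> R[i]} carries the topology of pointwise convergence on A, i.e.,
   the weak* topology. *)
Definition pure_states A : set {ptws A -> R[i]^o} :=
  [set f | state f /\
    forall (g h : A -> R[i]) (t : R), state g -> state h -> 0 < t < 1 ->
      (forall a, f a = t%:C%C * g a + (1 - t)%:C%C * h a) ->
      g = f /\ h = f].
Arguments pure_states : clear implicits.

Definition norm_open A (U : set (pure_states A)) : Prop :=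
  forall w, U w -> exists2 e : R, 0 < e &
    forall w' : pure_states A,
      dual_norm (fun a => set_val w' a - set_val w a) < e -> U w'.

End CStar.
Arguments pure_states {R} A.

Section Homotopy.
Variables (R : realType) (X : topologicalType).

Definition path_connected : Prop :=
  [set: X] !=set0 /\
  forall x y : X, exists f : R -> X,
    [/\ {within `[0, 1]%classic, continuous f}, f 0 = x & f 1 = y].

Definition cube n : set 'rV[R]_n := [set t | forall i, 0 <= t 0 i <= 1].

Definition cube_boundary n : set 'rV[R]_n :=
  [set t | cube t /\ exists i, t 0 i = 0 \/ t 0 i = 1].

(* Only the values on the cube are relevant. *)
Definition spheroid n (x : X) : set ('rV[R]_n -> X) :=
  [set f | {within @cube n, continuous f} /\
    forall t, cube_boundary t -> f t = x].

Definition homotopic n (x : X) (f g : 'rV[R]_n -> X) : Prop :=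
  exists h : R * 'rV[R]_n -> X,
    [/\ {within `[0, 1]%classic `*` @cube n, continuous h},
        forall t, cube t -> h (0, t) = f t,
        forall t, cube t -> h (1, t) = g t &
        forall (s : R) t, 0 <= s <= 1 -> cube_boundary t -> h (s, t) = x].

Definition homotopy_class n (x : X) (f : 'rV[R]_n -> X) :
    set ('rV[R]_n -> X) :=
  [set g | spheroid x g /\ homotopic x f g].

Definition homotopy_group n (x : X) : set (set ('rV[R]_n -> X)) :=
  [set homotopy_class x f | f in spheroid x].

Definition set_first n (c : R) (t : 'rV[R]_n.+1) : 'rV[R]_n.+1 :=
  \row_i if i == ord0 then c else t 0 i.

Definition concat n (f g : 'rV[R]_n.+1 -> X) (t : 'rV[R]_n.+1) : X :=
  if t 0 ord0 <= 2^-1 then f (set_first (2 * t 0 ord0) t)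
  else g (set_first (2 * t 0 ord0 - 1) t).

(* The union is over all representatives, which all give the same class. *)
Definition homotopy_mul n (x : X) (C D : set ('rV[R]_n.+1 -> X)) :
    set ('rV[R]_n.+1 -> X) :=
  \bigcup_(f in C) \bigcup_(g in D) homotopy_class x (concat f g).

(* For the homotopy group in dimension n.+1. *)
Definition homotopy_group_iso n (x : X) (G : zmodType) : Prop :=
  exists phi : set ('rV[R]_n.+1 -> X) -> G,
    set_bij (@homotopy_group n.+1 x) [set: G] phi /\
    forall C D, homotopy_group x C -> homotopy_group x D ->
      phi (homotopy_mul x C D) = phi C + phi D.

Definition eilenberg_maclane_Z2 : Prop :=
  [/\ path_connected,
      forall x, @homotopy_group_iso 1 x int &
      forall n x, (0 < n)%N -> n != 2%N ->
        @homotopy_group n x = [set homotopy_class x (cst x)]].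

End Homotopy.

(* Main.v *)
(** Write A = K(H).  If f is a pure state and x a unit vector with f(x (x) x^* ) > 0,
    then f dominates a positive multiple of the vector state of the vector psi
    representing y |-> f(x (x) y^* ), so it is that vector state by purity; conversely
    vector states are pure because a state equal to 1 on a rank-one projection is
    determined by it.  Hence the pure state space is the projective space of H.  The
    value at the projection onto psi of the state of psi' is |<psi', psi>|^2, and
    |psi' - psi|^2 <= 2 (1 - |<psi', psi>|^2) for suitable phases, so weak* convergence
    implies norm convergence.
    A map F into projective space lifts along [0,1] to the unit sphere: apply to a lift
    of F(0) the rank-one projections F(1/N), F(2/N), ..., F(1) successively and
    normalize.  Two maps u, v from a cube to the sphere that agree on the boundary are
    homotopic rel boundary, because (1-s) u + s v + s (1-s) |u-v| e does not vanish when
    the unit vector e is almost orthogonal to the compact images of u and v.  So the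
    class in pi_n of a map of the cube into projective space is determined by the
    restriction of its lift to one face, which is a spheroid of dimension n-1 in the
    circle: null-homotopic unless n = 2, and classified by its winding number then. *)
Require Import Defs.
From mathcomp Require Import all_boot all_order all_algebra.
From mathcomp Require Import sesquilinear.
From mathcomp Require Import all_classical all_reals all_analysis.
From mathcomp Require Import complex.
From mathcomp Require Import ring lra.
Set Implicit Arguments.
Unset Strict Implicit.
Unset Printing Implicit Defensive.
Import Order.TTheory GRing.Theory Num.Theory.
Import numFieldNormedType.Exports.
Local Open Scope classical_set_scope.
Local Open Scope ring_scope.

(** * Complex numbers and real-valued norms *)

Section ComplexNorm.
Variable R : realType.
Local Notation normc := Normc.normc.
Local Notation "x %:C" := (x%:C)%C.

(** The topology is that of the fibration of the unit sphere of H over its projective space with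
    fibre a circle. [projective_lift] does the work of the homotopy lifting property,
    [sphere_homotopic] that of the contractibility of the sphere, and [face] that of the connecting
    map to the homotopy groups of the circle. Since a pure state fixes its vector only up to a
    phase, continuity is always read off from projections ([pure_proj]), and lifts are repaired
    afterwards by explicit phase factors. On the algebraic side the obstacle is that the norm of A
    is abstract and [phi] is merely an algebraic isomorphism: precompactness of [phi a] gives
    approximations in the operator norm, not yet in A. The C*-identity on repeated squares compares
    the two norms on finite-rank elements, and completeness of A does the rest. Moreover A has no
    unit to evaluate positive functionals at; finite-rank projections take its place. *)

Lemma normcE2 (z : R[i]) : normc z ^+ 2 = complex.Re z ^+ 2 + complex.Im z ^+ 2.
Proof. by case: z => x y /=; rewrite sqr_sqrtr // addr_ge0 ?sqr_ge0. Qed.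

Lemma normr_normc (z : R[i]) : `|z| = (normc z)%:C. Proof. by []. Qed.

Lemma normc_ge0 (z : R[i]) : 0 <= normc z.
Proof. by case: z => x y /=; rewrite sqrtr_ge0. Qed.

Lemma normcJ (z : R[i]) : normc z^* = normc z.
Proof. by case: z => x y /=; rewrite sqrrN. Qed.

Lemma mulcJ (z : R[i]) : z * z^* = (normc z ^+ 2)%:C.
Proof. by rewrite -normCK normr_normc -rmorphXn. Qed.

Lemma normc_real (x : R) : normc x%:C = `|x|.
Proof. by rewrite /= expr0n addr0 sqrtr_sqr. Qed.

Lemma le_Re_normc (z : R[i]) : `|complex.Re z| <= normc z.
Proof. by rewrite -ler_sqr ?nnegrE ?normc_ge0 // normcE2 real_normK ?num_real //
  lerDl sqr_ge0. Qed.
Lemma le_Im_normc (z : R[i]) : `|complex.Im z| <= normc z.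
Proof. by rewrite -ler_sqr ?nnegrE ?normc_ge0 // normcE2 real_normK ?num_real //
  lerDr sqr_ge0. Qed.

Lemma le_normc_ReIm (z : R[i]) : normc z <= `|complex.Re z| + `|complex.Im z|.
Proof.
rewrite -ler_sqr ?nnegrE ?normc_ge0 ?addr_ge0 // normcE2 sqrrD.
by rewrite !real_normK ?num_real // lerD2r lerDl mulrn_wge0 // mulr_ge0.
Qed.

(** An inequality 0 <= z in [R[i]] includes that z is real, so c = 1 and c = i force w to be the
    conjugate of z. Then c = - t z leaves a real quadratic in t, tested at t = 1/b, or at t = (a +
    1)/|z|^2 when b = 0. It serves both Cauchy-Schwarz inequalities and the first variation in
    [riesz]. *)
Lemma psd_cross (a b : R) (z w : R[i]) : 0 <= b ->
  (forall c : R[i], 0 <= a%:C + c^* * z + c * w + c * c^* * b%:C) ->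
  w = z^* /\ normc z ^+ 2 <= a * b.
Proof.
case: z => x y; case: w => u v b0 h.
have H p q : p * (y + v) + q * (u - x) = 0 /\
    0 <= a + p * (x + u) + q * (y - v) + (p ^+ 2 + q ^+ 2) * b.
  have := h (p +i* q)%C; rewrite lecE /= => /andP[/eqP h1 h2]; split.
    by rewrite -[RHS]h1; ring.
  by move: h2; congr (_ <= _); ring.
have [e1 _] := H 1 0; have [e2 _] := H 0 1.
have hv : v = - y by lra.
have hu : u = x by lra.
subst v u; split=> //; rewrite normcE2 /=.
set m := x ^+ 2 + y ^+ 2; have m0 : 0 <= m by rewrite addr_ge0 ?sqr_ge0.
have {}H t : 0 <= a - t * m * 2 + t ^+ 2 * m * b.
  have [_] := H (- t * x) (- t * y); congr (_ <= _); rewrite /m; ring.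
have [b1|bn] := eqVneq b 0.
  subst b; rewrite mulr0.
  have [m1|mn] := eqVneq m 0; first by rewrite m1.
  have := H ((a + 1) / m); rewrite mulr0 addr0 mulfVK //.
  have := H 0; rewrite !mul0r subr0 expr0n /= !mul0r addr0; lra.
have := H b^-1; rewrite (_ : _ + _ = a - m / b); last by field.
by rewrite subr_ge0 ler_pdivrMr // lt_neqAle eq_sym bn.
Qed.

(* The norm of a module over R[i] takes values in R[i]; nrm is its real part. *)
Definition nrm (V : normedModType R[i]) (x : V) : R := complex.Re `|x|.

Section Norm.
Variable V : normedModType R[i].
Implicit Types x y : V.

Lemma nrmE x : `|x| = (nrm x)%:C.
Proof. by rewrite /nrm; have := normr_ge0 x; case: (`|x|) => a b /=;
  rewrite lecE /= => /andP[/eqP ->]. Qed.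

Lemma nrm_ge0 x : 0 <= nrm x.
Proof. by rewrite -ler0c -nrmE. Qed.

Lemma nrmP x (e : R) : (`|x| <= e%:C) = (nrm x <= e).
Proof. by rewrite nrmE lecR. Qed.

Lemma nrmPlt x (e : R) : (`|x| < e%:C) = (nrm x < e).
Proof. by rewrite nrmE ltcR. Qed.

Lemma nrm0_eq0 x : (nrm x == 0) = (x == 0).
Proof. by rewrite -(inj_eq (@complexI R)) -nrmE normr_eq0. Qed.

Lemma nrm0 : nrm (0 : V) = 0. Proof. by apply/eqP; rewrite nrm0_eq0. Qed.

Lemma nrm_gt0 x : (0 < nrm x) = (x != 0).
Proof. by rewrite lt_def nrm0_eq0 nrm_ge0 andbT. Qed.

Lemma nrmN x : nrm (- x) = nrm x. Proof. by rewrite /nrm normrN. Qed.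

Lemma nrm_distC x y : nrm (x - y) = nrm (y - x). Proof. by rewrite /nrm distrC. Qed.

Lemma nrmD x y : nrm (x + y) <= nrm x + nrm y.
Proof. by rewrite -lecR rmorphD /= -!nrmE ler_normD. Qed.

Lemma nrmB x y : nrm (x - y) <= nrm x + nrm y.
Proof. by rewrite -[nrm y]nrmN nrmD. Qed.

Lemma nrmZ (k : R[i]) x : nrm (k *: x) = normc k * nrm x.
Proof. by apply: (@complexI R); rewrite rmorphM /= -!nrmE normrZ normr_normc. Qed.

Lemma nrm_sum (I : Type) (r : seq I) (F : I -> V) :
  nrm (\sum_(i <- r) F i) <= \sum_(i <- r) nrm (F i).
Proof.
elim: r => [|i r IH]; first by rewrite !big_nil nrm0.
by rewrite !big_cons (le_trans (nrmD _ _)) // lerD2l.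
Qed.

Lemma cvg_nrmP (T : Type) (F : set_system T) (FF : Filter F) (f : T -> V) (l : V) :
  f x @[x --> F] --> l <-> forall e : R, 0 < e -> \forall x \near F, nrm (f x - l) < e.
Proof.
split=> [/cvgrPdist_lt h e e0|h].
  have := h e%:C; rewrite ltcR => /(_ e0); apply: filterS => x.
  by rewrite nrmPlt nrm_distC.
apply/cvgrPdist_lt => -[e e'] /=; rewrite ltcE /= => /andP[/eqP -> e0].
by have := h e e0; apply: filterS => x; rewrite nrm_distC -nrmPlt.
Qed.

Lemma cvg_nrm (T : Type) (F : set_system T) (FF : Filter F) (f : T -> V) (l : V) :
  f x @[x --> F] --> l -> nrm (f x) @[x --> F] --> nrm l.
Proof.
move=> /cvg_nrmP h; apply/cvgrPdist_lt => e /h; apply: filterS => x.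
apply: le_lt_trans; rewrite ler_norml.
have := nrmD (f x - l) l; have := nrmB (f x) (f x - l);
  rewrite opprB addrCA subrr addr0 subrK.
by move=> h1 h2; apply/andP; split; lra.
Qed.

End Norm.

Lemma nrm_normc (z : R[i]^o) : nrm z = normc z. Proof. by []. Qed.

Section ComplexCvg.
Variables (T : Type) (F : set_system T) (FF : Filter F).

Lemma cvgc_normcP (f : T -> R[i]^o) (l : R[i]^o) :
  f x @[x --> F] --> l <-> forall e : R, 0 < e -> \forall x \near F,
    normc (f x - l) < e.
Proof. exact: (@cvg_nrmP R[i]^o _ F FF f l). Qed.

Lemma cvg_real_complex (f : T -> R) (l : R) :
  f x @[x --> F] --> l -> ((f x)%:C : R[i]^o) @[x --> F] --> (l%:C : R[i]^o).
Proof.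
move=> /cvgrPdist_lt h; apply/cvgc_normcP => e /h; apply: filterS => x.
by rewrite -rmorphB normc_real distrC.
Qed.

Lemma cvg_Re (f : T -> R[i]^o) (l : R[i]^o) :
  f x @[x --> F] --> l -> complex.Re (f x) @[x --> F] --> complex.Re l.
Proof.
move=> /cvgc_normcP h; apply/cvgrPdist_lt => e /h; apply: filterS => x.
by apply: le_lt_trans; rewrite distrC -raddfB le_Re_normc.
Qed.

Lemma cvg_Im (f : T -> R[i]^o) (l : R[i]^o) :
  f x @[x --> F] --> l -> complex.Im (f x) @[x --> F] --> complex.Im l.
Proof.
move=> /cvgc_normcP h; apply/cvgrPdist_lt => e /h; apply: filterS => x.
by apply: le_lt_trans; rewrite distrC -raddfB le_Im_normc.
Qed.

Lemma cvg_complex (f g : T -> R) (a b : R) :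
  f x @[x --> F] --> a -> g x @[x --> F] --> b ->
  ((f x +i* g x)%C : R[i]^o) @[x --> F] --> ((a +i* b)%C : R[i]^o).
Proof.
move=> /cvgrPdist_lt hf /cvgrPdist_lt hg; apply/cvgc_normcP => e e0.
have e2 : 0 < e / 2 by lra.
near=> x; apply: le_lt_trans (le_normc_ReIm _) _ => /=.
rewrite [e]splitr ltrD // distrC; near: x; [exact: hf|exact: hg].
Unshelve. all: by end_near. Qed.

Lemma cvg_conjc (f : T -> R[i]^o) (l : R[i]^o) :
  f x @[x --> F] --> l -> ((f x)^* : R[i]^o) @[x --> F] --> (l^* : R[i]^o).
Proof.
move=> /cvgc_normcP h; apply/cvgc_normcP => e /h; apply: filterS => x.
by rewrite -rmorphB normcJ.
Qed.

End ComplexCvg.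
End ComplexNorm.

(** * Hilbert spaces *)

Section CauchyNorm.
Variable R : realType.
Variable V : completeNormedModType R[i].
Lemma nrm_cauchy_cvg (u : nat -> V) :
  (forall e : R, 0 < e -> exists N, forall n, (N <= n)%N -> nrm (u n - u N) < e) ->
  exists l : V, u n @[n --> \oo] --> l.
Proof.
move=> h; suff /cauchy_cvgP/cvg_ex : cauchy (u n @[n --> \oo]) by [].
apply: cauchy_exP => -[e e'] /=; rewrite ltcE /= => /andP[/eqP -> /h[N hN]].
exists (u N); rewrite /fmap /=; exists N => // n /= /hN.
by rewrite -ball_normE /ball_ /= nrm_distC -nrmPlt.
Qed.
End CauchyNorm.

Section HilbertBasics.
Variables (R : realType) (H : hilbertType R).
Local Notation normc := Normc.normc.
Local Notation "x %:C" := (x%:C)%C.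
Implicit Types (x y z : H) (s : seq H).

Definition dot x y : R[i] := hdot x y.

Lemma dotC x y : dot x y = (dot y x)^*.
Proof. by rewrite /dot hermC expr0 mul1r. Qed.
Lemma dotDl x y z : dot (x + y) z = dot x z + dot y z.
Proof. exact: linearDl. Qed.
Lemma dotNl x z : dot (- x) z = - dot x z.
Proof. exact: linearNl. Qed.
Lemma dotBl x y z : dot (x - y) z = dot x z - dot y z.
Proof. exact: linearBl. Qed.
Lemma dotZl (k : R[i]) x z : dot (k *: x) z = k * dot x z.
Proof. exact: linearZl_LR. Qed.
Lemma dotDr x y z : dot x (y + z) = dot x y + dot x z.
Proof. by rewrite dotC dotDl rmorphD /= -!dotC. Qed.
Lemma dotNr x z : dot x (- z) = - dot x z.
Proof. by rewrite dotC dotNl rmorphN /= -!dotC. Qed.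
Lemma dotBr x y z : dot x (y - z) = dot x y - dot x z.
Proof. by rewrite dotDr dotNr. Qed.
Lemma dotZr (k : R[i]) x z : dot x (k *: z) = k^* * dot x z.
Proof. by rewrite dotC dotZl rmorphM /= -dotC. Qed.
Lemma dot0l x : dot 0 x = 0. Proof. exact: linear0l. Qed.
Lemma dot0r x : dot x 0 = 0. Proof. by rewrite dotC dot0l rmorph0. Qed.
Lemma dot_suml (I : Type) (r : seq I) (F : I -> H) x :
  dot (\sum_(i <- r) F i) x = \sum_(i <- r) dot (F i) x.
Proof. exact: linear_sumlz. Qed.
Lemma dot_sumr (I : Type) (r : seq I) (F : I -> H) x :
  dot x (\sum_(i <- r) F i) = \sum_(i <- r) dot x (F i).
Proof. by rewrite dotC dot_suml rmorph_sum /=; apply: eq_bigr => i _;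
  rewrite -dotC. Qed.
Lemma dotxx x : dot x x = (nrm x ^+ 2)%:C.
Proof. by rewrite /dot -hdot_norm nrmE -rmorphXn. Qed.

Lemma dot_inj x y : (forall z, dot x z = dot y z) -> x = y.
Proof.
move=> h; apply/eqP; rewrite -subr_eq0 -nrm0_eq0 -sqrf_eq0 -(inj_eq (@complexI R)).
by rewrite -dotxx dotBl h subrr.
Qed.

Lemma nrmD2 x y : nrm (x + y) ^+ 2 = nrm x ^+ 2 + nrm y ^+ 2 + 2 * complex.Re (dot x y).
Proof.
apply: (@complexI R); rewrite -dotxx dotDl !dotDr (dotC y x) !dotxx.
by case: (dot x y) => a b; apply/eqP; rewrite eq_complex /=; apply/andP; split;
  apply/eqP; ring.
Qed.

Lemma cauchy_schwarz x y : normc (dot x y) <= nrm x * nrm y.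
Proof.
rewrite -ler_sqr ?nnegrE ?normc_ge0 ?mulr_ge0 ?nrm_ge0 // exprMn.
have [|c|_ //] := @psd_cross R (nrm x ^+ 2) (nrm y ^+ 2) (dot x y) (dot y x).
  by rewrite sqr_ge0.
have := sqr_ge0 (nrm (x + c *: y)); rewrite -ler0c -(dotxx (x + c *: y)) => h.
by move: h; congr (_ <= _); rewrite !(dotDl, dotDr, dotZl, dotZr) -!dotxx; ring.
Qed.

Lemma dot_nrm_bound x (M : R) : 0 <= M ->
  (forall y, normc (dot x y) <= M * nrm y) -> nrm x <= M.
Proof.
move=> M0 /(_ x); rewrite dotxx normc_real ger0_norm ?sqr_ge0 // expr2.
have [->//|x0] := eqVneq (nrm x) 0.
by rewrite ler_pM2r // lt_def x0 nrm_ge0.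
Qed.

Lemma cvg_dot (T : Type) (F : set_system T) (FF : Filter F) (f g : T -> H) x y :
  f t @[t --> F] --> x -> g t @[t --> F] --> y ->
  (dot (f t) (g t) : R[i]^o) @[t --> F] --> (dot x y : R[i]^o).
Proof.
move=> hf hg; apply/cvgc_normcP => e e0.
have hb : (nrm (f t - x) * nrm (g t) + nrm x * nrm (g t - y)) @[t --> F] --> (0 : R).
  have -> : (0 : R) = nrm (x - x) * nrm y + nrm x * nrm (y - y) by rewrite !subrr
    !nrm0 mul0r mulr0 addr0.
  apply: cvgD; apply: cvgM.
  - by apply: cvg_nrm; apply: cvgB => //; exact: cvg_cst.
  - exact: cvg_nrm.
  - exact: cvg_cst.
  - by apply: cvg_nrm; apply: cvgB => //; exact: cvg_cst.
have /cvgrPdist_lt /(_ e e0) := hb; apply: filterS => t.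
rewrite sub0r normrN; apply: le_lt_trans; apply: le_trans (ler_norm _).
have -> : dot (f t) (g t) - dot x y = dot (f t - x) (g t) + dot x (g t - y).
  by rewrite dotBl dotBr; ring.
by rewrite (le_trans (le_normcD _ _)) // lerD // cauchy_schwarz.
Qed.

Fixpoint orthonormal_seq s : Prop :=
  if s is e :: s' then
    [/\ nrm e = 1, (forall y, y \in s' -> dot y e = 0) & orthonormal_seq s']
  else True.

Definition proj s x : H := \sum_(e <- s) dot x e *: e.

Lemma proj_cons e s x : proj (e :: s) x = dot x e *: e + proj s x.
Proof. by rewrite /proj big_cons. Qed.
Lemma projD s x y : proj s (x + y) = proj s x + proj s y.
Proof. by rewrite /proj -big_split /=; apply: eq_bigr => e _;
  rewrite dotDl scalerDl. Qed.
Lemma projZ s (k : R[i]) x : proj s (k *: x) = k *: proj s x.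
Proof. by rewrite /proj scaler_sumr; apply: eq_bigr => e _; rewrite dotZl scalerA. Qed.
Lemma projB s x y : proj s (x - y) = proj s x - proj s y.
Proof. by rewrite projD -scaleN1r projZ scaleN1r. Qed.
Lemma proj_adj s x y : dot (proj s x) y = dot x (proj s y).
Proof.
rewrite /proj dot_suml dot_sumr; apply: eq_bigr => e _.
by rewrite dotZl dotZr -dotC mulrC.
Qed.
Lemma proj_eq0 s x : (forall e, e \in s -> dot x e = 0) -> proj s x = 0.
Proof. by move=> h; rewrite /proj big_seq big1 // => e /h ->; rewrite scale0r. Qed.
Lemma proj_mem s y : orthonormal_seq s -> y \in s -> proj s y = y.
Proof.
elim: s => //= e s IH [e1 he os]; rewrite inE proj_cons => /orP[/eqP ->|ys].
  rewrite dotxx e1 expr1n scale1r proj_eq0 ?addr0 // => z zs.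
  by rewrite dotC he // rmorph0.
by rewrite he // scale0r add0r IH.
Qed.
Lemma proj_proj s s' x : (forall e, e \in s' -> proj s e = e) ->
  proj s (proj s' x) = proj s' x.
Proof.
elim: s' => [|e s' IH] h; first by rewrite /proj !big_nil big1 // => e _;
  rewrite dot0l scale0r.
rewrite !proj_cons projD projZ h ?mem_head // IH // => y ys.
by rewrite h // inE ys orbT.
Qed.
Lemma projK s x : orthonormal_seq s -> proj s (proj s x) = proj s x.
Proof. by move=> os; apply: proj_proj => e; exact: proj_mem. Qed.
Lemma nrm_subproj s x : orthonormal_seq s -> nrm (x - proj s x) <= nrm x.
Proof.
move=> os; have := cauchy_schwarz x (x - proj s x).
have -> : dot x (x - proj s x) = dot (x - proj s x) (x - proj s x).
  by rewrite dotBl proj_adj projB projK // subrr dot0r subr0.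
rewrite dotxx normc_real ger0_norm ?sqr_ge0 // expr2.
have [->|x0] := eqVneq (nrm (x - proj s x)) 0; first by rewrite nrm_ge0.
by rewrite ler_pM2r // lt_def x0 nrm_ge0.
Qed.
Lemma nrm_subproj_le s x y : orthonormal_seq s -> proj s y = y ->
  nrm (x - proj s x) <= nrm (x - y).
Proof.
move=> os yE; have -> : x - proj s x = (x - y) - proj s (x - y).
  by rewrite projB yE opprB addrA subrK.
exact: nrm_subproj.
Qed.

Definition unitv x : H := (nrm x)^-1%:C *: x.
Lemma nrm_unitv x : x != 0 -> nrm (unitv x) = 1.
Proof.
move=> x0; rewrite nrmZ normc_real ger0_norm ?invr_ge0 ?nrm_ge0 // mulVf //.
by rewrite nrm0_eq0.
Qed.
Lemma unitv1 x : nrm x = 1 -> unitv x = x.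
Proof. by move=> x1; rewrite /unitv x1 invr1 scale1r. Qed.

(** Membership in the span of [s] is expressed by [proj s x = x]; a vector already fixed by [proj s]
    is not added to the list. *)
Lemma gram_schmidt (l : seq H) :
  exists2 s, orthonormal_seq s & forall x, x \in l -> proj s x = x.
Proof.
elim: l => [|x l [s os hs]]; first by exists [::].
have [r0|r0] := eqVneq (x - proj s x) 0.
  exists s => // y; rewrite inE => /orP[/eqP ->|/hs//].
  by apply/eqP; rewrite eq_sym -subr_eq0 r0.
set r := x - proj s x in r0; have pr : proj s r = 0 by rewrite projB projK // subrr.
have pe : proj s (unitv r) = 0 by rewrite projZ pr scaler0.
have he y : proj s y = y -> dot y (unitv r) = 0.
  by move=> <-; rewrite proj_adj pe dot0r.
exists (unitv r :: s).
  by split=> [|y ys|//]; [exact: nrm_unitv | apply/he/proj_mem].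
move=> y; rewrite inE proj_cons => /orP[/eqP ->|/hs yE]; last first.
  by rewrite he // scale0r add0r.
have -> : dot x (unitv r) = (nrm r)%:C.
  have -> : x = r + proj s x by rewrite subrK.
  rewrite dotDl (he (proj s x)) ?projK // addr0 dotZr dotxx expr2.
  by rewrite [X in X * _]conjc_real -rmorphM /= mulKf // nrm0_eq0.
by rewrite scalerA -rmorphM /= mulfV ?nrm0_eq0 // scale1r subrK.
Qed.

(** Infinite dimension in the form that the homotopies consume: a spare direction along which a path
    can dodge 0. *)
Definition infdim := forall l : seq H,
  exists2 e, nrm e = 1 & forall y, y \in l -> dot y e = 0.

Lemma infdimP : infdim \/ exists2 s, orthonormal_seq s & forall x, proj s x = x.
Proof.
apply: contrapT => /not_orP[h1 h2]; apply: h1 => l.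
have [s os hs] := gram_schmidt l.
have [x hx] : exists x, proj s x != x.
  apply: contrapT => h3; apply: h2; exists s => // x; apply/eqP.
  by apply: contrapT => h4; apply: h3; exists x; apply/negP.
exists (unitv (x - proj s x)); first by rewrite nrm_unitv // subr_eq0 eq_sym.
by move=> y /hs <-; rewrite proj_adj projZ projB projK // subrr scaler0 dot0r.
Qed.

(** The functional [q] is bounded below and its minimizing sequences are Cauchy by the parallelogram
    law; the first variation at the minimum [psi] is the claimed identity. *)
Lemma riesz (L : H -> R[i]) (M : R) :
  (forall k x y, L (k *: x + y) = k * L x + L y) ->
  (forall x, normc (L x) <= M * nrm x) ->
  exists psi, forall x, L x = dot x psi.
Proof.
move=> Llin Lbd.
have LD x y : L (x + y) = L x + L y by rewrite -[x in LHS]scale1r Llin mul1r.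
have L0 : L 0 = 0 by apply: (addrI (L 0)); rewrite -LD !addr0.
have LZ k x : L (k *: x) = k * L x by rewrite -[k *: x]addr0 Llin L0 addr0.
pose q x := nrm x ^+ 2 - 2 * complex.Re (L x).
have qlb x : - M ^+ 2 <= q x.
  have := le_trans (ler_norm _) (le_trans (le_Re_normc (L x)) (Lbd x)).
  by have := sqr_ge0 (nrm x - M); rewrite /q sqrrB; lra.
pose E := [set q x | x in [set: H]].
have E0 : E !=set0 by exists (q 0); exists 0.
have Elb : has_lbound E by exists (- M ^+ 2) => _ [x _ <-].
have hinf : has_inf E by split.
pose m := inf E.
have mle x : m <= q x by apply: ge_inf => //; exists x.
have hu n : exists x, q x < m + n.+1%:R^-1.
  have [|_ [x _ <-] hx] := @inf_adherent _ E n.+1%:R^-1 _ hinf;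
    first by rewrite invr_gt0.
  by exists x.
have [u hu'] := choice hu.
have par x y : nrm (x - y) ^+ 2 / 2 = q x + q y - 2 * q (2^-1 *: (x + y)).
  rewrite /q LZ LD nrmZ exprMn !nrmD2 nrmN dotNr.
  have -> : (2^-1 : R[i]) = (2^-1 : R)%:C by rewrite fmorphV /= rmorphMn.
  rewrite normc_real ger0_norm ?invr_ge0 //.
  case: (L x) (L y) (dot x y) => a b [c d] [e f] /=; by field.
have [|psi upsi] := @nrm_cauchy_cvg _ H u.
  move=> e e0.
  (* Both values exceed [m] by less than 1/(N+1) and the midpoint value is at least [m], so [par]
     gives |u n - u N|^2 < 4/(N+1). *)
  have [N hN] : exists N : nat, N.+1%:R^-1 < e ^+ 2 / 4.
    have e2 : 0 < e ^+ 2 / 4 by rewrite divr_gt0 // exprn_gt0.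
    have /cvgrPdist_lt /(_ _ e2) [N _ hN] := @cvg_harmonic R.
    by exists N; have := hN N (leqnn N); rewrite sub0r normrN ger0_norm // invr_ge0.
  exists N => n Nn; rewrite -ltr_sqr ?nnegrE ?nrm_ge0 ?(ltW e0) //.
  have := par (u n) (u N); have := hu' n; have := hu' N.
  have := mle (2^-1 *: (u n + u N)).
  have : n.+1%:R^-1 <= N.+1%:R^-1 :> R by rewrite lef_pV2 ?posrE // ler_nat.
  move: hN; move: (N.+1%:R^-1) (n.+1%:R^-1) (nrm (u n - u N) ^+ 2) (q (u n)) (q (u
    N)) (q _).
  by move=> *; lra.
have Lcvg : (L (u n) : R[i]^o) @[n --> \oo] --> (L psi : R[i]^o).
  apply/cvgc_normcP => e e0.
  have M1 : 0 < `|M| + 1 by rewrite ltr_wpDl.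
  have e1 : 0 < e / (`|M| + 1) by rewrite divr_gt0.
  have /cvg_nrmP /(_ _ e1) := upsi; apply: filterS => n.
  rewrite ltr_pdivlMr // => hn.
  have -> : L (u n) - L psi = L (u n - psi) by rewrite LD -[- psi]scaleN1r LZ mulN1r.
  apply: le_lt_trans (Lbd _) _; apply: le_lt_trans hn.
  rewrite mulrC ler_wpM2l ?nrm_ge0 // (le_trans (ler_norm M)) // lerDl.
  exact: ler01.
have qcvg : q (u n) @[n --> \oo] --> q psi.
  apply: cvgB; first by rewrite expr2; under eq_fun do rewrite expr2; apply: cvgM;
    apply: cvg_nrm.
  by apply: cvgM; [exact: cvg_cst | exact: cvg_Re].
have qpsi : q psi <= m.
  suff h (e : R) : 0 < e -> q psi <= m + e by apply/ler_addgt0Pr => e; exact: h.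
  move=> e0.
  have e2 : 0 < e / 2 by lra.
  have /cvgrPdist_lt /(_ _ e2) [N1 _ hN1] := qcvg.
  have /cvgrPdist_lt /(_ _ e2) [N2 _ hN2] := @cvg_harmonic R.
  have := hN1 (maxn N1 N2) (leq_maxl _ _); have := hN2 (maxn N1 N2) (leq_maxr _ _).
  rewrite /= sub0r normrN ger0_norm ?invr_ge0 // => h1.
  rewrite ltr_norml => /andP[_]; have := hu' (maxn N1 N2); move: h1.
  by move: (q psi) (q (u _)) (_.+1%:R^-1) => x y z *; lra.
exists psi => v; pose z := dot v psi - L v.
(* q (psi + c v) - q psi is this form, with constant term 0 and cross coefficient z; hence |z|^2 <=
   0. *)
have [|c|_ ] := @psd_cross R 0 (nrm v ^+ 2) z^* z; first exact: sqr_ge0.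
  rewrite add0r.
  have := le_trans qpsi (mle (psi + c *: v)).
  rewrite /q nrmD2 LD LZ dotC dotZl nrmZ exprMn /z normcE2.
  case: (dot v psi) (L v) (L psi) c => a b [a' b'] [e f] [c d] /=.
  rewrite lecE /= => h; apply/andP; split; first by apply/eqP; ring.
  by move: h; rewrite -subr_ge0; congr (_ <= _); ring.
rewrite normcJ mul0r => h.
have : normc z = 0 by apply/eqP; rewrite -sqrf_eq0 eq_le h sqr_ge0.
by move/Normc.eq0_normc/eqP; rewrite subr_eq0 => /eqP.
Qed.

End HilbertBasics.

(** * Growth of powers against a constant, and finite nets *)

Section Extra.
Variable R : realType.
Local Notation normc := Normc.normc.
Local Notation "x %:C" := (x%:C)%C.

Lemma bernoulli (h : R) n : 0 <= h -> 1 + n%:R * h <= (1 + h) ^+ n.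
Proof.
move=> h0; elim: n => [|n IH]; first by rewrite mul0r addr0 expr0.
rewrite exprS; apply: le_trans (ler_wpM2l _ IH); last by rewrite addr_ge0.
have : 0 <= n%:R * h ^+ 2 by rewrite mulr_ge0 // sqr_ge0.
rewrite -natr1; lra.
Qed.

(** If x > y > 0, then (x/y)^(2^k) outgrows every constant by Bernoulli. This removes the factor C
    left over when the C*-identity is applied to repeated squares. *)
Lemma le_pow2_const (C x y : R) : 0 <= x -> 0 <= y ->
  (forall k, x ^+ (2 ^ k)%N <= C * y ^+ (2 ^ k)%N) -> x <= y.
Proof.
move=> x0 y0 h; rewrite leNgt; apply/negP => yx.
have [y00|yn] := eqVneq y 0.
  by have := h 0%N; rewrite y00 expn0 !expr1 mulr0 => ?; lra.
have yp : 0 < y by rewrite lt_def yn.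
pose r := x / y - 1.
have r0 : 0 < r by rewrite subr_gt0 ltr_pdivlMr // mul1r.
have hC k : k%:R * r <= C.
  have := h k; rewrite -ler_pdivrMr ?exprn_gt0 // -expr_div_n.
  have -> : x / y = 1 + r by rewrite /r; ring.
  apply: le_trans; apply: le_trans (bernoulli _ (ltW r0)).
  rewrite -[leLHS]add0r lerD // ler_wpM2r ?(ltW r0) // ler_nat.
  exact/ltnW/ltn_expl.
have C0 : 0 <= C by have := hC 0%N; rewrite mul0r.
have := hC (Num.truncn (C / r)).+1.
by rewrite -ler_pdivlMr // leNgt truncnS_gt.
Qed.

Lemma finite_net (V : normedModType R[i]) (K : set V) (e : R) : compact K -> 0 < e ->
  exists l : seq V, forall x, K x -> exists2 y, y \in l & nrm (x - y) < e.
Proof.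
move=> cK e0; have := cK; rewrite compact_cover => /(_ V K (fun y => ball y e%:C)).
case=> [y _||l lK Kl].
- by apply: ball_open; rewrite ltcR.
- by move=> x Kx; exists x => //; apply: ballxx; rewrite ltcR.
exists (finmap.enum_fset l) => x /Kl [y ly]; exists y => //.
by move: q; rewrite -ball_normE /ball_ /= nrm_distC -nrmPlt.
Qed.
End Extra.

(** * C*-algebras *)

Section CompactOperators.
Variables (R : realType) (H : hilbertType R).
Local Notation normc := Normc.normc.
Local Notation "x %:C" := (x%:C)%C.

(** For z in the unit ball the coefficient [dot z y] stays in a square of half-side |y|, so the
    image of the ball lies in a continuous image of a compact square. *)
Lemma compact_rank_one (x y : H) : compact_operator (fun z => dot z y *: x).
Proof.
split; first by move=> k a b; rewrite /= dotDl dotZl scalerDl scalerA.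
set I := `[- nrm y, nrm y]%classic.
pose F (p : R * R) : H := (p.1 +i* p.2)%C *: x.
have cF : continuous F.
  move=> p; apply: cvgZ; last exact: cvg_cst.
  by apply: cvg_complex; [exact: cvg_fst | exact: cvg_snd].
have cK : compact (F @` (I `*` I)).
  apply: continuous_compact; first exact: continuous_subspaceT.
  by apply: compact_setX; exact: segment_compact.
apply: (@precompact_subset _ _ (F @` (I `*` I))); last first.
  by rewrite precompact_closed //; apply: compact_closed => //; exact: norm_hausdorff.
move=> _ [z /= z1 <-]; exists (complex.Re (dot z y), complex.Im (dot z y)); last first.
  by rewrite /F /=; case: (dot z y).
have hz : normc (dot z y) <= nrm y.
  apply: le_trans (cauchy_schwarz _ _) _; rewrite ler_piMl ?nrm_ge0 //.
  by rewrite -nrmP.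
by split; rewrite /I /= in_itv /= -ler_norml (le_trans _ hz) // (le_Re_normc,
  le_Im_normc).
Qed.
End CompactOperators.

Section CStarBasics.
Variables (R : realType) (A : cstarAlgType R).
Local Notation normc := Normc.normc.
Local Notation "x %:C" := (x%:C)%C.
Local Notation "a ** b" := (cmul a b) (at level 40, left associativity).
Implicit Types a b c d p : A.

Lemma cmulDl a b c : (a + b) ** c = a ** c + b ** c.
Proof. by have := cmul_linearl c 1 a b; rewrite !scale1r. Qed.
Lemma cmulDr a b c : a ** (b + c) = a ** b + a ** c.
Proof. by have := cmul_linearr a 1 b c; rewrite !scale1r. Qed.
Lemma cmul0l c : (0 : A) ** c = 0.
Proof. by apply: (addrI (0 ** c)); rewrite -cmulDl !addr0. Qed.
Lemma cmul0r c : c ** (0 : A) = 0.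
Proof. by apply: (addrI (c ** 0)); rewrite -cmulDr !addr0. Qed.
Lemma cmulZl (k : R[i]) a b : (k *: a) ** b = k *: (a ** b).
Proof. by have := cmul_linearl b k a 0; rewrite !addr0 cmul0l addr0. Qed.
Lemma cmulZr (k : R[i]) a b : a ** (k *: b) = k *: (a ** b).
Proof. by have := cmul_linearr a k b 0; rewrite !addr0 cmul0r addr0. Qed.
Lemma cmulNl a b : (- a) ** b = - (a ** b).
Proof. by rewrite -scaleN1r cmulZl scaleN1r. Qed.
Lemma cmulNr a b : a ** (- b) = - (a ** b).
Proof. by rewrite -scaleN1r cmulZr scaleN1r. Qed.
Lemma cmulBl a b c : (a - b) ** c = a ** c - b ** c.
Proof. by rewrite cmulDl cmulNl. Qed.
Lemma cmulBr a b c : a ** (b - c) = a ** b - a ** c.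
Proof. by rewrite cmulDr cmulNr. Qed.
Lemma cmul_suml (I : Type) (r : seq I) (F : I -> A) c :
  (\sum_(i <- r) F i) ** c = \sum_(i <- r) F i ** c.
Proof. by elim: r => [|i r IH]; rewrite ?big_nil ?cmul0l // !big_cons cmulDl IH. Qed.
Lemma cadj0 : cadj (0 : A) = 0.
Proof. by have := @cadj_antilinear R A 1 0 0; rewrite !rmorph1 !scale1r addr0 => h;
  apply: (addrI (cadj 0)); rewrite -h addr0. Qed.
Lemma cadjD a b : cadj (a + b) = cadj a + cadj b.
Proof. by have := @cadj_antilinear R A 1 a b; rewrite !rmorph1 !scale1r. Qed.
Lemma cadjZ (k : R[i]) a : cadj (k *: a) = k^* *: cadj a.
Proof. by have := @cadj_antilinear R A k a 0; rewrite cadj0 !addr0. Qed.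
Lemma cadjN a : cadj (- a) = - cadj a.
Proof. by rewrite -scaleN1r cadjZ rmorphN rmorph1 scaleN1r. Qed.
Lemma cadjB a b : cadj (a - b) = cadj a - cadj b.
Proof. by rewrite cadjD cadjN. Qed.

Lemma nrm_cmul a b : nrm (a ** b) <= nrm a * nrm b.
Proof. by rewrite -lecR rmorphM /= -!nrmE cmul_norm. Qed.
Lemma nrm_cstar a : nrm (cadj a ** a) = nrm a ^+ 2.
Proof. by apply: (@complexI R); rewrite rmorphXn /= -!nrmE cstar_norm. Qed.
Lemma nrm_cadj a : nrm (cadj a) = nrm a.
Proof.
suff h b : nrm b <= nrm (cadj b) by apply/eqP; rewrite eq_le h -{2}(cadjK a) h.
have := nrm_cmul (cadj b) b; rewrite nrm_cstar expr2.
have [->|b0] := eqVneq (nrm b) 0; first by rewrite nrm_ge0.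
by rewrite ler_pM2r // lt_def b0 nrm_ge0.
Qed.
Lemma nrm_cstar' a : nrm (a ** cadj a) = nrm a ^+ 2.
Proof. by rewrite -(nrm_cadj a) -nrm_cstar cadjK. Qed.

Lemma nrm_projection p : cadj p = p -> p ** p = p -> p != 0 -> nrm p = 1.
Proof.
move=> ps pp p0; have := nrm_cstar p; rewrite ps pp expr2 -{1}[nrm p]mulr1.
by move/(mulfI _) => <- //; rewrite nrm0_eq0.
Qed.

(* a^(2^k): the algebra carries no ring structure. *)
Definition csq k a : A := iter k (fun d => d ** d) a.

Lemma csqS k a : csq k.+1 a = csq k a ** csq k a. Proof. by []. Qed.

Lemma csq_adj k a : cadj a = a -> cadj (csq k a) = csq k a.
Proof. by move=> h; elim: k => //= k IH; rewrite -/(csq k a) cadjM IH. Qed.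

Lemma nrm_csq k a : cadj a = a -> nrm (csq k a) = nrm a ^+ (2 ^ k)%N.
Proof.
move=> h; elim: k => [|k IH]; first by rewrite expn0 expr1.
by rewrite csqS -{1}(csq_adj k h) nrm_cstar IH expnS mulnC exprM.
Qed.

(* (p + d)^(2^k) = p + d^(2^k) has norm at most 2. *)
Lemma nrm_orthogonal_add p d : cadj p = p -> p ** p = p -> nrm p <= 1 ->
  cadj d = d -> p ** d = 0 -> nrm d <= 1 -> nrm (p + d) <= 1.
Proof.
move=> ps pp p1 ds pd d1.
have dp : d ** p = 0 by rewrite -ps -ds -cadjM pd cadj0.
have hk k : [/\ csq k (p + d) = p + csq k d, p ** csq k d = 0 & csq k d ** p = 0].
  elim: k => [//|k [h1 h2 h3]]; rewrite !csqS h1 cmulDl !cmulDr pp h2 h3 addr0 add0r.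
  by rewrite cmulA h2 cmul0l -cmulA h3 cmul0r.
apply: (@le_pow2_const R 2) => [||k]; rewrite ?nrm_ge0 //.
rewrite expr1n mulr1 -nrm_csq; last by rewrite cadjD ps ds.
have [-> _ _] := hk k; apply: le_trans (nrmD _ _) _.
rewrite (_ : 2 = 1 + 1) // lerD // nrm_csq // exprn_ile1 ?nrm_ge0 //.
Qed.

Section Functionals.
Variable f : A -> R[i].
Hypothesis flin : scalar f.

Lemma func_D a b : f (a + b) = f a + f b.
Proof. by have := flin 1 a b; rewrite scale1r mul1r. Qed.
Lemma func_0 : f 0 = 0.
Proof. by apply: (addrI (f 0)); rewrite -func_D !addr0. Qed.
Lemma func_Z (k : R[i]) a : f (k *: a) = k * f a.
Proof. by have := flin k a 0; rewrite !addr0 func_0 addr0. Qed.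
Lemma func_N a : f (- a) = - f a.
Proof. by rewrite -scaleN1r func_Z mulN1r. Qed.
Lemma func_B a b : f (a - b) = f a - f b.
Proof. by rewrite func_D func_N. Qed.
Lemma func_sum (I : Type) (r : seq I) (F : I -> A) :
  f (\sum_(i <- r) F i) = \sum_(i <- r) f (F i).
Proof. by elim: r => [|i r IH]; rewrite ?big_nil ?func_0 // !big_cons func_D IH. Qed.

Lemma func_bound (M : R) : (forall a, nrm a <= 1 -> normc (f a) <= M) ->
  forall a, normc (f a) <= M * nrm a.
Proof.
move=> h a; have [->|a0] := eqVneq a 0.
  by rewrite func_0 nrm0 mulr0 (_ : (0 : R[i]) = 0%:C) // normc_real normr0.
have na : 0 < nrm a by rewrite nrm_gt0.
have := h ((nrm a)^-1%:C *: a); rewrite nrmZ normc_real ger0_norm ?invr_ge0 ?nrm_ge0 //.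
rewrite mulVf ?gt_eqF // => /(_ (lexx _)).
by rewrite func_Z Normc.normcM normc_real ger0_norm ?invr_ge0 ?nrm_ge0 // ler_pdivrMl
  // mulrC.
Qed.

Hypothesis fpos : forall a, 0 <= f (cadj a ** a).

Lemma func_real a : f (cadj a ** a) = (complex.Re (f (cadj a ** a)))%:C.
Proof. by have := fpos a; case: (f _) => u v; rewrite lecE /= => /andP[/eqP ->]. Qed.

Lemma func_ge0 a : 0 <= complex.Re (f (cadj a ** a)).
Proof. by have := fpos a; rewrite func_real ler0c. Qed.

Lemma func_cauchy_schwarz a b : normc (f (cadj a ** b)) ^+ 2 <=
  complex.Re (f (cadj a ** a)) * complex.Re (f (cadj b ** b)).
Proof.
rewrite mulrC.
have [|c|_ ] := @psd_cross R (complex.Re (f (cadj b ** b)))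
  (complex.Re (f (cadj a ** a))) (f (cadj a ** b)) (f (cadj b ** a)).
- exact: func_ge0.
- rewrite -!func_real; have := fpos (b + c *: a); congr (_ <= _).
  by rewrite cadjD cadjZ !(cmulDl, cmulDr, cmulZl, cmulZr, func_D, func_Z); ring.
- by [].
Qed.
End Functionals.

Section DualNorm.
Variable f : A -> R[i].

Lemma dual_norm_le (M : R) :
  (forall a, nrm a <= 1 -> normc (f a) <= M) -> dual_norm f <= M.
Proof.
move=> h; apply: ge_sup; first by exists (normc (f 0)), 0; rewrite //= normr0 ler01.
by move=> _ [a /= a1 <-]; apply: h; rewrite -nrmP.
Qed.

(** The bound [B] certifies that the supremum is taken over a bounded set; otherwise [sup] would be
    0. *)
Lemma dual_norm_ub (B : R) : (forall a, nrm a <= 1 -> normc (f a) <= B) ->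
  forall a, nrm a <= 1 -> normc (f a) <= dual_norm f.
Proof.
move=> h a a1; apply: sup_upper_bound; last by exists a => //=; rewrite nrmE lecR.
split; first by exists (normc (f 0)), 0; rewrite //= normr0 ler01.
by exists B => _ [b /= b1 <-]; apply: h; rewrite -nrmP.
Qed.

(** An unbounded functional would have the default supremum 0, against [dual_norm f = 1]; so the
    supremum is genuine. *)
Lemma state_bound : state f -> forall a, normc (f a) <= nrm a.
Proof.
case=> flin _ f1 a; rewrite -[nrm a]mul1r; apply: func_bound => // b b1.
rewrite -f1; apply: sup_upper_bound; last by exists b => //=; rewrite nrmE lecR.
apply: contrapT => h; move: f1; rewrite /dual_norm sup_out // => /eqP.
by rewrite eq_sym oner_eq0.
Qed.
End DualNorm.
End CStarBasics.

(** * The algebra of compact operators *)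

Section Elementary.
Variables (R : realType) (A : cstarAlgType R) (H : hilbertType R).
Variable phi : A -> H -> H.
Hypothesis hphi : star_iso_compact phi.
Local Notation normc := Normc.normc.
Local Notation "x %:C" := (x%:C)%C.
Local Notation "a ** b" := (cmul a b) (at level 40, left associativity).
Implicit Types (a b c d p : A) (x y z psi : H) (s : seq H).

Lemma op_lin a (k : R[i]) x y : phi a (k *: x + y) = k *: phi a x + phi a y.
Proof. by case: hphi => -[+ _ _] _ _ _ => /(_ a I) [h _]; exact: h. Qed.
Lemma op_precompact a : precompact (phi a @` [set x : H | `|x| <= 1]).
Proof. by case: hphi => -[+ _ _] _ _ _ => /(_ a I) [_]. Qed.
Lemma op_D a x y : phi a (x + y) = phi a x + phi a y.
Proof. by rewrite -[x in LHS]scale1r op_lin scale1r. Qed.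
Lemma op_0 a : phi a 0 = 0.
Proof. by apply: (addrI (phi a 0)); rewrite -op_D !addr0. Qed.
Lemma op_Z a (k : R[i]) x : phi a (k *: x) = k *: phi a x.
Proof. by rewrite -[k *: x]addr0 op_lin op_0 addr0. Qed.
Lemma op_B a x y : phi a (x - y) = phi a x - phi a y.
Proof. by rewrite op_D -scaleN1r op_Z scaleN1r. Qed.

Lemma phi_D a b x : phi (a + b) x = phi a x + phi b x.
Proof. by case: hphi => _ h _ _; have := h 1 a b x; rewrite !scale1r. Qed.
Lemma phi_0 x : phi 0 x = 0.
Proof. by apply: (addrI (phi 0 x)); rewrite -phi_D !addr0. Qed.
Lemma phi_Z (k : R[i]) a x : phi (k *: a) x = k *: phi a x.
Proof. by case: hphi => _ h _ _; have := h k a 0 x; rewrite phi_0 !addr0. Qed.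
Lemma phi_B a b x : phi (a - b) x = phi a x - phi b x.
Proof. by rewrite phi_D -scaleN1r phi_Z scaleN1r. Qed.
Lemma phi_sum (I : Type) (r : seq I) (F : I -> A) x :
  phi (\sum_(i <- r) F i) x = \sum_(i <- r) phi (F i) x.
Proof. by elim: r => [|i r IH]; rewrite ?big_nil ?phi_0 // !big_cons phi_D IH. Qed.
Lemma phi_M a b x : phi (a ** b) x = phi a (phi b x).
Proof. by case: hphi. Qed.
Lemma phi_adjl a x y : dot (phi (cadj a) x) y = dot x (phi a y).
Proof. by case: hphi => _ _ _; exact. Qed.
Lemma phi_adjr a x y : dot (phi a x) y = dot x (phi (cadj a) y).
Proof. by rewrite -phi_adjl cadjK. Qed.
Lemma phi_inj a b : (forall x, phi a x = phi b x) -> a = b.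
Proof. by move=> h; case: hphi => -[_ hi _] _ _ _; apply: hi; rewrite ?inE //;
  exact/funext. Qed.

(** The element of A that represents the rank-one operator of [compact_rank_one]; surjectivity of
    [phi] keeps [xget] from returning its default. *)
Definition rk x y : A := xget 0 [set a | phi a = fun z => dot z y *: x].

Lemma rkE x y z : phi (rk x y) z = dot z y *: x.
Proof.
suff : phi (rk x y) = fun z => dot z y *: x by move=> ->.
case: hphi => -[_ _ hs] _ _ _.
have [a _ ha] := hs _ (compact_rank_one x y).
exact: (@xgetPex _ 0 [set a | phi a = fun z => dot z y *: x] (ex_intro _ a ha)).
Qed.

Lemma rkZl (k : R[i]) x y : rk (k *: x) y = k *: rk x y.
Proof. by apply: phi_inj => z; rewrite phi_Z !rkE !scalerA mulrC. Qed.
Lemma rkDr x y z : rk x (y + z) = rk x y + rk x z.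
Proof. by apply: phi_inj => w; rewrite phi_D !rkE dotDr scalerDl. Qed.
Lemma rkZr (k : R[i]) x y : rk x (k *: y) = k^* *: rk x y.
Proof. by apply: phi_inj => z; rewrite phi_Z !rkE dotZr scalerA. Qed.
Lemma cadj_rk x y : cadj (rk x y) = rk y x.
Proof.
apply: phi_inj => z; apply: dot_inj => w.
by rewrite phi_adjl !rkE dotZl dotZr -dotC mulrC.
Qed.
Lemma mul_rk a x y : a ** rk x y = rk (phi a x) y.
Proof. by apply: phi_inj => z; rewrite phi_M !rkE op_Z. Qed.
Lemma rk_mul a x y : rk x y ** a = rk x (phi (cadj a) y).
Proof. by apply: phi_inj => z; rewrite phi_M !rkE phi_adjr. Qed.
Lemma rk_rk x y z w : rk x y ** rk z w = dot z y *: rk x w.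
Proof. by rewrite mul_rk rkE rkZl. Qed.
Lemma rk_sandwich a psi : rk psi psi ** a ** rk psi psi = dot (phi a psi) psi *: rk
  psi psi.
Proof. by rewrite -cmulA mul_rk mul_rk rkE rkZl. Qed.

Lemma rk_idem psi : nrm psi = 1 -> rk psi psi ** rk psi psi = rk psi psi.
Proof. by move=> h; rewrite rk_rk dotxx h expr1n scale1r. Qed.

Lemma nrm_rk1 psi : nrm psi = 1 -> nrm (rk psi psi) = 1.
Proof.
move=> h; apply: nrm_projection; [exact: cadj_rk|exact: rk_idem|].
apply/eqP => h0; have := rkE psi psi psi;
  rewrite h0 phi_0 dotxx h expr1n scale1r => /eqP.
by rewrite eq_sym -nrm0_eq0 h oner_eq0.
Qed.

Lemma unitvK x : x = (nrm x)%:C *: unitv x.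
Proof.
have [->|x0] := eqVneq x 0; first by rewrite /unitv !scaler0.
by rewrite scalerA -rmorphM /= mulfV ?nrm0_eq0 // scale1r.
Qed.

(** A unit vector gives a nonzero projection, which has norm 1; scaling settles [rk z z]. The
    C*-identity reduces [rk x y] to this case, since its adjoint times itself is |x|^2 [rk y y]. *)
Lemma nrm_rk x y : nrm (rk x y) = nrm x * nrm y.
Proof.
have hd z : nrm (rk z z) = nrm z ^+ 2.
  have [->|z0] := eqVneq z 0.
    rewrite nrm0 expr0n /=; apply/eqP; rewrite nrm0_eq0; apply/eqP/phi_inj => w.
    by rewrite rkE scaler0 phi_0.
  rewrite {1 2}(unitvK z) rkZl rkZr !nrmZ normcJ nrm_rk1 ?nrm_unitv //.
  by rewrite normc_real ger0_norm ?nrm_ge0 // mulr1 expr2.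
apply/eqP; rewrite -(@eqrXn2 _ 2) ?mulr_ge0 ?nrm_ge0 //.
rewrite -nrm_cstar cadj_rk rk_rk nrmZ hd dotxx normc_real ger0_norm ?sqr_ge0 //.
by rewrite exprMn.
Qed.

(* For |x| = 1, |phi a x| is the norm of a times the projection onto x. *)
Lemma nrm_phi a x : nrm (phi a x) <= nrm a * nrm x.
Proof.
have [->|x0] := eqVneq x 0; first by rewrite op_0 nrm0 mulr0.
have := nrm_cmul a (rk x x); rewrite mul_rk !nrm_rk mulrA ler_pM2r // nrm_gt0 //.
Qed.

Definition projA s : A := \sum_(e <- s) rk e e.

Lemma phi_projA s x : phi (projA s) x = proj s x.
Proof. by rewrite phi_sum; apply: eq_bigr => e _; rewrite rkE. Qed.

Lemma cadj_projA s : cadj (projA s) = projA s.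
Proof.
rewrite /projA; elim: s => [|e s IH]; first by rewrite !big_nil cadj0.
by rewrite !big_cons cadjD cadj_rk IH.
Qed.

Lemma projA_idem s : orthonormal_seq s -> projA s ** projA s = projA s.
Proof. by move=> os; apply: phi_inj => x; rewrite phi_M !phi_projA projK. Qed.

Lemma nrm_projA s : orthonormal_seq s -> nrm (projA s) <= 1.
Proof.
move=> os; have [->|h] := eqVneq (projA s) 0; first by rewrite nrm0 ler01.
by rewrite nrm_projection ?cadj_projA ?projA_idem.
Qed.

Lemma orthonormal_seq1 s e : orthonormal_seq s -> e \in s -> nrm e = 1.
Proof. by elim: s => //= e' s IH [h _ /IH {}IH]; rewrite inE => /orP[/eqP -> //|]. Qed.

(** Each summand [rk e e ** d] equals [rk e (phi (cadj d) e)], whose norm is known exactly; summing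
    costs the factor [size s]. *)
Lemma nrm_finite_rank s d (M : R) : orthonormal_seq s -> projA s ** d = d ->
  (forall x, nrm (phi (cadj d) x) <= M * nrm x) -> nrm d <= (size s)%:R * M.
Proof.
move=> os <-; rewrite cmul_suml => h.
apply: le_trans (nrm_sum _ _) _.
have -> : (size s)%:R * M = \sum_(e <- s) M by rewrite big_const_seq count_predT
  iter_addr_0 mulr_natl.
rewrite big_seq [leRHS]big_seq; apply: ler_sum => e es.
rewrite rk_mul nrm_rk (orthonormal_seq1 os es) mul1r.
have -> : phi (cadj d) e = phi (cadj (projA s ** d)) e.
  by rewrite cadjM phi_M cadj_projA phi_projA proj_mem.
by rewrite /projA cmul_suml; have := h e; rewrite (orthonormal_seq1 os es) mulr1.
Qed.

Lemma phi_cadj_bound a (M : R) : 0 <= M -> (forall x, nrm (phi a x) <= M * nrm x) ->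
  forall x, nrm (phi (cadj a) x) <= M * nrm x.
Proof.
move=> M0 h x; apply: dot_nrm_bound => [|y]; first by rewrite mulr_ge0 ?nrm_ge0.
rewrite phi_adjl; apply: le_trans (cauchy_schwarz _ _) _.
by rewrite [M * _]mulrC -mulrA ler_wpM2l ?nrm_ge0.
Qed.

(* The bound of nrm_finite_rank for (c c^* )^(2^k), whose constant size s does not
   depend on k, becomes sharp as k grows. *)
Lemma nrm_finite_rank_le s c (M : R) : orthonormal_seq s -> projA s ** c = c ->
  0 <= M -> (forall x, nrm (phi c x) <= M * nrm x) -> nrm c <= M.
Proof.
move=> os cE M0 hM; rewrite -ler_sqr ?nnegrE ?nrm_ge0 // -nrm_cstar'.
set b := c ** cadj c.
have bs : cadj b = b by rewrite cadjM cadjK.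
have bE : projA s ** b = b by rewrite cmulA cE.
have hb k : projA s ** csq k b = csq k b /\
    forall x, nrm (phi (csq k b) x) <= (M ^+ 2) ^+ (2 ^ k)%N * nrm x.
  elim: k => [|k [h1 h2]].
    split=> // x; rewrite expn0 expr1 phi_M; apply: le_trans (hM _) _.
    by rewrite expr2 -mulrA ler_wpM2l // phi_cadj_bound.
  rewrite csqS cmulA h1; split=> // x; rewrite phi_M; apply: le_trans (h2 _) _.
  by rewrite expnS mul2n -addnn exprD -mulrA ler_wpM2l ?exprn_ge0.
apply: (@le_pow2_const R (size s)%:R); rewrite ?nrm_ge0 ?exprn_ge0 // => k.
rewrite -nrm_csq //; have [h1 h2] := hb k; apply: nrm_finite_rank => // x.
by rewrite csq_adj.
Qed.

(** A finite net of the precompact image of the unit ball spans a finite-dimensional space, and the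
    projection onto it comes at least as close as the nearest point of the net. *)
Lemma finite_rank_approx a (e : R) : 0 < e -> exists2 s, orthonormal_seq s &
  forall x, nrm (phi a x - proj s (phi a x)) <= e * nrm x.
Proof.
move=> e0; have [U hU [cU _]] := op_precompact a.
have [l hl] := finite_net cU e0.
have [s os hs] := gram_schmidt l; exists s => // x.
rewrite [in phi a x](unitvK x) op_Z projZ -scalerBr nrmZ normc_real ger0_norm
  ?nrm_ge0 //.
rewrite mulrC; have [->|x0] := eqVneq x 0; first by rewrite nrm0 !mulr0.
rewrite ler_wpM2r ?nrm_ge0 //.
have [y yl hy] : exists2 y, y \in l & nrm (phi a (unitv x) - y) < e.
  by apply: hl; apply: hU; exists (unitv x) => //=; rewrite nrmE nrm_unitv ?lexx.
by apply: le_trans (ltW hy); apply: nrm_subproj_le => //; exact: hs.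
Qed.

(** The truncations [c n] approximate [a] as operators only. They are Cauchy in A because their
    differences have finite rank, where [nrm_finite_rank_le] bounds the norm; their limit acts on H
    like [a], so it is [a] by injectivity of [phi]. *)
Lemma finite_rank_dense a (e : R) : 0 < e ->
  exists2 s, orthonormal_seq s & nrm (a - projA s ** a) < e.
Proof.
have hs n : exists s, orthonormal_seq s /\
    forall x, nrm (phi a x - proj s (phi a x)) <= n.+1%:R^-1 * nrm x.
  have [|s os h] := @finite_rank_approx a n.+1%:R^-1; first by rewrite invr_gt0.
  by exists s.
have [S {}hs] := choice hs.
pose c n := projA (S n) ** a.
have cop n x : nrm (phi a x - phi (c n) x) <= n.+1%:R^-1 * nrm x.
  by rewrite phi_M phi_projA; have [_] := hs n.
have cc n m : nrm (c n - c m) <= n.+1%:R^-1 + m.+1%:R^-1.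
  have [s os hsub] := gram_schmidt (S n ++ S m).
  have hp k : {subset S k <= S n ++ S m} -> projA s ** c k = c k.
    move=> hk; apply: phi_inj => x; rewrite !phi_M !phi_projA.
    by apply: proj_proj => e' /hk; exact: hsub.
  apply: (nrm_finite_rank_le os); rewrite ?addr_ge0 ?invr_ge0 //.
    by rewrite cmulBr !hp // => x; rewrite mem_cat => ->; rewrite ?orbT.
  move=> x; rewrite phi_B mulrDl.
  have -> : phi (c n) x - phi (c m) x = (phi a x - phi (c m) x) - (phi a x - phi (c
    n) x).
    by rewrite opprB [RHS]addrC addrA subrK.
  by apply: le_trans (nrmB _ _) _; rewrite addrC lerD.
have small (r : R) : 0 < r -> exists N, forall n, (N <= n)%N -> n.+1%:R^-1 < r.
  move=> r0; have /cvgrPdist_lt /(_ _ r0) [N _ hN] := @cvg_harmonic R.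
  by exists N => n /hN /=; rewrite sub0r normrN ger0_norm // invr_ge0.
have [|b cb] := @nrm_cauchy_cvg _ A c.
  move=> r r0; have [|N hN] := small (r / 2); first by rewrite divr_gt0.
  exists N => n Nn; apply: le_lt_trans (cc _ _) _; rewrite [r]splitr.
  by rewrite ltrD // hN.
have ab : a = b.
  apply: phi_inj => x; apply/eqP; rewrite -subr_eq0 -nrm0_eq0 eq_le nrm_ge0 andbT.
  suff h (r : R) : 0 < r -> nrm (phi a x - phi b x) <= r * nrm x.
    have [x0|x0] := eqVneq (nrm x) 0.
      by have := h 1 ltr01; rewrite x0 mulr0.
    apply/ler_addgt0Pr => r r0; rewrite add0r.
    have nx : 0 < nrm x by rewrite lt_def x0 nrm_ge0.
    by have := h (r / nrm x) (divr_gt0 r0 nx); rewrite divfK.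
  move=> r0; have r2 : 0 < r / 2 by rewrite divr_gt0.
  have [N1 hN1] := small _ r2.
  have /cvg_nrmP /(_ _ r2) [N2 _ hN2] := cb.
  set n := maxn N1 N2.
  have -> : phi a x - phi b x = (phi a x - phi (c n) x) + phi (c n - b) x.
    by rewrite phi_B addrA subrK.
  apply: le_trans (nrmD _ _) _; rewrite [r]splitr mulrDl lerD //.
    apply: le_trans (cop _ _) _; rewrite ler_wpM2r ?nrm_ge0 // ltW // hN1 //.
    exact: leq_maxl.
  apply: le_trans (nrm_phi _ _) _; rewrite ler_wpM2r ?nrm_ge0 // ltW //.
  by apply: hN2; exact: leq_maxr.
move=> e0; have /cvg_nrmP /(_ _ e0) [N _ hN] := cb.
exists (S N); first by have [] := hs N.
by rewrite {1}ab nrm_distC; exact: (hN N (leqnn N)).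
Qed.

End Elementary.

(** * Pure states are vector states *)

Section PureStates.
Variables (R : realType) (A : cstarAlgType R) (H : hilbertType R).
Variable phi : A -> H -> H.
Hypothesis hphi : star_iso_compact phi.
Local Notation normc := Normc.normc.
Local Notation "x %:C" := (x%:C)%C.
Local Notation "a ** b" := (cmul a b) (at level 40, left associativity).
Local Notation rk := (rk phi).
Local Notation projA := (projA phi).
Implicit Types (a b c d p : A) (x y z psi : H) (s : seq H).

Definition vec psi a : R[i] := dot (phi a psi) psi.

Lemma vec_scalar psi : scalar (vec psi).
Proof. by move=> k a b; rewrite /vec (phi_D hphi) (phi_Z hphi) dotDl dotZl. Qed.

Lemma vec_sq psi a : vec psi (cadj a ** a) = (nrm (phi a psi) ^+ 2)%:C.
Proof. by rewrite /vec (phi_M hphi) (phi_adjl hphi) dotxx. Qed.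

Lemma vec_bound psi a : normc (vec psi a) <= nrm a * nrm psi ^+ 2.
Proof.
apply: le_trans (cauchy_schwarz _ _) _.
by rewrite expr2 mulrA ler_wpM2r ?nrm_ge0 // (nrm_phi hphi).
Qed.

Lemma vec_rk psi : nrm psi = 1 -> vec psi (rk psi psi) = 1.
Proof. by move=> h; rewrite /vec (rkE hphi) dotZl dotxx h expr1n mulr1. Qed.

Lemma vec_state psi : nrm psi = 1 -> state (vec psi).
Proof.
move=> h; have hb a : nrm a <= 1 -> normc (vec psi a) <= 1.
  by move=> a1; apply: le_trans (vec_bound _ _) _; rewrite h expr1n mulr1.
split; first exact: vec_scalar.
  by move=> a; rewrite vec_sq ler0c sqr_ge0.
apply/eqP; rewrite eq_le dual_norm_le //=.
have := dual_norm_ub hb (a := rk psi psi); rewrite (nrm_rk1 hphi h) lexx vec_rk //.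
by rewrite (_ : (1 : R[i]) = 1%:C) // normc_real normr1 => /(_ isT).
Qed.

(** |1 + z|^2 and |1 - z|^2 add up to 2 + 2 |z|^2. *)
Lemma eq0_of_norm1pm (z : R[i]) : normc (1 + z) <= 1 -> normc (1 - z) <= 1 -> z = 0.
Proof.
case: z => x y h1 h2.
have {}h1 : normc (1 + (x +i* y)%C) ^+ 2 <= 1 by rewrite exprn_ile1 ?normc_ge0.
have {}h2 : normc (1 - (x +i* y)%C) ^+ 2 <= 1 by rewrite exprn_ile1 ?normc_ge0.
move: h1 h2; rewrite !normcE2 /= => h1 h2.
have hx := sqr_ge0 x; have hy := sqr_ge0 y.
have x0 : x ^+ 2 = 0 by apply/eqP; rewrite eq_le hx andbT; nra.
have y0 : y ^+ 2 = 0 by apply/eqP; rewrite eq_le hy andbT; nra.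
by move/eqP: x0; move/eqP: y0; rewrite !sqrf_eq0 => /eqP -> /eqP ->.
Qed.

(* With p the projection: p + d is a contraction for every self-adjoint contraction d
   orthogonal to p, so |1 + g d| <= 1 and |1 - g d| <= 1, i.e. g d = 0. *)
Lemma state_at_projection (g : A -> R[i]) psi : state g -> nrm psi = 1 ->
  g (rk psi psi) = 1 -> g = vec psi.
Proof.
move=> gs h1; have gb := state_bound gs; case: (gs) => glin gpos _.
set p := rk psi psi => gp.
have ps : cadj p = p by exact: cadj_rk.
have pp : p ** p = p by exact: rk_idem.
have p1 : nrm p = 1 by exact: nrm_rk1.
have sa0 d : cadj d = d -> p ** d = 0 -> g d = 0.
  move=> ds pd; have [->|d0] := eqVneq d 0; first exact: func_0.
  have nd : 0 < nrm d by rewrite nrm_gt0.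
  pose k : R[i] := (nrm d)^-1%:C.
  have k0 : k != 0 by rewrite (_ : 0 = 0%:C) // (inj_eq (@complexI R)) invr_neq0 //
    gt_eqF.
  have kd (r : R) : `|r| = 1 -> normc (1 + r%:C * (k * g d)) <= 1.
    move=> r1; have -> : 1 + r%:C * (k * g d) = g (p + (r%:C * k) *: d).
      by rewrite func_D // func_Z // gp mulrA.
    apply: le_trans (gb _) _; apply: nrm_orthogonal_add => //.
    - by rewrite p1.
    - by rewrite cadjZ ds /k -rmorphM; congr (_ *: _); exact: conjc_real.
    - by rewrite cmulZr pd scaler0.
    - rewrite nrmZ Normc.normcM !normc_real r1 mul1r ger0_norm ?invr_ge0 ?nrm_ge0 //.
      by rewrite mulVf // gt_eqF.
  have : k * g d = 0.
    apply: eq0_of_norm1pm.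
    - by have := kd 1; rewrite normr1 mul1r; exact.
    - by have := kd (-1); rewrite normrN1 rmorphN mulN1r; exact.
  by move/eqP; rewrite mulf_eq0 (negPf k0) => /eqP.
(* The self-adjoint elements d + [cadj d] and i (d - [cadj d]) reduce this to [sa0]. *)
have d0 d : p ** d = 0 -> d ** p = 0 -> g d = 0.
  move=> pd dp.
  have pds : p ** cadj d = 0 by rewrite -ps -cadjM dp cadj0.
  have e1 : g (d + cadj d) = 0.
    by apply: sa0; rewrite ?cadjD ?cadjK 1?addrC // cmulDr pd pds addr0.
  have e2 : g ('i%C *: (d - cadj d)) = 0.
    apply: sa0; last by rewrite cmulZr cmulBr pd pds subr0 scaler0.
    rewrite cadjZ cadjB cadjK -opprB scalerN -scaleNr; congr (_ *: _).
    by apply/eqP; rewrite eq_complex /= oppr0 opprK !eqxx.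
  move: e1 e2; rewrite func_Z // func_D // func_B // => e1 /eqP.
  rewrite mulf_eq0 eq_complex /= eqxx oner_eq0 /= subr_eq0 => /eqP e2.
  move/eqP: e1; rewrite -e2 -mulr2n -mulr_natr mulf_eq0 pnatr_eq0 orbF => /eqP //.
(* For e p = 0 the element [cadj e ** e] is orthogonal to p, so Cauchy-Schwarz makes g vanish on
   every product [cadj c ** e]. *)
have ep0 e : e ** p = 0 -> g (cadj e ** e) = 0.
  move=> ep; apply: sa0; first by rewrite cadjM cadjK.
  by rewrite cmulA -{1}ps -cadjM ep cadj0 cmul0l.
have cs0 c e : e ** p = 0 -> g (cadj c ** e) = 0.
  move=> /ep0 ge; have := func_cauchy_schwarz glin gpos c e; rewrite ge mulr0 => h.
  apply: Normc.eq0_normc; apply/eqP; rewrite -sqrf_eq0 eq_le h sqr_ge0 //.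
have e0 e : e ** p = 0 -> g e = 0.
  move=> ep; have -> : e = cadj p ** e + (e - p ** e) by rewrite ps addrC subrK.
  rewrite func_D // cs0 // add0r; apply: d0.
    by rewrite cmulBr cmulA pp subrr.
  by rewrite cmulBl ep -cmulA ep cmul0r subrr.
have e0' e : p ** e = 0 -> e ** p = e -> g e = 0.
  move=> pe epe; rewrite -epe -{1}(cadjK e).
  have gee : g (e ** cadj e) = 0.
    by apply: sa0; rewrite ?cadjM ?cadjK // cmulA pe cmul0l.
  have := func_cauchy_schwarz glin gpos (cadj e) p; rewrite cadjK gee mul0r => h.
  by apply: Normc.eq0_normc; apply/eqP; rewrite -sqrf_eq0 eq_le h sqr_ge0.
(* Only the corner p a p contributes to g a, and it is the multiple <a psi, psi> of p. *)
apply/funext => a.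
have -> : g a = g (a ** p).
  apply/eqP; rewrite -subr_eq0 -func_B //; apply/eqP/e0.
  by rewrite cmulBl -cmulA pp subrr.
have -> : g (a ** p) = g (p ** a ** p).
  apply/eqP; rewrite -subr_eq0 -func_B //; apply/eqP/e0'.
    by rewrite cmulBr !cmulA pp subrr.
  by rewrite cmulBl -!cmulA pp.
by rewrite (rk_sandwich hphi) func_Z // gp mulr1.
Qed.

Lemma vec_pure psi : nrm psi = 1 -> pure_states A (vec psi).
Proof.
move=> h1; split; first exact: vec_state.
suff key (g h : A -> R[i]) (t : R) : state g -> state h -> 0 < t < 1 ->
    (forall a, vec psi a = t%:C * g a + (1 - t)%:C * h a) -> g = vec psi.
  move=> g h t gs hs t01 E; split; first exact: (key g h t).
  apply: (key h g (1 - t)) => //; first by case/andP: t01 => *; apply/andP; split; lra.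
  by move=> a; rewrite E addrC subKr.
move=> gs hs /andP[t0 t1] E; apply: state_at_projection => //.
(* At this projection a convex combination of two numbers of modulus at most 1 equals 1. Real parts
   give that the value of g has real part 1, and its modulus then kills the imaginary part. *)
have := E (rk psi psi); rewrite vec_rk //.
have := state_bound gs (rk psi psi); have := state_bound hs (rk psi psi).
rewrite (nrm_rk1 hphi h1) => hb gb.
have := le_trans (ler_norm _) (le_trans (le_Re_normc _) gb).
have := le_trans (ler_norm _) (le_trans (le_Re_normc _) hb).
have : normc (g (rk psi psi)) ^+ 2 <= 1 by rewrite exprn_ile1 ?normc_ge0.
rewrite normcE2; case: (g _) (h _) => a b [c d] /= hab ha hc [h2 _].
have ea : a = 1 by nra.
subst a; have : b ^+ 2 <= 0 by nra.
move=> hb2; have /eqP : b ^+ 2 = 0 by apply/eqP; rewrite eq_le hb2 sqr_ge0.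
by rewrite sqrf_eq0 => /eqP ->.
Qed.

Lemma normc_rM (r : R) (z : R[i]) : 0 <= r -> normc (r%:C * z) = r * normc z.
Proof. by move=> r0; rewrite Normc.normcM normc_real ger0_norm. Qed.

Lemma le_sqr_sqrt (x y : R) : 0 <= x -> 0 <= y -> (x ^+ 2 <= y) = (x <= Num.sqrt y).
Proof. by move=> x0 y0; rewrite -[y in LHS]sqr_sqrtr // ler_sqr ?nnegrE ?sqrtr_ge0. Qed.

(** On finite-rank b = P b, Cauchy-Schwarz gives |g b|^2 <= g P * g (b^* b) <= t m |b|^2, and
    density extends this to A. With m the norm of g it yields m <= t: a substitute for evaluating g
    at a unit. *)
Lemma positive_bound (g : A -> R[i]) psi (m t : R) : scalar g ->
  (forall a, 0 <= g (cadj a ** a)) -> 0 <= m -> (forall a, normc (g a) <= m * nrm a) ->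
  0 <= t ->
  (forall s, orthonormal_seq s -> proj s psi = psi -> complex.Re (g (projA s)) <= t) ->
  forall a, normc (g a) ^+ 2 <= t * m * nrm a ^+ 2.
Proof.
move=> glin gpos m0 gm t0 gt a.
have fin s b : orthonormal_seq s -> projA s ** b = b ->
    normc (g b) ^+ 2 <= t * m * nrm b ^+ 2.
  (* Adjoining [psi] makes the larger projection fix [psi], so the bound by [t] applies to it. *)
  move=> os bE; have [s' os' hs'] := gram_schmidt (psi :: s).
  have qb : projA s' ** b = b.
    rewrite -bE cmulA; congr (_ ** _); apply: (phi_inj hphi) => x.
    rewrite (phi_M hphi) !(phi_projA hphi) proj_proj // => e es.
    by apply: hs'; rewrite inE es orbT.
  have := func_cauchy_schwarz glin gpos (projA s') b.
  rewrite (cadj_projA hphi) (projA_idem hphi os') qb; move/le_trans; apply.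
  rewrite -mulrA ler_pM ?(func_ge0 gpos) //.
  - by rewrite -(projA_idem hphi os') -{1}(cadj_projA hphi); exact: func_ge0.
  - by apply: gt => //; apply: hs'; rewrite mem_head.
  apply: le_trans (ler_norm _) _; apply: le_trans (le_Re_normc _) _.
  by apply: le_trans (gm _) _; rewrite nrm_cstar.
rewrite le_sqr_sqrt ?normc_ge0 ?mulr_ge0 ?sqr_ge0 ?nrm_ge0 //.
apply/ler_addgt0Pr => e e0.
have m1 : 0 < m + 1 by rewrite ltr_wpDl.
have [s os hs] := finite_rank_dense hphi a (divr_gt0 e0 m1).
set b := projA s ** a in hs.
have -> : g a = g b + g (a - b) by rewrite -func_D // addrC subrK.
apply: le_trans (le_normcD _ _) _; apply: lerD; last first.
  apply: le_trans (gm _) _; rewrite ltr_pdivlMr // in hs.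
  apply: le_trans (ltW hs); rewrite mulrC ler_wpM2l ?nrm_ge0 // lerDl ler01 //.
have nb : nrm b <= nrm a.
  apply: le_trans (nrm_cmul _ _) _; rewrite ler_piMl ?nrm_ge0 //.
  exact: (nrm_projA hphi).
have bE : projA s ** b = b by rewrite cmulA (projA_idem hphi).
have := fin s b os bE => h.
rewrite -le_sqr_sqrt ?normc_ge0 ?mulr_ge0 ?sqr_ge0 ?nrm_ge0 //.
apply: le_trans h _; rewrite ler_wpM2l ?mulr_ge0 // ler_sqr ?nnegrE ?nrm_ge0 //.
Qed.

(** If f vanished on all rank-one projections, Cauchy-Schwarz would make it vanish on
    [projA s ** c], and density on all of A, against norm 1. *)
Lemma state_rank_one (f : A -> R[i]) : state f ->
  exists2 x, nrm x = 1 & 0 < complex.Re (f (rk x x)).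
Proof.
move=> fs; have fb := state_bound fs; have [flin fpos f1] := fs.
apply: contrapT => hno.
have h0 e : nrm e = 1 -> complex.Re (f (rk e e)) = 0.
  move=> e1; apply/eqP; rewrite eq_le; apply/andP; split.
    by rewrite leNgt; apply/negP => hlt; apply: hno; exists e.
  by rewrite -(rk_idem hphi e1) -{1}(cadj_rk hphi); exact: func_ge0.
have hfin s c : orthonormal_seq s -> f (projA s ** c) = 0.
  move=> os; rewrite cmul_suml func_sum // big_seq big1 // => e es.
  have e1 := orthonormal_seq1 os es.
  have := func_cauchy_schwarz flin fpos (rk e e) c.
  rewrite (cadj_rk hphi) (rk_idem hphi e1) h0 // mul0r => h.
  by apply: Normc.eq0_normc; apply/eqP; rewrite -sqrf_eq0 eq_le h sqr_ge0.
have fz a : normc (f a) <= 0.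
  apply/ler_addgt0Pr => e e0; rewrite add0r.
  have [s os hs] := finite_rank_dense hphi a e0.
  have -> : a = projA s ** a + (a - projA s ** a) by rewrite addrC subrK.
  rewrite func_D // hfin // add0r; exact: le_trans (fb _) (ltW hs).
have : dual_norm f <= 0 by apply: dual_norm_le => a _.
by rewrite f1 ler10.
Qed.

(* The Riesz vector psi with <psi, y> = f (x (x) y^* ) works, where f (x (x) x^* ) > 0:
   <phi a psi, y> = f ((x (x) y^* ) a), so Cauchy-Schwarz for f bounds |phi a psi|^2. *)
Lemma state_dominates_vec (f : A -> R[i]) : state f -> exists2 psi, nrm psi = 1 &
  exists2 t : R, 0 < t & forall a,
    t * nrm (phi a psi) ^+ 2 <= complex.Re (f (cadj a ** a)).
Proof.
move=> fs; have fb := state_bound fs; have [flin fpos f1] := fs.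
have [x0 x01 M0] := state_rank_one fs.
set M := complex.Re _ in M0.
have fp : f (rk x0 x0) = M%:C.
  by have := func_real fpos (rk x0 x0); rewrite (cadj_rk hphi) (rk_idem hphi x01).
(* The conjugate is linear in y, because [rk] is antilinear in its second argument. *)
have [||psi hpsi] := @riesz R H (fun y => (f (rk x0 y))^*) 1.
- move=> k x y; rewrite (rkDr hphi) (rkZr hphi) func_D // func_Z //.
  by rewrite rmorphD rmorphM /= conjCK.
- by move=> x; rewrite normcJ; apply: le_trans (fb _) _; rewrite (nrm_rk hphi) x01.
have {}hpsi y : f (rk x0 y) = dot psi y by rewrite dotC -hpsi conjCK.
have psi0 : psi != 0.
  apply/eqP => h; have := hpsi x0; rewrite h dot0l fp => -[h0].
  by move: M0; rewrite h0 ltxx.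
have np : 0 < nrm psi by rewrite nrm_gt0.
(* With y = [phi a psi], Cauchy-Schwarz for [rk y x0] and [a] reads |y|^4 <= |y|^2 M f (a^* a). *)
have key a : nrm (phi a psi) ^+ 2 <= M * complex.Re (f (cadj a ** a)).
  set y := phi a psi.
  have [->|y0] := eqVneq (nrm y) 0.
    by rewrite expr0n mulr_ge0 ?(ltW M0) //; exact: func_ge0.
  have := func_cauchy_schwarz flin fpos (rk y x0) a.
  rewrite (cadj_rk hphi) (rk_rk hphi) (rk_mul hphi) hpsi -(phi_adjr hphi) -/y.
  rewrite func_Z // fp dotxx normc_real ger0_norm ?sqr_ge0 // -rmorphM /=.
  by rewrite [_ ^+ 2 ^+ 2]expr2 -[nrm y ^+ 2 * M * _]mulrA ler_pM2l // exprn_gt0 //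
    lt_def y0 nrm_ge0.
exists (unitv psi); first exact: nrm_unitv.
exists (nrm psi ^+ 2 / M); first by rewrite divr_gt0 // exprn_gt0.
move=> a; rewrite (op_Z hphi) nrmZ normc_real ger0_norm ?invr_ge0 ?nrm_ge0 //.
have -> : nrm psi ^+ 2 / M * ((nrm psi)^-1 * nrm (phi a psi)) ^+ 2 =
    nrm (phi a psi) ^+ 2 / M by field; rewrite !gt_eqF.
by rewrite ler_pdivrMr // mulrC; exact: key.
Qed.

(** Once t times the dominated vector state is subtracted, the positive remainder [g] has norm at
    most 1 - t. So f is a convex combination of two states, and purity identifies the vector state
    with f. *)
Lemma pure_vec (f : A -> R[i]) : pure_states A f ->
  exists2 psi, nrm psi = 1 & f = vec psi.
Proof.
case=> fs fpure; have [psi psi1 [t0 t0p ht0]] := state_dominates_vec fs.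
have fb := state_bound fs; have [flin fpos f1] := fs.
(* The minimum with 1/2 keeps 1 - t positive; [h] divides by it. *)
exists psi => //; pose t := Num.min t0 2^-1.
have t_gt0 : 0 < t by rewrite lt_min t0p invr_gt0 ltr0n.
have t_lt1 : t < 1 by rewrite gt_min [X in _ || X](_ : _ = true) ?orbT //; lra.
have t1 : 0 < 1 - t by lra.
have ht a : t * nrm (phi a psi) ^+ 2 <= complex.Re (f (cadj a ** a)).
  apply: le_trans (ht0 a); rewrite ler_wpM2r ?sqr_ge0 //; by rewrite ge_min lexx.
pose g a := f a - t%:C * vec psi a.
have glin : scalar g.
  by move=> k a b; rewrite /g flin vec_scalar; ring.
have gpos a : 0 <= g (cadj a ** a).
  by rewrite /g vec_sq (func_real fpos) -rmorphM -rmorphB /= ler0c subr_ge0 ht.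
have gb a : nrm a <= 1 -> normc (g a) <= 1 + t.
  move=> a1; apply: le_trans (le_normcD _ _) _; rewrite normcN; apply: lerD.
    exact: le_trans (fb a) a1.
  rewrite Normc.normcM normc_real gtr0_norm // ler_piMr ?(ltW t_gt0) //.
  by apply: le_trans (vec_bound _ _) _; rewrite psi1 expr1n mulr1.
set m := dual_norm g.
have gm := func_bound glin (dual_norm_ub gb).
have m0 : 0 <= m.
  have := dual_norm_ub gb (a := 0); rewrite nrm0 ler01 => /(_ isT).
  exact: le_trans (normc_ge0 _).
have gq := positive_bound glin gpos m0 gm (ltW t1).
have {}gq a : normc (g a) ^+ 2 <= (1 - t) * m * nrm a ^+ 2.
  apply: (gq psi) => s os hs.
  rewrite /g raddfB /=; have -> : vec psi (projA s) = 1.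
    by rewrite /vec (phi_projA hphi) hs dotxx psi1 expr1n.
  rewrite mulr1 /= lerB //.
  apply: le_trans (ler_norm _) (le_trans (le_Re_normc _) (le_trans (fb _) _)).
  exact: (nrm_projA hphi).
(* The bound 1 - t in [gq] comes from [vec psi] being 1 on projections that fix [psi]. Taking
   suprema there gives m^2 <= (1 - t) m. *)
have mt : m <= 1 - t.
  have [->|mn] := eqVneq m 0; first exact: ltW.
  have mp : 0 < m by rewrite lt_def mn.
  have : m <= Num.sqrt ((1 - t) * m).
    apply: dual_norm_le => a a1; rewrite -le_sqr_sqrt ?normc_ge0 ?mulr_ge0 ?(ltW t1) //.
    apply: le_trans (gq a) _.
    by rewrite ler_piMr ?mulr_ge0 ?(ltW t1) // exprn_ile1 ?nrm_ge0.
  rewrite -ler_sqr ?nnegrE ?sqrtr_ge0 // sqr_sqrtr ?mulr_ge0 ?(ltW t1) //.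
  by rewrite expr2 ler_pM2r.
pose h a := ((1 - t)^-1)%:C * g a.
have hE a : f a = t%:C * vec psi a + (1 - t)%:C * h a.
  by rewrite /h mulrA -rmorphM /= mulfV ?gt_eqF // mul1r /g; ring.
have hb a : nrm a <= 1 -> normc (h a) <= 1.
  move=> a1; rewrite Normc.normcM normc_real gtr0_norm ?invr_gt0 // ler_pdivrMl //
    mulr1.
  exact: le_trans (dual_norm_ub gb a1) mt.
have hs : state h.
  split.
  - by move=> k a b; rewrite /h glin; ring.
  - by move=> a; rewrite mulr_ge0 // ler0c invr_ge0 ltW.
  apply/eqP; rewrite eq_le dual_norm_le //=.
  (* This bounds the norm of h from below: 1 <= t + (1 - t) |h|. *)
  have : dual_norm f <= t + (1 - t) * dual_norm h.
    apply: dual_norm_le => a a1; rewrite hE; apply: le_trans (le_normcD _ _) _.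
    rewrite (normc_rM _ (ltW t_gt0)) (normc_rM (h a) (ltW t1)); apply: lerD.
      rewrite ler_piMr ?(ltW t_gt0) //.
      by apply: le_trans (vec_bound _ _) _; rewrite psi1 expr1n mulr1.
    by rewrite ler_wpM2l ?(ltW t1) //; exact: (dual_norm_ub hb).
  by rewrite f1 -lerBlDl -[X in X <= _]mulr1 ler_pM2l.
by have [|<- //] := fpure (vec psi) h t (vec_state psi1) hs _ hE; rewrite t_gt0.
Qed.

End PureStates.

(** * The two topologies on the pure states *)

Section PureStateTopology.
Variables (R : realType) (A : cstarAlgType R) (H : hilbertType R).
Variable phi : A -> H -> H.
Hypothesis hphi : star_iso_compact phi.
Local Notation normc := Normc.normc.
Local Notation "x %:C" := (x%:C)%C.
Local Notation "a ** b" := (cmul a b) (at level 40, left associativity).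
Local Notation rk := (rk phi).
Local Notation vec := (vec phi).
Local Notation X := (pure_states A).
Implicit Types (a b c d p : A) (x y z psi : H) (s : seq H).

Lemma cvg_pure_eval (T : Type) (F : set_system T) (FF : Filter F) (f : T -> X) (w :
  X) a :
  f t @[t --> F] --> w ->
  (set_val (f t) a : R[i]^o) @[t --> F] --> (set_val w a : R[i]^o).
Proof.
move=> fw.
have h1 : set_val (f t) @[t --> F] --> (set_val w : {ptws A -> R[i]^o}).
  apply: (@cvg_comp _ _ _ f set_val) fw _; exact: initial_continuous.
have [h _] := @pointwise_cvgP A R[i]^o (set_val (f t) @[t --> F]) (set_val w) _.
exact: (h h1 a).
Qed.

Lemma cvg_pure (T : Type) (F : set_system T) (FF : Filter F) (f : T -> X) (w : X) :
  (forall a, (set_val (f t) a : R[i]^o) @[t --> F] --> (set_val w a : R[i]^o)) ->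
  f t @[t --> F] --> w.
Proof.
move=> h B [_ [[V oV <-] /= Vw sub]].
have [_ h2] := @pointwise_cvgP A R[i]^o (set_val (f t) @[t --> F]) (set_val w) _.
have /h2 h3 : forall a, (fun g : A -> R[i]^o =>
  g a) @ (set_val (f t) @[t --> F]) --> (set_val w a : R[i]^o).
  by move=> a; exact: h.
have : nbhs (set_val w : {ptws A -> R[i]^o}) V by exact: open_nbhs_nbhs.
move=> /h3 h4; have {}h4 : F (fun t => V (set_val (f t))) by exact: h4.
by apply: filterS h4 => t; exact: sub.
Qed.

(** The phase k = conj z / |z| turns <k x, y> into |z|, so the left side is 2 - 2 |z|, and |z|^2 <=
    |z|. For z = 0 any phase works. *)
Lemma phase_align x y : nrm x = 1 -> nrm y = 1 ->
  exists2 k : R[i], normc k = 1 &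
    nrm (k *: x - y) ^+ 2 <= 2 * (1 - normc (dot x y) ^+ 2).
Proof.
move=> x1 y1; set z := dot x y.
have z1 : normc z <= 1 by apply: le_trans (cauchy_schwarz _ _) _; rewrite x1 y1 mulr1.
have [z0|z0] := eqVneq z 0.
  exists 1; first by rewrite (_ : (1 : R[i]) = 1%:C) // normc_real normr1.
  rewrite scale1r nrmD2 nrmN x1 y1 dotNr -/z z0 oppr0 -(nrm_normc 0) nrm0 /=.
  lra.
have nz : 0 < normc z by rewrite lt_def normc_ge0 andbT -nrm_normc nrm0_eq0.
pose k : R[i] := (normc z)^-1%:C * z^*.
exists k.
  by rewrite normc_rM ?invr_ge0 ?normc_ge0 // normcJ mulVf // gt_eqF.
rewrite nrmD2 nrmN nrmZ dotNr dotZl -/z /k -mulrA [z^* * z]mulrC mulcJ -rmorphM /=.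
rewrite normc_rM ?invr_ge0 ?normc_ge0 // normcJ mulVf ?gt_eqF // x1 y1 expr2.
rewrite [_ ^-1 * _](_ : _ = normc z); last by field; rewrite gt_eqF.
by nra.
Qed.

Lemma dot_phase (k : R[i]) x y : normc k = 1 -> dot y (k *: x) *: (k *: x) = dot y x
  *: x.
Proof.
move=> k1; rewrite dotZr scalerA mulrAC mulrC -[k^* * k]mulrC mulcJ k1 expr1n mulr1 //.
Qed.

(** A rank-one projection does not see the phase of x, so x may be aligned with y first. The right
    side involves only the overlap |<x, y>|, which the two states determine. *)
Lemma rank_one_lipschitz x y z : nrm x = 1 -> nrm y = 1 ->
  nrm (dot z x *: x - dot z y *: y) <=
    2 * nrm z * Num.sqrt (2 * (1 - normc (dot x y) ^+ 2)).
Proof.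
move=> x1 y1; have [k k1 hk] := phase_align x1 y1.
set r := Num.sqrt _; have {}hk : nrm (k *: x - y) <= r.
  by rewrite -le_sqr_sqrt ?nrm_ge0 // (le_trans _ hk) ?sqr_ge0.
rewrite -(dot_phase x z k1); set u := k *: x in hk *.
have u1 : nrm u = 1 by rewrite nrmZ k1 x1 mulr1.
have -> : dot z u *: u - dot z y *: y = dot z u *: (u - y) + dot z (u - y) *: y.
  by rewrite scalerBr dotBr scalerBl addrA subrK.
apply: le_trans (nrmD _ _) _; rewrite !nrmZ y1 mulr1.
have h1 := cauchy_schwarz z u; have h2 := cauchy_schwarz z (u - y).
rewrite u1 mulr1 in h1.
have z0 := nrm_ge0 z; have d0 := nrm_ge0 (u - y).
apply: (@le_trans _ _ (2 * nrm z * nrm (u - y))); last by rewrite ler_wpM2l // mulr_ge0.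
have := ler_wpM2r d0 h1; lra.
Qed.

Lemma vec_lipschitz x y a : nrm x = 1 -> nrm y = 1 ->
  normc (vec x a - vec y a) <=
    2 * nrm a * Num.sqrt (2 * (1 - normc (dot x y) ^+ 2)).
Proof.
move=> x1 y1; have [k k1 hk] := phase_align x1 y1.
set r := Num.sqrt _; have {}hk : nrm (k *: x - y) <= r.
  by rewrite -le_sqr_sqrt ?nrm_ge0 // (le_trans _ hk) ?sqr_ge0.
have -> : vec x a = vec (k *: x) a.
  by rewrite /vec (op_Z hphi) dotZl dotZr mulrA mulcJ k1 expr1n mul1r.
set u := k *: x in hk *; have u1 : nrm u = 1 by rewrite nrmZ k1 x1 mulr1.
have -> : vec u a - vec y a = dot (phi a u) (u - y) + dot (phi a (u - y)) y.
  by rewrite (op_B hphi) dotBr dotBl addrA subrK.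
apply: le_trans (le_normcD _ _) _.
have h1 := cauchy_schwarz (phi a u) (u - y);
  have h2 := cauchy_schwarz (phi a (u - y)) y.
have h3 := nrm_phi hphi a u; have h4 := nrm_phi hphi a (u - y).
rewrite u1 mulr1 in h3; rewrite y1 mulr1 in h2.
have a0 := nrm_ge0 a; have d0 := nrm_ge0 (u - y).
apply: (@le_trans _ _ (2 * nrm a * nrm (u - y))); last by rewrite ler_wpM2l // mulr_ge0.
have := ler_wpM2r d0 h3; lra.
Qed.

Lemma vec_rk_dot x y : vec x (rk y y) = (normc (dot x y) ^+ 2)%:C.
Proof. by rewrite /vec (rkE hphi) dotZl (dotC y x) mulcJ. Qed.

Lemma pure_vector (w : X) : exists psi, nrm psi = 1 /\ set_val w = vec psi.
Proof.
have /set_mem/(pure_vec hphi) [psi h1 h2] := valP w.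
by exists psi; split.
Qed.

(* Determined up to a phase only. *)
Definition vector_of (w : X) : H := projT1 (cid (pure_vector w)).
Lemma nrm_vector_of w : nrm (vector_of w) = 1.
Proof. by rewrite /vector_of; case: cid => psi []. Qed.
Lemma vec_vector_of w : set_val w = vec (vector_of w).
Proof. by rewrite /vector_of; case: cid => psi []. Qed.

(** The projection onto the line of [w]. The arbitrary phase of [vector_of w] cancels, so this is
    continuous in [w] although [vector_of] need not be. *)
Definition pure_proj (w : X) x : H := dot x (vector_of w) *: vector_of w.

(** Evaluating both descriptions of [w] at [rk psi psi] shows that the overlap is 1, which makes the
    Lipschitz bound 0. *)
Lemma pure_projE (w : X) psi x : nrm psi = 1 -> set_val w = vec psi ->
  pure_proj w x = dot x psi *: psi.
Proof.
move=> h1 wE; apply/eqP; rewrite -subr_eq0 -nrm0_eq0 eq_le nrm_ge0 andbT.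
apply: le_trans (rank_one_lipschitz _ (nrm_vector_of w) h1) _.
have : vec psi (rk psi psi) = vec (vector_of w) (rk psi psi) by rewrite -wE
  vec_vector_of.
rewrite (vec_rk hphi h1) vec_rk_dot => -[<-].
by rewrite subrr mulr0 sqrtr0 mulr0.
Qed.

Lemma cvg_overlap (T : Type) (F : set_system T) (FF : Filter F) (f : T -> X) (w : X) :
  f t @[t --> F] --> w ->
  Num.sqrt (2 * (1 - normc (dot (vector_of (f t)) (vector_of w)) ^+ 2)) @[t --> F]
    --> (0 : R).
Proof.
move=> hf; have /cvg_Re h := cvg_pure_eval FF (a := rk (vector_of w) (vector_of w)) hf.
have -> : (0 : R) = Num.sqrt (2 * (1 - normc (dot (vector_of w) (vector_of w)) ^+ 2)).
  by rewrite dotxx nrm_vector_of expr1n normc_real normr1 expr1n subrr mulr0 sqrtr0.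
apply: continuous_cvg; first exact: sqrt_continuous.
apply: cvgM; first exact: cvg_cst.
apply: cvgB; first exact: cvg_cst.
move: h; rewrite vec_vector_of vec_rk_dot /=.
by under eq_fun do rewrite vec_vector_of vec_rk_dot /=.
Qed.

(** The difference splits into a projection, which is a contraction, applied to g t - x, and the
    change of the projection at the fixed vector x, which the overlap controls. *)
Lemma cvg_pure_proj (T : Type) (F : set_system T) (FF : Filter F)
    (f : T -> X) (g : T -> H) (w : X) x :
  f t @[t --> F] --> w -> g t @[t --> F] --> x ->
  pure_proj (f t) (g t) @[t --> F] --> pure_proj w x.
Proof.
move=> /cvg_overlap; set q := fun t => Num.sqrt _ => hq hg.
have hb : (nrm (g t - x) + 2 * nrm x * q t) @[t --> F] --> (0 : R).
  have -> : (0 : R) = nrm (x - x) + 2 * nrm x * 0 by rewrite subrr nrm0 mulr0 addr0.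
  apply: cvgD; last by apply: cvgM => //; exact: cvg_cst.
  by apply: cvg_nrm; apply: cvgB => //; exact: cvg_cst.
apply/cvg_nrmP => e e0; have /cvgrPdist_lt /(_ e e0) := hb; apply: filterS => t.
rewrite sub0r normrN; apply: le_lt_trans; apply: le_trans (ler_norm _).
have -> : pure_proj (f t) (g t) - pure_proj w x =
    pure_proj (f t) (g t - x) + (pure_proj (f t) x - pure_proj w x).
  by rewrite addrA; congr (_ - _); rewrite /pure_proj dotBl scalerBl subrK.
apply: le_trans (nrmD _ _) _; apply: lerD; last first.
  exact: rank_one_lipschitz (nrm_vector_of _) (nrm_vector_of _).
rewrite nrmZ nrm_vector_of mulr1; apply: le_trans (cauchy_schwarz _ _) _.
by rewrite nrm_vector_of mulr1.
Qed.

Lemma dual_norm_vec_le (w w' : X) :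
  dual_norm (fun a => set_val w' a - set_val w a) <=
    2 * Num.sqrt (2 * (1 - normc (dot (vector_of w') (vector_of w)) ^+ 2)).
Proof.
apply: dual_norm_le => a a1; rewrite !vec_vector_of.
apply: le_trans (vec_lipschitz _ (nrm_vector_of _) (nrm_vector_of _)) _.
by rewrite ler_wpM2r ?sqrtr_ge0 // ler_piMr.
Qed.

Lemma weak_star_open_norm_open (U : set X) : open U <-> norm_open U.
Proof.
split=> [oU w Uw|hU].
  (* [F] is the filter of norm neighbourhoods of [w]; [Fw] says that norm convergence implies weak*
     convergence. *)
  pose B (e : R) := [set w' : X | dual_norm (fun a => set_val w' a - set_val w a) < e].
  pose F := filter_from [set e : R | 0 < e] B.
  have FF : Filter F.
    apply: filter_from_filter; first by exists 1; exact: ltr01.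
    move=> e1 e2 /= e10 e20; exists (Num.min e1 e2); first by rewrite /= lt_min e10.
    by move=> w'; rewrite /B /= lt_min => /andP[].
  have Fw : (id w') @[w' --> F] --> w.
    apply: cvg_pure => a; apply/cvgc_normcP => e e0.
    have a1 : 0 < nrm a + 1 by rewrite ltr_wpDl ?nrm_ge0.
    exists (e / (nrm a + 1)); first exact: divr_gt0.
    move=> w' /=; rewrite /B /= ltr_pdivlMr // => hw.
    have wb (v : X) b : normc (set_val v b) <= nrm b.
      by apply: state_bound; have /set_mem [] := valP v.
    have vlin (v : X) : scalar (set_val v : A -> R[i]) by have /set_mem [[]] := valP v.
    have lin : scalar (fun a => set_val w' a - set_val w a).
      by move=> k b c; rewrite !vlin; ring.
    have bd b : nrm b <= 1 -> normc (set_val w' b - set_val w b) <= 2.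
      move=> b1; apply: le_trans (le_normcD _ _) _; rewrite normcN.
      by have := wb w' b; have := wb w b; lra.
    have := func_bound lin (dual_norm_ub bd) a; move/le_lt_trans; apply.
    apply: le_lt_trans hw; rewrite ler_wpM2l ?lerDl ?ler01 //.
    have := dual_norm_ub bd (a := 0); rewrite nrm0 ler01 => /(_ isT).
    exact: le_trans (normc_ge0 _).
  have [|e e0 he] := Fw U; first exact: open_nbhs_nbhs.
  by exists e => // w' hw'; exact: he.
rewrite openE => w Uw; have [e e0 he] := hU w Uw.
(* The tolerance e/2 absorbs the factor 2 in [dual_norm_vec_le]. *)
have := @cvg_overlap X (nbhs w) (nbhs_filter w) id w (fun _ => id).
move=> /cvgrPdist_lt /(_ (e / 2)); rewrite divr_gt0 // => /(_ isT).
apply: filterS => w' /=; rewrite sub0r normrN => hw'; apply: he.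
apply: le_lt_trans (dual_norm_vec_le _ _) _.
by rewrite mulrC -ltr_pdivlMr // (le_lt_trans (ler_norm _)).
Qed.

(** Over a finite orthonormal basis of H the matrix units [rk (e i) (e j)] would span A; [enum_val]
    lists the pairs (i, j) by one ordinal. *)
Lemma infdim_of_infinite_dimensional : ~ finite_dimensional A -> infdim H.
Proof.
move=> hA; have [//|[s os hs]] := infdimP H; exfalso; apply: hA.
pose m := size s; pose e (i : 'I_m) : H := tnth (in_tuple s) i.
pose I := ('I_m * 'I_m)%type.
exists #|{: I}|, (fun k => let p : I := enum_val k in rk (e p.1) (e p.2)) => a.
exists (fun k => let p : I := enum_val k in dot (phi a (e p.2)) (e p.1)).
rewrite /= -(big_enum_val (fun p : I =>
  dot (phi a (e p.2)) (e p.1) *: rk (e p.1) (e p.2))) /=.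
rewrite -(pair_bigA _ (fun i j => dot (phi a (e j)) (e i) *: rk (e i) (e j))) /=.
have pE x : x = \sum_(i < m) dot x (e i) *: e i by rewrite -{1}(hs x) /proj big_tnth.
apply: (phi_inj hphi) => x; rewrite (phi_sum hphi).
rewrite {1}[phi a x]pE; apply: eq_bigr => i _.
rewrite (phi_sum hphi).
under [RHS]eq_bigr do rewrite (phi_Z hphi) (rkE hphi) scalerA.
rewrite -scaler_suml; congr (_ *: _); rewrite {1}[x]pE.
rewrite (big_morph _ (op_D hphi a) (op_0 hphi a)) dot_suml; apply: eq_bigr => j _.
by rewrite (op_Z hphi) dotZl mulrC.
Qed.

End PureStateTopology.

(** * Lifting maps into the circle *)

Section PairCvg.
Variables (T : Type) (X Y : topologicalType) (F : set_system T) (FF : Filter F).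

Lemma cvg_pairT (f : T -> X) (g : T -> Y) (a : X) (b : Y) :
  f t @[t --> F] --> a -> g t @[t --> F] --> b ->
  ((f t, g t) : X * Y) @[t --> F] --> ((a, b) : X * Y).
Proof.
move=> hf hg A [[B C] [/= nB nC] sub].
have h : F ((f @^-1` B) `&` (g @^-1` C)) by apply: filterI; [exact: hf | exact: hg].
suff h2 : f @^-1` B `&` g @^-1` C `<=` (fun t => A (f t, g t)) by exact: filterS h2 h.
by move=> t [h1 h2]; exact: (sub (f t, g t)).
Qed.

Lemma cvg_fstT (f : T -> X * Y) (a : X) (b : Y) : f t @[t --> F] --> (a, b) ->
  (f t).1 @[t --> F] --> a.
Proof. by move=> h; apply: (cvg_comp _ _ h); exact: cvg_fst. Qed.

Lemma cvg_sndT (f : T -> X * Y) (a : X) (b : Y) : f t @[t --> F] --> (a, b) ->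
  (f t).2 @[t --> F] --> b.
Proof. by move=> h; apply: (cvg_comp _ _ h); exact: cvg_snd. Qed.
End PairCvg.

Section Circle.
Variable R : realType.
Local Notation normc := Normc.normc.
Local Notation "x %:C" := (x%:C)%C.
Implicit Types (u v : R) (z : R[i]).

Definition cis u : R[i] := (cos u +i* sin u)%C.

Lemma cis0 : cis 0 = 1. Proof. by rewrite /cis cos0 sin0. Qed.
Lemma cisD u v : cis (u + v) = cis u * cis v.
Proof. by rewrite /cis cosD sinD; apply/eqP; rewrite eq_complex /=; apply/andP;
  split; apply/eqP; ring. Qed.
Lemma normc_cis u : normc (cis u) = 1.
Proof. by apply/eqP; rewrite -(@eqrXn2 _ 2) ?normc_ge0 ?ler01 // normcE2 /= cos2Dsin2
  expr1n. Qed.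
Lemma cis_neq0 u : cis u != 0.
Proof. by rewrite -(nrm0_eq0 (cis u : R[i]^o)) nrm_normc normc_cis oner_eq0. Qed.
Lemma cisN u : cis (- u) = (cis u)^-1.
Proof. by apply: (mulIf (cis_neq0 u)); rewrite mulVf ?cis_neq0 // -cisD addNr cis0. Qed.
Lemma cis_conj u : cis (- u) = (cis u)^*.
Proof. by rewrite /cis cosN sinN. Qed.
Lemma cisB u v : cis (u - v) = cis u / cis v.
Proof. by rewrite cisD cisN. Qed.

Lemma cis_2pi : cis (2 * pi) = 1.
Proof. by rewrite mulrC mulr_natr /cis cos2pi sin2pi. Qed.
Lemma cis_int (d : int) : cis (2 * pi * d%:~R) = 1.
Proof.
have hn (n : nat) : cis (2 * pi * n%:R) = 1.
  elim: n => [|n IH]; first by rewrite mulr0 cis0.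
  rewrite (_ : 2 * pi * n.+1%:R = 2 * pi * n%:R + 2 * pi); last by rewrite -natr1; ring.
  by rewrite cisD IH cis_2pi mulr1.
case: d => n; first exact: hn.
by rewrite NegzE mulrNz mulrN cisN hn invr1.
Qed.

(** Reduce u modulo 2 pi to v in [0, 2 pi). If v were not 0, then sin (v/2) > 0 and cos v = 1 - 2
    sin^2 (v/2) < 1. *)
Lemma cis_eq1 u : cis u = 1 -> exists d : int, u = 2 * pi * d%:~R.
Proof.
move=> hu; have p0 := pi_gt0 R; have p2 : 0 < 2 * pi :> R by rewrite mulr_gt0.
pose d := Num.floor (u / (2 * pi)); exists d.
pose v := u - 2 * pi * d%:~R.
have hv : cis v = 1 by rewrite cisB hu cis_int invr1 mulr1.
have /andP[v0 v1] : 0 <= v < 2 * pi.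
  have /andP[h1 h2] := floor_itv (u / (2 * pi)).
  rewrite ler_pdivlMr // in h1; rewrite ltr_pdivrMr // rmorphD mulrDl mul1r in h2.
  by apply/andP; split; rewrite /v /d; lra.
suff : v = 0 by rewrite /v => /eqP; rewrite subr_eq0 => /eqP.
have [//|vn] := eqVneq v 0; exfalso.
have sp : 0 < sin (v / 2).
  by apply: sin_gt0_pi; apply/andP; split; [rewrite divr_gt0 // lt_def vn | lra].
have : cos v = 1 by move: hv; rewrite /cis => -[].
have -> : v = (v / 2) *+ 2 by rewrite mulr2n; lra.
rewrite cos_mulr2n; have := cos2Dsin2 (v / 2).
have : 0 < sin (v / 2) ^+ 2 by rewrite exprn_gt0.
rewrite mulr2n; lra.
Qed.

Lemma cvg_cis (T : Type) (F : set_system T) (FF : Filter F) (f : T -> R) u :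
  f t @[t --> F] --> u -> (cis (f t) : R[i]^o) @[t --> F] --> (cis u : R[i]^o).
Proof.
move=> h; apply: cvg_complex.
- by apply: continuous_cvg h; exact: continuous_cos.
- by apply: continuous_cvg h; exact: continuous_sin.
Qed.

(** On the open right half of the circle, [asin] of the imaginary part is a continuous branch of the
    angle; [circle_lift] adds up such small angles. *)
Lemma cis_asin z : normc z = 1 -> 0 < complex.Re z -> cis (asin (complex.Im z)) = z.
Proof.
move=> z1 x0; have := normcE2 z; rewrite z1 expr1n.
case: z z1 x0 => x y /= z1 x0 h; have hy : -1 <= y <= 1.
  by apply/andP; split; nra.
rewrite /cis asinK ?in_itv //= cos_asin //; congr (_ +i* _)%C.
by rewrite (_ : 1 - y ^+ 2 = x ^+ 2) ?sqrtr_sqr ?gtr0_norm // h addrK.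
Qed.

Lemma cis_surj z : normc z = 1 -> exists u, cis u = z.
Proof.
move=> z1; have [x0|x0] := ltP 0 (complex.Re z);
  first by exists (asin (complex.Im z)); exact: cis_asin.
have [/eqP xz|xz] := eqVneq (complex.Re z) 0; last first.
  exists (asin (complex.Im (- z)) + pi); rewrite cisD cis_asin ?normcN //.
    by rewrite /cis cospi sinpi; case: (z) => a b; apply/eqP; rewrite eq_complex /=;
      apply/andP; split; apply/eqP; ring.
  by rewrite raddfN /= oppr_gt0 lt_def eq_sym xz.
have := normcE2 z; rewrite z1 expr1n; case: z xz {x0 z1} => x y /= /eqP -> /eqP.
rewrite expr0n add0r eq_sym sqrf_eq1 => /orP[] /eqP ->.
  by exists (pi / 2); rewrite /cis cos_pihalf sin_pihalf.
by exists (- (pi / 2)); rewrite /cis cosN sinN cos_pihalf sin_pihalf.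
Qed.

(* f takes values in 2 pi Z. *)
Lemma cis_const (f : R -> R) :
  (forall r, 0 <= r <= 1 -> {for r, continuous f}) ->
  (forall r, 0 <= r <= 1 -> cis (f r) = 1) -> f 0 = f 1.
Proof.
move=> fc f1; have p0 := pi_gt0 R.
have fc' : {within `[0, 1], continuous f}.
  by apply: continuous_in_subspaceT => r; rewrite inE /= in_itv => /fc.
(* By the intermediate value theorem every v between f 0 and f 1 is attained. If they differed, the
   smaller one plus pi would lie between them, where [cis] is -1. *)
have no v : Num.min (f 0) (f 1) <= v <= Num.max (f 0) (f 1) -> cis v != 1 -> False.
  move=> /(IVT ler01 fc')[r]; rewrite in_itv /= => /f1 h <-.
  by rewrite h eqxx.
have cispi : cis pi = -1 by rewrite /cis cospi sinpi; apply/eqP;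
  rewrite eq_complex /= oppr0 !eqxx.
have neg u : cis u = 1 -> cis (u + pi) != 1.
  move=> h; rewrite cisD h mul1r cispi eq_complex /= negb_and; apply/orP; left.
  by apply/eqP; lra.
have h0 : cis (f 0) = 1 by apply: f1; rewrite lexx ler01.
have h1 : cis (f 1) = 1 by apply: f1; rewrite lexx ler01.
have gap u v : cis u = 1 -> cis v = 1 -> u < v -> u + pi <= v.
  move=> hu hv uv; have [d hd] : exists d : int, v - u = 2 * pi * d%:~R.
    by apply: cis_eq1; rewrite cisB hu hv divr1.
  have : 0 < 2 * pi * d%:~R :> R by rewrite -hd subr_gt0.
  rewrite pmulr_rgt0 ?mulr_gt0 // ltr0z => d0.
  have : (1 : R) <= d%:~R by rewrite -[1]/(1%:~R) ler_int.
  by move=> d1; have := ler_wpM2l (ltW p0) d1; lra.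
have [lt01|lt10|//] := ltgtP (f 0) (f 1); exfalso.
- apply: (no (f 0 + pi)) (neg _ h0).
  rewrite min_l ?(ltW lt01) // max_r ?(ltW lt01) //.
  by rewrite (gap _ _ h0 h1 lt01) andbT; lra.
- apply: (no (f 1 + pi)) (neg _ h1).
  rewrite min_r ?(ltW lt10) // max_l ?(ltW lt10) //.
  by rewrite (gap _ _ h1 h0 lt10) andbT; lra.
Qed.

End Circle.

(** * Uniform partitions of the unit interval and continuous angles *)

Section Partition.
Variable R : realType.

(** A Lebesgue number: near the diagonal Q holds for all close s, s', and compactness of [0, 1] x K
    makes the admissible gap uniform in s and t. *)
Lemma uniform_partition (T : topologicalType) (K : set T) (Q : R -> R -> T -> Prop) :
  compact K ->
  (forall (s : R) t, 0 <= s <= 1 -> K t ->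
    \forall p \near ((s, s, t) : R * R * T), Q p.1.1 p.1.2 p.2) ->
  exists2 N, (0 < N)%N & forall k t, (k < N)%N -> K t ->
    Q (k%:R / N%:R) (k.+1%:R / N%:R) t.
Proof.
move=> cK h.
have cI : compact (`[0 : R, 1]%classic `*` K) by apply: compact_setX => //;
  exact: segment_compact.
have nc := (compact_near_coveringP _).1 cI R (nbhs (0 : R))
  (fun d x => Q x.1 (x.1 + d) x.2) (nbhs_filter _).
have /nc hd : forall x : R * T, (`[0, 1]%classic `*` K) x ->
    \forall x' \near x & i \near nbhs (0 : R), Q x'.1 (x'.1 + i) x'.2.
  move=> [s t] [/= s01 Kt].
  have := h s t; rewrite in_itv /= in s01 => /(_ s01 Kt) hq.
  have hc : ((y.1.1, y.1.1 + y.2, y.1.2) : R * R * T) @[y --> ((s, t, 0) : R * T * R)]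
      --> ((s, s, t) : R * R * T).
    apply: cvg_pairT; last by apply: cvg_sndT; apply: cvg_fstT; exact: cvg_id.
    apply: cvg_pairT; first by apply: cvg_fstT; apply: cvg_fstT; exact: cvg_id.
    rewrite -[X in _ --> X]addr0; apply: cvgD; last by apply: cvg_sndT; exact: cvg_id.
    by apply: cvg_fstT; apply: cvg_fstT; exact: cvg_id.
  by have := hc _ hq.
have /cvgrPdist_lt hh := @cvg_harmonic R.
case/nbhs_ballP: hd => e /= e0 he.
have [N0 _ hN] := hh e e0; exists N0.+1 => // k t kN Kt.
have := he (N0.+1%:R^-1) _ (k%:R / N0.+1%:R, t).
rewrite /= -[k.+1%:R]natr1 mulrDl mul1r; apply.
  by have := hN N0 (leqnn N0); rewrite /ball /= !sub0r.
split=> //=; rewrite in_itv /= divr_ge0 //= ler_pdivrMr // mul1r ler_nat.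
exact: ltnW.
Qed.

Lemma partition_in01 (k N : nat) : (0 < N)%N -> (k <= N)%N -> 0 <= (k%:R / N%:R : R)
  <= 1.
Proof. by move=> N0 kN; rewrite divr_ge0 //= ler_pdivrMr ?ltr0n // mul1r ler_nat. Qed.

Lemma cvg_pairl (T : topologicalType) (Y : topologicalType) (F : R * T -> Y) (s : R)
  (t : T) :
  {for (s, t), continuous F} -> F (s, t') @[t' --> t] --> F (s, t).
Proof.
move=> h; apply: (cvg_comp (fun t' => (s, t')) F) h.
by apply: cvg_pairT; [exact: cvg_cst | exact: cvg_id].
Qed.

Local Notation normc := Normc.normc.

(** On a fine partition successive quotients of L have positive real part, and theta is the sum of
    their angles. Along a path constantly equal to 1 all the summands vanish, which is the last
    clause. *)
Lemma circle_lift (T : topologicalType) (K : set T) (L : R * T -> R[i]^o) :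
  compact K ->
  (forall s t, 0 <= s <= 1 -> K t -> {for (s, t), continuous L}) ->
  (forall s t, 0 <= s <= 1 -> K t -> normc (L (s, t)) = 1) ->
  (forall t, K t -> L (0, t) = 1) ->
  exists theta : T -> R, forall t, K t ->
    [/\ {for t, continuous theta}, cis (theta t) = L (1, t) &
        (forall s, 0 <= s <= 1 -> L (s, t) = 1) -> theta t = 0].
Proof.
move=> cK Lc L1 L0.
have [|N N0 hN] := @uniform_partition T K
    (fun s s' t => 0 < complex.Re (L (s', t) * (L (s, t))^*)) cK.
  move=> s t s01 Kt.
  have Lst := Lc s t s01 Kt.
  have h : (complex.Re (L (p.1.2, p.2) * (L (p.1.1, p.2))^*)) @[p --> ((s, s,
    t) : R * R * T)]
      --> complex.Re (L (s, t) * (L (s, t))^*).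
    apply: cvg_Re; apply: cvgM; last apply: cvg_conjc.
    - apply: (cvg_comp (fun p : R * R * T => (p.1.2, p.2)) L) Lst.
      by apply: cvg_pairT; [apply: cvg_sndT; apply: cvg_fstT | apply: cvg_sndT];
        exact: cvg_id.
    - apply: (cvg_comp (fun p : R * R * T => (p.1.1, p.2)) L) Lst.
      by apply: cvg_pairT; [apply: cvg_fstT; apply: cvg_fstT | apply: cvg_sndT];
        exact: cvg_id.
  have : 0 < complex.Re (L (s, t) * (L (s, t))^*).
    by rewrite mulcJ L1 // expr1n /= ltr01.
  exact: (cvgr_gt _ h).
pose st k t := L (k.+1%:R / N%:R, t) * (L (k%:R / N%:R, t))^*.
pose th k t := \sum_(j < k) asin (complex.Im (st j t)).
have key k t : (k <= N)%N -> K t -> {for t, continuous (th k)} /\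
    cis (th k t) = L (k%:R / N%:R, t).
  move=> kN Kt; elim: k kN => [|k IH] kN.
    split; last by rewrite /th big_ord0 cis0 mul0r L0.
    have -> : th 0%N = cst 0 by apply/funext => t'; rewrite /th big_ord0.
    exact: cvg_cst.
  have [IH1 IH2] := IH (ltnW kN).
  have e1 := partition_in01 N0 kN; have e2 := partition_in01 N0 (ltnW kN).
  have n1 : normc (st k t) = 1 by rewrite Normc.normcM normcJ !L1 // mulr1.
  have r1 := hN k t kN Kt.
  have thS : th k.+1 = (fun t => th k t + asin (complex.Im (st k t))).
    by apply/funext => t'; rewrite /th big_ord_recr.
  rewrite thS; split; last first.
    rewrite cisD IH2 cis_asin // /st mulrCA mulcJ L1 // expr1n mulr1 //.
  apply: cvgD => //; apply: continuous_cvg.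
    apply: continuous_asin; have := normcE2 (st k t); rewrite n1 expr1n.
    move: r1; rewrite -/(st k t); case: (st k t) => a b /= a0 ab.
    by apply/andP; split; nra.
  apply: cvg_Im; apply: cvgM; last apply: cvg_conjc.
  - by apply: cvg_pairl; exact: Lc.
  - by apply: cvg_pairl; exact: Lc.
exists (th N) => t Kt; have [h1 h2] := key N t (leqnn N) Kt; split=> //.
  by rewrite h2 divff // pnatr_eq0 -lt0n.
move=> hs; rewrite /th big1 // => j _;
  rewrite /st !hs ?partition_in01 // ?(ltnW (ltn_ord j)) //.
rewrite rmorph1 mulr1 /= -[X in asin X](@sin0 R) sinK // in_itv /=.
by have := pi_gt0 R => p0; apply/andP; split; lra.
Qed.
End Partition.

(** * The cube *)

Section CubeBasics.
Variable R : realType.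

Lemma cvg_row (T : Type) (F : set_system T) (FF : Filter F) n (f : T -> 'rV[R]_n) (l
  : 'rV[R]_n) :
  (forall i, f t 0 i @[t --> F] --> l 0 i) -> f t @[t --> F] --> l.
Proof.
move=> h; apply/cvg_ballP => e e0.
have : \forall t \near F, forall i, ball (l 0 i) e (f t 0 i).
  by apply: filter_forall => i; have /cvg_ballP := h i; exact.
apply: filterS => t ht; split => // i j; rewrite (ord1 i); exact: ht.
Qed.

Lemma cvg_coord (T : Type) (F : set_system T) (FF : Filter F) n (f : T -> 'rV[R]_n)
  (l : 'rV[R]_n) i :
  f t @[t --> F] --> l -> f t 0 i @[t --> F] --> l 0 i.
Proof. by move=> h; apply: (cvg_comp _ (fun M : 'rV[R]_n => M 0 i) h);
  exact: coord_continuous. Qed.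

Lemma compact_cube n : compact (@cube R n).
Proof.
have := @rV_compact R n (fun=> `[0, 1]%classic) (fun=> @segment_compact R 0 1).
congr compact; apply/seteqP; split=> t /= h i; have := h i; rewrite in_itv //=.
Qed.

(** Precomposition with clamping extends a map from the cube to the whole space, so that continuity
    within the cube becomes continuity at its points, as the lifting lemmas ask. *)
Definition clamp (x : R) : R := Num.max 0 (Num.min 1 x).
Lemma clamp01 x : 0 <= clamp x <= 1.
Proof. by rewrite /clamp le_max lexx /= ge_max ler01 ge_min lexx. Qed.
Lemma clamp_id x : 0 <= x <= 1 -> clamp x = x.
Proof. by case/andP=> x0 x1; rewrite /clamp (min_r x1) (max_r x0). Qed.
Lemma cvg_clamp (T : topologicalType) (f : T -> R) (t : T) :
  {for t, continuous f} -> {for t, continuous (clamp \o f)}.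
Proof.
move=> h; apply: (@continuous_max R T (cst 0)); first exact: cst_continuous.
by apply: (@continuous_min R T (cst 1)) => //; exact: cst_continuous.
Qed.

Definition clamp_row n (t : 'rV[R]_n) : 'rV[R]_n := \row_i clamp (t 0 i).
Lemma clamp_row_cube n t : @cube R n (clamp_row t).
Proof. by move=> i; rewrite mxE clamp01. Qed.
Lemma clamp_row_id n t : @cube R n t -> clamp_row t = t.
Proof. by move=> h; apply/rowP => i; rewrite mxE clamp_id. Qed.
Lemma continuous_clamp_row n : continuous (@clamp_row n).
Proof.
move=> t; apply: (cvg_row (nbhs_filter _)) => i; rewrite mxE.
under eq_fun do rewrite mxE.
by apply: cvg_clamp; exact: coord_continuous.
Qed.

Lemma within_comp (S T : topologicalType) (X : topologicalType) (K : set T) (c : S ->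
  T) (f : T -> X) :
  continuous c -> (forall s, K (c s)) -> {within K,
    continuous f} -> continuous (f \o c).
Proof.
move=> cc cK fc s; apply: (cvg_comp (c : S -> subspace K) f) (fc (c s)).
have [_ h] := @subspace_cvgP T K (c x @[x --> s]) (c s) _ (cK s).
apply: h => U hU; have h : \forall x \near s, K (c x) -> U (c x) by exact: (cc s _ hU).
suff : \forall x \near s, U (c x) by [].
by apply: filterS h => x; apply; exact: cK.
Qed.

Lemma within_at (T X : topologicalType) (K : set T) (f : T -> X) :
  (forall x, K x -> {for x, continuous f}) -> {within K, continuous f}.
Proof. by move=> h; apply: continuous_in_subspaceT => x; rewrite inE; exact: h. Qed.

Lemma within_eq (T X : topologicalType) (K : set T) (f g : T -> X) :
  (forall x, K x -> f x = g x) -> {within K, continuous f} -> {within K, continuous g}.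
Proof. by move=> h; apply: subspace_eq_continuous => x /set_mem; exact: h. Qed.

Lemma continuous_at_if (T X : topologicalType) (a b : T -> X) (q : T -> R) (c : R) (t
  : T) :
  {for t, continuous q} -> (q t <= c -> {for t, continuous a}) ->
  (c <= q t -> {for t, continuous b}) -> (q t = c -> a t = b t) ->
  {for t, continuous (fun t => if q t <= c then a t else b t)}.
Proof.
move=> qc ac bc ab U hU; change (\forall t' \near t,
  U (if q t' <= c then a t' else b t')).
have [lt|gt|eq] := ltgtP (q t) c.
- rewrite (ltW lt) in hU.
  have h1 : \forall t' \near t, U (a t') by exact: (ac (ltW lt) _ hU).
  have h2 : \forall t' \near t, q t' < c by exact: (cvgr_lt _ qc).
  by apply: filterS2 h1 h2 => t' h3 h4; rewrite ltW.
- rewrite leNgt gt /= in hU.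
  have h1 : \forall t' \near t, U (b t') by exact: (bc (ltW gt) _ hU).
  have h2 : \forall t' \near t, c < q t' by exact: (cvgr_gt _ qc).
  by apply: filterS2 h1 h2 => t' h3 h4; rewrite leNgt h4.
- have le1 : q t <= c by rewrite eq.
  have le2 : c <= q t by rewrite eq.
  rewrite le1 in hU.
  have h1 : \forall t' \near t, U (a t') by exact: (ac le1 _ hU).
  rewrite ab // in hU.
  have h2 : \forall t' \near t, U (b t') by exact: (bc le2 _ hU).
  by apply: filterS2 h1 h2 => t' h3 h4; case: ifP.
Qed.

Lemma set_first_cube n c t : 0 <= c <= 1 -> @cube R n.+1 t -> cube (set_first c t).
Proof. by move=> c01 h i; rewrite mxE; case: ifP. Qed.

Lemma set_first_id n (t : 'rV[R]_n.+1) : set_first (t 0 ord0) t = t.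
Proof. by apply/rowP => i; rewrite mxE; case: eqP => [->|]. Qed.

Lemma cvg_set_first (T : Type) (F : set_system T) (FF : Filter F) n
    (c : T -> R) (f : T -> 'rV[R]_n.+1) c0 l :
  c t @[t --> F] --> c0 -> f t @[t --> F] --> l ->
  set_first (c t) (f t) @[t --> F] --> set_first c0 l.
Proof.
move=> hc hf; apply: cvg_row => i; rewrite mxE; under eq_fun do rewrite mxE.
by case: ifP => _ //; exact: cvg_coord.
Qed.
End CubeBasics.

(** * Lifting maps into projective space *)

Section Projective.
Variables (R : realType) (H : hilbertType R) (X : topologicalType).
Variables (st : H -> X) (P : X -> H -> H).
Local Notation normc := Normc.normc.
Local Notation "x %:C" := (x%:C)%C.

(* X is the projective space of H: st sends a nonzero vector to its line (st 0 is junk)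
   and P x is the orthogonal projection onto the line x. *)
Record projective_chart : Prop := {
  chart_surj : forall x, exists2 psi, nrm psi = 1 & x = st psi ;
  chart_scale : forall (k : R[i]) v, k != 0 -> v != 0 -> st (k *: v) = st v ;
  chart_cvg : forall v, v != 0 -> {for v, continuous st} ;
  chart_proj : forall psi v, nrm psi = 1 -> P (st psi) v = dot v psi *: psi ;
  chart_proj_cvg : forall x v, {for (x, v), continuous (fun q : X * H => P q.1 q.2)} ;
  chart_infdim : infdim H
}.
Hypothesis chart : projective_chart.

Lemma neq0_of_nrm1 (v : H) : nrm v = 1 -> v != 0.
Proof. by move=> h; rewrite -nrm0_eq0 h oner_eq0. Qed.

Lemma real_neq0 (r : R) : r != 0 -> r%:C != 0 :> R[i].
Proof. by rewrite -(inj_eq (@complexI R)). Qed.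

Lemma st_unitv v : v != 0 -> st (unitv v) = st v.
Proof. by move=> v0; rewrite chart_scale // real_neq0 // invr_neq0 // nrm0_eq0. Qed.

Lemma cvg_P (T : Type) (F : set_system T) (FF : Filter F) (f : T -> X) (g : T -> H) x
  v :
  f t @[t --> F] --> x -> g t @[t --> F] --> v -> P (f t) (g t) @[t --> F] --> P x v.
Proof.
move=> hf hg.
have h : {for (x, v), continuous (fun q : X * H => P q.1 q.2)} by exact: chart_proj_cvg.
by have := cvg_comp _ _ (cvg_pairT FF hf hg) h.
Qed.

Lemma cvg_unitv (T : Type) (F : set_system T) (FF : Filter F) (g : T -> H) v :
  v != 0 -> g t @[t --> F] --> v -> unitv (g t) @[t --> F] --> unitv v.
Proof.
move=> v0 hg; apply: cvgZ => //; apply: cvg_real_complex; apply: cvgV;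
  first by rewrite nrm0_eq0.
exact: cvg_nrm.
Qed.

(** The projection onto the common line fixes u and also sends it to <u, v> v. *)
Lemma st_eq_colinear (u v : H) : nrm u = 1 -> nrm v = 1 -> st u = st v ->
  u = dot u v *: v /\ normc (dot u v) = 1.
Proof.
move=> u1 v1 uv; have := chart_proj chart u u1;
  rewrite uv chart_proj // dotxx u1 expr1n scale1r.
move=> E; split=> //; have := u1; rewrite -{1}E nrmZ v1 mulr1 //.
Qed.


(* G t is the normalization of P (F (1, t)) ... P (F (2/N, t)) (P (F (1/N, t)) psi0). *)
Lemma projective_lift (T : topologicalType) (K : set T) (F : R * T -> X) psi0 :
  compact K ->
  (forall (s : R) t, 0 <= s <= 1 -> K t -> {for (s, t), continuous F}) ->
  nrm psi0 = 1 -> (forall t, K t -> F (0, t) = st psi0) ->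
  exists G : T -> H, forall t, K t ->
    [/\ {for t, continuous G}, nrm (G t) = 1, st (G t) = F (1, t) &
        (forall s : R, 0 <= s <= 1 -> F (s, t) = st psi0) -> G t = psi0].
Proof.
move=> cK Fc n0 F0.
(* The existence of such a v is an open way to say that the two lines are not orthogonal. *)
have [|N N0 hN] := @uniform_partition R T K
    (fun s s' t => exists v, P (F (s', t)) (P (F (s, t)) v) != 0) cK.
  move=> s t s01 Kt; have [psi psi1 Fst] := chart_surj chart (F (s, t)).
  have Fc' := Fc s t s01 Kt.
  have h : P (F (p.1.2, p.2)) (P (F (p.1.1, p.2)) psi) @[p --> ((s, s, t) : R * R * T)]
      --> P (F (s, t)) (P (F (s, t)) psi).
    apply: cvg_P; last (apply: cvg_P; last exact: cvg_cst).
    - apply: (cvg_comp (fun p : R * R * T => (p.1.2, p.2)) F) Fc'.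
      by apply: cvg_pairT; [apply: cvg_sndT; apply: cvg_fstT | apply: cvg_sndT];
        exact: cvg_id.
    - apply: (cvg_comp (fun p : R * R * T => (p.1.1, p.2)) F) Fc'.
      by apply: cvg_pairT; [apply: cvg_fstT; apply: cvg_fstT | apply: cvg_sndT];
        exact: cvg_id.
  rewrite Fst !chart_proj // dotxx psi1 expr1n scale1r dotxx psi1 expr1n scale1r in h.
  have h0 : \forall p \near ((s, s, t) : R * R * T),
      P (F (p.1.2, p.2)) (P (F (p.1.1, p.2)) psi) != 0.
    exact: (cvgr_neq0 _ h (neq0_of_nrm1 psi1)).
  by apply: filterS h0 => p hp; exists psi.
pose g := fix g k (t : T) : H := if k is k'.+1 then P (F (k'.+1%:R / N%:R,
  t)) (g k' t) else psi0.
have key k t : (k <= N)%N -> K t ->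
    [/\ {for t, continuous (g k)}, g k t != 0 & st (g k t) = F (k%:R / N%:R, t)].
  move=> kN Kt; elim: k kN => [|k IH] kN.
    split; [exact: cvg_cst | exact: neq0_of_nrm1 | by rewrite mul0r F0].
  have [c1 c2 c3] := IH (ltnW kN).
  have e1 := partition_in01 R N0 kN.
  have [psi psi1 Fst] := chart_surj chart (F (k.+1%:R / N%:R, t)).
  (* The witness v serves only to show that the two lines are not orthogonal; hence the next
     projection does not kill [g k t]. *)
  have [v] := hN k t kN Kt; rewrite Fst -c3 -(st_unitv c2) !chart_proj ?nrm_unitv //.
  rewrite scaler_eq0 negb_or => /andP[+ _].
  rewrite dotZl mulf_eq0 negb_or => /andP[_].
  rewrite dotZl mulf_eq0 negb_or => /andP[_ d0].
  split.
  - apply: cvg_P => //; apply: cvg_pairl; exact: Fc.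
  - by rewrite /= Fst chart_proj // scaler_eq0 negb_or d0 neq0_of_nrm1.
  - by rewrite /= Fst chart_proj // chart_scale // neq0_of_nrm1.
exists (fun t => unitv (g N t)) => t Kt; have [c1 c2 c3] := key N t (leqnn N) Kt; split.
- exact: cvg_unitv.
- exact: nrm_unitv.
- by rewrite st_unitv // c3 divff // pnatr_eq0 -lt0n.
move=> hs; suff gk k : (k <= N)%N -> g k t = psi0 by rewrite gk // unitv1.
elim: k => [//|k IH] kN; rewrite /= IH ?(ltnW kN) // hs ?partition_in01 //.
by rewrite chart_proj // dotxx n0 expr1n scale1r.
Qed.

(** A unit vector orthogonal to a finite 1/4-net of K is almost orthogonal to K. Any bound below 1/3
    would suit [segment_avoid]. *)
Lemma infdim_avoid (K : set H) : compact K ->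
  exists2 e, nrm e = 1 & forall w, K w -> normc (dot w e) <= 4^-1.
Proof.
move=> cK; have h4 : 0 < 4^-1 :> R by rewrite invr_gt0.
have [l hl] := finite_net cK h4; have [e e1 he] := chart_infdim chart l.
exists e => // w /hl[y yl hy]; have -> : w = y + (w - y) by rewrite addrC subrK.
rewrite dotDl he // add0r; apply: le_trans (cauchy_schwarz _ _) _.
by rewrite e1 mulr1 ltW.
Qed.

(* If the sum w + c e vanishes, then c = |w| = |<w, e>| <= 1/4, whereas
   u = w + s (u - v) and v = w - (1 - s) (u - v) give 1 <= 3 c. *)
Lemma segment_avoid (u v e : H) (s : R) : nrm u = 1 -> nrm v = 1 -> nrm e = 1 ->
  normc (dot u e) <= 4^-1 -> normc (dot v e) <= 4^-1 -> 0 <= s <= 1 ->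
  (1 - s)%:C *: u + s%:C *: v + (s * (1 - s) * nrm (u - v))%:C *: e != 0.
Proof.
move=> u1 v1 e1 ue ve /andP[s0 s1]; have s1' : 0 <= 1 - s by rewrite subr_ge0.
set c := s * (1 - s) * nrm (u - v).
have c0 : 0 <= c by rewrite !mulr_ge0 // nrm_ge0.
set w := _ + s%:C *: v; apply/negP => /eqP E.
have wE : w = - (c%:C *: e) by apply/eqP; rewrite -addr_eq0 E.
have nw : nrm w = c by rewrite wE nrmN nrmZ normc_real ger0_norm // e1 mulr1.
have c4 : c <= 4^-1.
  have : normc (dot w e) = c.
    by rewrite wE dotNl normcN dotZl dotxx e1 expr1n normc_rM // normc_real normr1
      mulr1.
  move=> <-; rewrite /w dotDl !dotZl; apply: le_trans (le_normcD _ _) _.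
  rewrite !normc_rM //.
  have := ler_wpM2l s1' ue; have := ler_wpM2l s0 ve; lra.
have hu : 1 <= c + s * nrm (u - v).
  have -> : s * nrm (u - v) = nrm (s%:C *: (u - v)) by rewrite nrmZ normc_real
    ger0_norm.
  rewrite -nw -[leLHS]u1; apply: le_trans (nrmD _ _); rewrite le_eqVlt; apply/orP; left.
  apply/eqP; congr nrm; rewrite /w rmorphB rmorph1 scalerBl scale1r scalerBr.
  by rewrite addrACA subrK subrr addr0.
have hv : 1 <= c + (1 - s) * nrm (u - v).
  have -> : (1 - s) * nrm (u - v) = nrm ((1 - s)%:C *: (u - v)) by rewrite nrmZ
    normc_real ger0_norm.
  rewrite -nw -[leLHS]v1; apply: le_trans (nrmB _ _); rewrite le_eqVlt; apply/orP; left.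
  apply/eqP; congr nrm; rewrite /w scalerBr opprB.
  rewrite [X in X + _]addrC addrACA subrr addr0 -scalerDl -rmorphD /=.
  by rewrite addrC subrK scale1r.
have d0 := nrm_ge0 (u - v).
(* The weights 1 - s and s combine both bounds to 1 <= c + 2 s (1 - s) |u - v| = 3 c. *)
have := ler_wpM2l s1' hu; have := ler_wpM2l s0 hv.
rewrite -/c; have : c = s * (1 - s) * nrm (u - v) by []. nra.
Qed.

Lemma cvg_segment (T : Type) (F : set_system T) (FF : Filter F) (u v : T -> H) (s : T
  -> R) e u0 v0 s0 :
  u t @[t --> F] --> u0 -> v t @[t --> F] --> v0 -> s t @[t --> F] --> s0 ->
  ((1 - s t)%:C *: u t + (s t)%:C *: v t + (s t * (1 - s t) * nrm (u t - v t))%:C *: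
    e) @[t --> F] -->
  (1 - s0)%:C *: u0 + s0%:C *: v0 + (s0 * (1 - s0) * nrm (u0 - v0))%:C *: e.
Proof.
move=> hu hv hs.
have hs' : (1 - s t) @[t --> F] --> 1 - s0 by apply: cvgB => //; exact: cvg_cst.
apply: cvgD; first by apply: cvgD; apply: cvgZ => //; exact: cvg_real_complex.
apply: cvgZ; last exact: cvg_cst.
apply: cvg_real_complex; apply: cvgM; first exact: cvgM.
by apply: cvg_nrm; apply: cvgB.
Qed.

Lemma sphere_homotopic n (u v : 'rV[R]_n -> H) x (f g : 'rV[R]_n -> X) :
  (forall t, cube t -> {for t, continuous u} /\ nrm (u t) = 1) ->
  (forall t, cube t -> {for t, continuous v} /\ nrm (v t) = 1) ->
  (forall t, cube_boundary t -> u t = v t) ->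
  (forall t, cube t -> st (u t) = f t) -> (forall t, cube t -> st (v t) = g t) ->
  (forall t, cube_boundary t -> f t = x) ->
  homotopic x f g.
Proof.
move=> hu hv uv uf vg fx.
have cI (w : 'rV[R]_n -> H) : (forall t, cube t -> {for t,
  continuous w} /\ nrm (w t) = 1) ->
    compact (w @` @cube R n).
  move=> hw; apply: continuous_compact; last exact: compact_cube.
  by apply: within_at => t /hw[].
have [e e1 he] := infdim_avoid (compactU (cI u hu) (cI v hv)).
have nz (s : R) t : 0 <= s <= 1 -> cube t ->
    (1 - s)%:C *: u t + s%:C *: v t + (s * (1 - s) * nrm (u t - v t))%:C *: e != 0.
  move=> s01 ct; apply: segment_avoid => //.
  - by have [] := hu t ct.
  - by have [] := hv t ct.
  - by apply: he; left; exists t.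
  - by apply: he; right; exists t.
(* The coefficient of e vanishes at s = 0, at s = 1 and wherever u = v, so the endpoints and the
   boundary values are kept. As [st] accepts nonzero vectors, the path stays unnormalized. *)
exists (fun q => st ((1 - q.1)%:C *: u q.2 + q.1%:C *: v q.2 +
   (q.1 * (1 - q.1) * nrm (u q.2 - v q.2))%:C *: e)); split.
- apply: within_at => -[s t] [/=]; rewrite in_itv /= => s01 ct.
  have [uc _] := hu t ct; have [vc _] := hv t ct.
  apply: (cvg_comp _ st) (chart_cvg chart (nz s t s01 ct)).
  apply: cvg_segment; last by apply: cvg_fstT; exact: cvg_id.
    by apply: (cvg_comp _ u) uc; apply: cvg_sndT; exact: cvg_id.
  by apply: (cvg_comp _ v) vc; apply: cvg_sndT; exact: cvg_id.
- by move=> t ct; rewrite /= subr0 mul0r mul0r !scale0r !addr0 scale1r uf.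
- by move=> t ct; rewrite /= subrr mulr0 mul0r !scale0r add0r addr0 scale1r vg.
- move=> s t s01 bt; have [ct _] := bt.
  rewrite /= (uv t bt) subrr nrm0 mulr0 scale0r addr0 -scalerDl -rmorphD /= subrK
    scale1r.
  by rewrite -uv // uf // fx.
Qed.

Lemma projective_path_connected : path_connected R X.
Proof.
split.
  have [e e1 _] := chart_infdim chart [::].
  by exists (st e).
move=> x y; have [u u1 ->] := chart_surj chart x; have [v v1 ->] := chart_surj chart y.
have [e e1 he] := chart_infdim chart [:: u; v].
pose w (s : R) := (1 - s)%:C *: u + s%:C *: v + (s * (1 - s) * nrm (u - v))%:C *: e.
exists (st \o w); split.
- apply: within_at => s; rewrite /= in_itv /= => s01.
  apply: (cvg_comp w st) (chart_cvg chart _).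
    by apply: cvg_segment; [exact: cvg_cst | exact: cvg_cst | exact: cvg_id].
  apply: segment_avoid => //; rewrite he ?inE ?eqxx ?orbT // -(nrm_normc 0) nrm0
    invr_ge0 //.
- by rewrite /= /w subr0 mul0r mul0r !scale0r !addr0 scale1r.
- by rewrite /= /w subrr mulr0 mul0r !scale0r add0r addr0 scale1r.
Qed.

End Projective.

(** * Homotopy groups of projective space *)

Section ContinuityAt.
Variables (R : realType) (H : hilbertType R) (T : topologicalType) (t : T).
Local Notation "x %:C" := (x%:C)%C.

Lemma cont_add (f g : T -> H) : {for t, continuous f} -> {for t, continuous g} ->
  {for t, continuous (fun x => f x + g x)}.
Proof. by move=> hf hg; apply: cvgD. Qed.
Lemma cont_scale (k : T -> R[i]^o) (f : T -> H) : {for t, continuous k} ->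
  {for t, continuous f} -> {for t, continuous (fun x => k x *: f x)}.
Proof. by move=> hk hf; apply: cvgZ. Qed.
Lemma cont_subr (f g : T -> R) : {for t, continuous f} -> {for t, continuous g} ->
  {for t, continuous (fun x => f x - g x)}.
Proof. by move=> hf hg; apply: cvgB. Qed.
Lemma cont_oppr (f : T -> R) : {for t, continuous f} -> {for t,
  continuous (fun x => - f x)}.
Proof. by move=> hf; apply: cvgN. Qed.
Lemma cont_mulr (f g : T -> R) : {for t, continuous f} -> {for t, continuous g} ->
  {for t, continuous (fun x => f x * g x)}.
Proof. by move=> hf hg; apply: cvgM. Qed.
Lemma cont_addc (f g : T -> R[i]^o) : {for t, continuous f} -> {for t, continuous g} ->
  {for t, continuous (fun x => f x + g x : R[i]^o)}.
Proof. by move=> hf hg; exact: (@cvgD R[i] R[i]^o T (nbhs t) _ f g _ _ hf hg). Qed.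
Lemma cont_subc (f g : T -> R[i]^o) : {for t, continuous f} -> {for t, continuous g} ->
  {for t, continuous (fun x => f x - g x : R[i]^o)}.
Proof. by move=> hf hg; exact: (@cvgB R[i] R[i]^o T (nbhs t) _ f g _ _ hf hg). Qed.
Lemma cont_mulc (f g : T -> R[i]^o) : {for t, continuous f} -> {for t, continuous g} ->
  {for t, continuous (fun x => f x * g x : R[i]^o)}.
Proof. by move=> hf hg; exact: (@cvgM R[i] T (nbhs t) _ f g _ _ hf hg). Qed.
Lemma cont_real_complex (f : T -> R) : {for t, continuous f} ->
  {for t, continuous (fun x => (f x)%:C : R[i]^o)}.
Proof. exact: cvg_real_complex. Qed.
Lemma cont_cis (f : T -> R) : {for t, continuous f} ->
  {for t, continuous (fun x => cis (f x) : R[i]^o)}.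
Proof. exact: cvg_cis. Qed.
End ContinuityAt.

Lemma cont_coord (R : realType) n (i : 'I_n) (t : 'rV[R]_n) :
  {for t, continuous (fun x : 'rV[R]_n => x 0 i)}.
Proof. exact: coord_continuous. Qed.

Section HomotopyGroups.
Variables (R : realType) (H : hilbertType R) (X : topologicalType).
Variables (st : H -> X) (P : X -> H -> H).
Hypothesis chart : projective_chart st P.
Local Notation normc := Normc.normc.
Local Notation "x %:C" := (x%:C)%C.
Variable psi0 : H.
Hypothesis psi01 : nrm psi0 = 1.
Local Notation x0 := (st psi0).

Definition set_coord n (j : 'I_n) (c : R) (t : 'rV[R]_n) : 'rV[R]_n :=
  \row_i if i == j then c else t 0 i.

Lemma set_coord_cube n (j : 'I_n) c t : 0 <= c <= 1 -> cube t -> cube (set_coord j c t).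
Proof. by move=> c01 h i; rewrite mxE; case: ifP. Qed.

Lemma set_coord_id n (j : 'I_n) (t : 'rV[R]_n) : set_coord j (t 0 j) t = t.
Proof. by apply/rowP => i; rewrite mxE; case: eqP => [->|]. Qed.

Lemma cvg_set_coord (T : Type) (F : set_system T) (FF : Filter F) n (j : 'I_n)
    (c : T -> R) (f : T -> 'rV[R]_n) c0 l :
  c t @[t --> F] --> c0 -> f t @[t --> F] --> l ->
  set_coord j (c t) (f t) @[t --> F] --> set_coord j c0 l.
Proof.
move=> hc hf; apply: cvg_row => i; rewrite mxE; under eq_fun do rewrite mxE.
by case: ifP => _ //; exact: cvg_coord.
Qed.

Lemma boundary_first n c (t : 'rV[R]_n.+1) : cube t -> c = 0 \/ c = 1 ->
  cube_boundary (set_first c t).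
Proof.
move=> ct hc; split; last by exists ord0; rewrite mxE eqxx.
by apply: set_first_cube => //; case: hc => ->; rewrite ?lexx ?ler01.
Qed.

Lemma boundary_other n c (t : 'rV[R]_n.+1) : cube t -> 0 <= c <= 1 ->
  (exists2 i, i != ord0 & t 0 i = 0 \/ t 0 i = 1) -> cube_boundary (set_first c t).
Proof.
move=> ct hc [i i0 hi]; split; first exact: set_first_cube.
by exists i; rewrite mxE (negPf i0).
Qed.

Lemma mul01 (s c : R) : 0 <= s <= 1 -> 0 <= c <= 1 -> 0 <= s * c <= 1.
Proof. by move=> /andP[s0 s1] /andP[c0 c1]; rewrite mulr_ge0 //= mulr_ile1. Qed.

(** The lift is taken along the first coordinate, from the face where it is 0, with r as part of the
    compact parameter. Over the side faces this path stays at the base point, so the lift stays at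
    [psi0]; only the face where the first coordinate is 1 is left uncontrolled. *)
Lemma first_lift n (h : R * 'rV[R]_n.+1 -> X) :
  (forall r t, 0 <= r <= 1 -> cube t -> {for (r, t), continuous h}) ->
  (forall r t, 0 <= r <= 1 -> cube_boundary t -> h (r, t) = x0) ->
  exists G : R * 'rV[R]_n.+1 -> H, forall r t, 0 <= r <= 1 -> cube t ->
    [/\ {for (r, t), continuous G}, nrm (G (r, t)) = 1, st (G (r, t)) = h (r, t) &
        t 0 ord0 = 0 \/ (exists2 i, i != ord0 & t 0 i = 0 \/ t 0 i = 1) ->
        G (r, t) = psi0].
Proof.
move=> hc hb; pose K : set (R * 'rV[R]_n.+1) := `[0, 1]%classic `*` @cube R n.+1.
have cK : compact K by apply: compact_setX;
  [exact: segment_compact | exact: compact_cube].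
pose F (q : R * (R * 'rV[R]_n.+1)) := h (q.2.1, set_first (q.1 * q.2.2 0 ord0) q.2.2).
have [||G hG] := @projective_lift _ _ _ _ _ chart _ K F psi0 cK _ psi01.
- move=> s [r t] s01 [/=]; rewrite in_itv /= => r01 ct.
  have c01 := mul01 s01 (ct ord0).
  apply: (cvg_comp (fun q : R * (R * 'rV[R]_n.+1) => (q.2.1,
    set_first (q.1 * q.2.2 0 ord0) q.2.2)) h)
    (hc r (set_first (s * t 0 ord0) t) r01 (set_first_cube c01 ct)).
  have t2 : q.2.2 @[q --> ((s, (r, t)) : R * (R * 'rV[R]_n.+1))] --> t.
    by apply: cvg_sndT; apply: cvg_sndT; exact: cvg_id.
  apply: cvg_pairT; first by apply: cvg_fstT; apply: cvg_sndT; exact: cvg_id.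
  apply: cvg_set_first => //; apply: cvgM; first by apply: cvg_fstT; exact: cvg_id.
  exact: cvg_coord.
- move=> [r t] [/=]; rewrite in_itv /= => r01 ct; rewrite /F /= mul0r hb //.
  by apply: boundary_first => //; left.
exists G => r t r01 ct.
have Krt : K (r, t) by split; rewrite //= in_itv.
have [h1 h2 h3 h4] := hG _ Krt; split=> //.
  by rewrite h3 /F /= mul1r set_first_id.
move=> hside; apply: h4 => s s01; rewrite /F /=; apply: hb => //.
case: hside => [t0|hi]; first by rewrite t0 mulr0; apply: boundary_first => //; left.
by apply: boundary_other => //; exact: mul01.
Qed.

Section Face.
Variables (n : nat) (h : R * 'rV[R]_n.+1 -> X) (G : R * 'rV[R]_n.+1 -> H).
Hypothesis hb : forall r t, 0 <= r <= 1 -> cube_boundary t -> h (r, t) = x0.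
Hypothesis hG : forall r t, 0 <= r <= 1 -> cube t ->
    [/\ {for (r, t), continuous G}, nrm (G (r, t)) = 1, st (G (r, t)) = h (r, t) &
        t 0 ord0 = 0 \/ (exists2 i, i != ord0 & t 0 i = 0 \/ t 0 i = 1) ->
        G (r, t) = psi0].

(* On the face t_0 = 1 the lift stays in the fibre over the base point. *)
Definition face (q : R * 'rV[R]_n.+1) : R[i]^o := dot (G (q.1, set_first 1 q.2)) psi0.

Lemma one01 : 0 <= (1 : R) <= 1. Proof. by rewrite ler01 lexx. Qed.
Lemma zero01 : 0 <= (0 : R) <= 1. Proof. by rewrite ler01 lexx. Qed.

Lemma faceP r t : 0 <= r <= 1 -> cube t ->
  [/\ {for (r, t), continuous face}, G (r, set_first 1 t) = face (r, t) *: psi0,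
      normc (face (r, t)) = 1 &
      (exists2 i, i != ord0 & t 0 i = 0 \/ t 0 i = 1) -> face (r, t) = 1].
Proof.
move=> r01 ct; have ct1 := set_first_cube one01 ct.
have [h1 h2 h3 h4] := hG r01 ct1.
have hx : st (G (r, set_first 1 t)) = x0.
  by rewrite h3 hb //; apply: boundary_first => //; right.
have [e1 e2] := st_eq_colinear chart h2 psi01 hx; split=> //.
- apply: cvg_dot; last exact: cvg_cst.
  apply: (cvg_comp (fun q : R * 'rV[R]_n.+1 => (q.1, set_first 1 q.2)) G) h1.
  apply: cvg_pairT; first by apply: cvg_fstT; exact: cvg_id.
  by apply: cvg_set_first; [exact: cvg_cst | apply: cvg_sndT; exact: cvg_id].
- move=> [i i0 hi]; rewrite /face /= h4 ?dotxx ?psi01 ?expr1n //.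
  by right; exists i => //; rewrite mxE (negPf i0).
Qed.
End Face.

Lemma cube0 n : cube (0 : 'rV[R]_n).
Proof. by move=> i; rewrite mxE zero01. Qed.

Lemma cube_scale n (s : R) (t : 'rV[R]_n) : 0 <= s <= 1 -> cube t -> cube (s *: t).
Proof. by move=> s01 ct i; rewrite mxE mul01. Qed.

(** On the last face the lift is [psi0] times a phase [lam]. For n <> 1 this phase has a continuous
    angle theta that vanishes on the side faces, and the factor cis (- t_0 theta) undoes it. *)
Lemma spheroid_lift n (f : 'rV[R]_n.+1 -> X) : n != 1%N -> spheroid x0 f ->
  exists g : 'rV[R]_n.+1 -> H, forall t, cube t ->
    [/\ {for t, continuous g}, nrm (g t) = 1, st (g t) = f t &
        cube_boundary t -> g t = psi0].
Proof.
move=> n1 [fc fb]; pose h (q : R * 'rV[R]_n.+1) := f (clamp_row q.2).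
have hE r t : cube t -> h (r, t) = f t by move=> ct; rewrite /h /= clamp_row_id.
have hc r t : {for (r, t), continuous h}.
  apply: (within_comp (c := fun q : R * 'rV[R]_n.+1 => clamp_row q.2) _ _ fc).
    move=> [r' t']; apply: (cvg_comp snd (@clamp_row R n.+1)); first exact: cvg_snd.
    exact: continuous_clamp_row.
  by move=> q; exact: clamp_row_cube.
have hb r t : 0 <= r <= 1 -> cube_boundary t -> h (r, t) = x0.
  by move=> _ bt; rewrite hE ?fb //; case: bt.
have [G hG] := first_lift (fun r t _ _ => hc r t) hb.
pose lam t := face G (0, t).
have lamP := faceP hb hG zero01.
have lamc t : cube t -> {for t, continuous lam}.
  by move=> /lamP[h1 _ _ _]; exact: cvg_pairl.
have [theta hth] : exists theta : 'rV[R]_n.+1 -> R, forall t, cube t ->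
    [/\ {for t, continuous theta}, cis (theta t) = lam t &
     (exists2 i, i != ord0 & t 0 i = 0 \/ t 0 i = 1) -> theta t = 0].
  (* For n = 0 the face is a point and the angle a constant. For n >= 2 the angle is built along the
     rays s t from the origin, where [lam] is 1. *)
  case: n n1 f fc fb h hE hc hb G hG @lam lamP lamc =>
    [|[//|n]] _ f fc fb h hE hc hb G hG lam lamP lamc.
    have [_ _ l1 _] := lamP 0 (@cube0 1); have [u hu] := cis_surj l1.
    exists (cst u) => t ct; split; first exact: cst_continuous.
      rewrite hu /lam /face /=; congr (dot (G (_, _)) _).
      by apply/rowP => i; rewrite !mxE (ord1 i).
    by case=> i; rewrite (ord1 i).
  have [|||theta hth] := @circle_lift R _ _ (fun q : R * 'rV[R]_n.+3 =>
    lam (q.1 *: q.2)) (@compact_cube R n.+3).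
  - move=> s t s01 ct.
    apply: (cvg_comp (fun q : R * 'rV[R]_n.+3 =>
      q.1 *: q.2) lam) (lamc _ (cube_scale s01 ct)).
    apply: (cvg_row (nbhs_filter _)) => i; rewrite mxE; under eq_fun do rewrite mxE.
    apply: cvgM; first by apply: cvg_fstT; exact: cvg_id.
    by apply: cvg_coord; apply: cvg_sndT; exact: cvg_id.
  - by move=> s t s01 ct; have [_ _] := lamP _ (cube_scale s01 ct).
  - move=> t ct; rewrite /= scale0r; have [_ _ _ h1] := lamP _ (@cube0 n.+3); apply: h1.
    by exists ord_max => //; rewrite mxE; left.
  exists theta.
  (* A ray stays in the side face t_i = 0, where [lam] is 1. *)
  have th0 t i : cube t -> i != ord0 -> t 0 i = 0 -> theta t = 0.
    move=> ct i0 ti; have [_ _ h1] := hth t ct; apply: h1 => s s01 /=.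
    have [_ _ _ h2] := lamP _ (cube_scale s01 ct); apply: h2.
    by exists i => //; rewrite mxE ti mulr0; left.
  move=> t ct; have [h1 h2 _] := hth t ct; rewrite /= scale1r in h2;
    split=> // -[i i0 [|ti]].
    exact: th0.
  (* A point with t_i = 1 is joined inside that face to a point with t_j = 0. On this path theta
     lies in 2 pi Z, so it is constant. The second side coordinate j exists because n >= 2. *)
  have [j j0 ji] : exists2 j : 'I_n.+3, j != ord0 & i != j.
    have [->|im] := eqVneq i ord_max; last by exists ord_max.
    by exists (inord 1); rewrite -val_eqE /= inordK.
  have tj := ct j.
  rewrite -[t](set_coord_id j); have t0 := th0 (set_coord j 0 t) j.
  pose path r := theta (set_coord j (r * t 0 j) t).
  have pc r : 0 <= r <= 1 -> cube (set_coord j (r * t 0 j) t).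
    by move=> r01; apply: set_coord_cube => //; exact: mul01.
  have -> : theta (set_coord j (t 0 j) t) = path 1 by rewrite /path mul1r.
  rewrite -(@cis_const R path).
  - by rewrite /path mul0r t0 // ?mxE ?eqxx //; exact: set_coord_cube zero01 ct.
  - move=> r r01; have [c1 _ _] := hth _ (pc r r01).
    apply: (cvg_comp (fun r : R => set_coord j (r * t 0 j) t) theta) c1.
    apply: (cvg_set_coord (nbhs_filter _)); last exact: cvg_cst.
    by apply: cvgM; [exact: cvg_id | exact: cvg_cst].
  - move=> r r01; have [_ c2 _] := hth _ (pc r r01); rewrite /path c2 /= scale1r.
    have [_ _ _ h3] := lamP _ (pc r r01); apply: h3.
    by exists i => //; rewrite mxE (negPf ji); right.
exists (fun t : 'rV[R]_n.+1 => cis (- (t 0 ord0 * theta t)) *: G (0, t)) => t ct.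
have [g1 g2 g3 g4] := hG 0 t zero01 ct; have [t1 t2 t3] := hth t ct; split.
- apply: cont_scale; last exact: cvg_pairl.
  by apply: cont_cis; apply: cont_oppr; apply: cont_mulr => //; exact: cont_coord.
- by rewrite nrmZ normc_cis g2 mulr1.
- by rewrite (chart_scale chart) ?cis_neq0 ?neq0_of_nrm1 // g3 hE.
- case=> _ [i hi]; have [i0|i0] := eqVneq i ord0; last first.
    have hi' : exists2 i, i != ord0 & t 0 i = 0 \/ t 0 i = 1 by exists i.
    by rewrite t3 // mulr0 oppr0 cis0 scale1r g4 //; right.
  move: hi; rewrite i0 => -[t00|t01].
    by rewrite t00 mul0r oppr0 cis0 scale1r g4 //; left.
  rewrite t01 mul1r cisN t2.
  have tE : t = set_first 1 t by rewrite -t01 set_first_id.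
  have [_ l2 l3 _] := lamP t ct; rewrite [in G _]tE l2 scalerA mulVf ?scale1r //.
  by rewrite -t2 cis_neq0.
Qed.

Lemma spheroids_homotopic n (f g : 'rV[R]_n.+1 -> X) : n != 1%N ->
  spheroid x0 f -> spheroid x0 g -> homotopic x0 f g.
Proof.
move=> n1 sf sg; have [u hu] := spheroid_lift n1 sf; have [v hv] := spheroid_lift n1 sg.
apply: (@sphere_homotopic _ _ _ _ _ chart _ u v).
- by move=> t /hu[].
- by move=> t /hv[].
- move=> t bt; have [ct _] := bt; have [_ _ _ h1] := hu t ct;
  have [_ _ _ h2] := hv t ct.
  by rewrite h1 // h2.
- by move=> t /hu[].
- by move=> t /hv[].
- by move=> t bt; case: sf => _; exact.
Qed.

Lemma cst_spheroid n : spheroid x0 (cst x0 : 'rV[R]_n -> X).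
Proof. by split=> //; apply: within_at => t _; exact: cst_continuous. Qed.

Lemma trivial_homotopy_group n : n != 1%N ->
  @homotopy_group R X n.+1 x0 = [set homotopy_class x0 (cst x0)].
Proof.
move=> n1; have hcl f : spheroid x0 f -> @homotopy_class R X n.+1 x0 f = spheroid x0.
  move=> sf; apply/seteqP; split=> [g [] //|g sg]; split=> //.
  exact: spheroids_homotopic.
apply/seteqP; split=> [_ [f sf <-]|_ ->] /=.
  by rewrite !hcl //; exact: cst_spheroid.
by exists (cst x0) => //; exact: cst_spheroid.
Qed.


Local Notation t1 := (ord0 : 'I_2).
Local Notation t2 := (ord_max : 'I_2).

Lemma ord2P (i : 'I_2) : i = t1 \/ i = t2.
Proof. by case: i => -[|[|//]] hi; [left | right]; apply: val_inj. Qed.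

(* The phase 2 pi d t2 on the face t1 = 1 winds d times around the fibre over the
   base point, so that d is the image of the class of f under pi_2 -> pi_1(S^1). *)
Definition has_degree (f : 'rV[R]_2 -> X) (d : int) :=
  exists G : 'rV[R]_2 -> H, forall t, cube t ->
    [/\ {for t, continuous G}, nrm (G t) = 1, st (G t) = f t,
        t 0 t1 = 0 \/ t 0 t2 = 0 \/ t 0 t2 = 1 -> G t = psi0 &
        t 0 t1 = 1 -> G t = cis (2 * pi * d%:~R * t 0 t2) *: psi0].

(** The angle theta on the last face is measured from t2 = 0. At the corner (1, 1) it lies in 2 pi Z
    and varies continuously with r, so all members of the family share one winding number d. *)
Lemma degree_family (h : R * 'rV[R]_2 -> X) :
  (forall r t, 0 <= r <= 1 -> cube t -> {for (r, t), continuous h}) ->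
  (forall r t, 0 <= r <= 1 -> cube_boundary t -> h (r, t) = x0) ->
  exists d, has_degree (fun t => h (0, t)) d /\ has_degree (fun t => h (1, t)) d.
Proof.
move=> hc hb; have [G hG] := first_lift hc hb.
have lamP := faceP hb hG.
pose K : set (R * 'rV[R]_2) := `[0, 1]%classic `*` @cube R 2.
have cK : compact K by apply: compact_setX;
  [exact: segment_compact | exact: compact_cube].
have Kin r t : 0 <= r <= 1 -> cube t -> K (r, t) by move=> r01 ct; split;
  rewrite //= in_itv.
pose L (q : R * (R * 'rV[R]_2)) : R[i]^o :=
  face G (q.2.1, set_coord t2 (q.1 * q.2.2 0 t2) q.2.2).
have lc (s : R) t : 0 <= s <= 1 -> cube t -> cube (set_coord t2 (s * t 0 t2) t).
  by move=> s01 ct; apply: set_coord_cube => //; exact: mul01.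
have [|||theta hth] := @circle_lift R _ K L cK.
- move=> s [r t] s01 [/=]; rewrite in_itv /= => r01 ct.
  have [fc _ _ _] := lamP r _ r01 (lc s t s01 ct).
  apply: (cvg_comp (fun q : R * (R * 'rV[R]_2) => (q.2.1,
    set_coord t2 (q.1 * q.2.2 0 t2) q.2.2)) (face G)) fc.
  have c2 : q.2.2 @[q --> ((s, (r, t)) : R * (R * 'rV[R]_2))] --> t.
    by apply: cvg_sndT; apply: cvg_sndT; exact: cvg_id.
  apply: cvg_pairT; first by apply: cvg_fstT; apply: cvg_sndT; exact: cvg_id.
  apply: cvg_set_coord => //; apply: cvgM; first by apply: cvg_fstT; exact: cvg_id.
  exact: cvg_coord.
- move=> s [r t] s01 [/=]; rewrite in_itv /= => r01 ct.
  by have [_ _] := lamP r _ r01 (lc s t s01 ct).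
- move=> [r t] [/=]; rewrite in_itv /= => r01 ct.
  have [_ _ _ h1] := lamP r _ r01 (lc 0 t zero01 ct); apply: h1.
  by exists t2 => //; rewrite mxE eqxx mul0r; left.
have th1 r t : 0 <= r <= 1 -> cube t ->
    {for (r, t), continuous theta} /\ cis (theta (r, t)) = face G (r, t).
  move=> r01 ct; have [c1 c2 _] := hth _ (Kin r t r01 ct); split=> //.
  by rewrite c2 /L /= mul1r set_coord_id.
have th0 r t : 0 <= r <= 1 -> cube t -> t 0 t2 = 0 -> theta (r, t) = 0.
  move=> r01 ct t0; have [_ _ c3] := hth _ (Kin r t r01 ct); apply: c3 => s s01.
  have [_ _ _ h1] := lamP r _ r01 (lc s t s01 ct); apply: h1.
  by exists t2 => //; rewrite mxE eqxx t0 mulr0; left.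
pose ones : 'rV[R]_2 := const_mx 1.
have c1s : cube ones by move=> i; rewrite mxE one01.
have f1 r : 0 <= r <= 1 -> cis (theta (r, ones)) = 1.
  move=> r01; have [_ ->] := th1 r ones r01 c1s; have [_ _ _ h1] := lamP r _ r01 c1s.
  by apply: h1; exists t2 => //; rewrite mxE; right.
have th01 : theta (0, ones) = theta (1, ones).
  apply: (@cis_const R (fun r => theta (r, ones))) => // r r01.
  have [c1 _] := th1 r ones r01 c1s.
  apply: (cvg_comp (fun r => (r, ones)) theta) c1.
  by apply: cvg_pairT; [exact: cvg_id | exact: cvg_cst].
have [d hd] := cis_eq1 (f1 0 zero01).
suff key r : 0 <= r <= 1 -> theta (r, ones) = 2 * pi * d%:~R ->
    has_degree (fun t => h (r, t)) d.
  by exists d; split; apply: key; rewrite ?zero01 ?one01 // -th01.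
move=> r01 hr.
(* This factor replaces the angle theta on the face t1 = 1 by the linear one. It is 1 where t1 = 0,
   where t2 = 0 and where t2 = 1, as theta is 0 at t2 = 0 and 2 pi d at the corner. *)
exists (fun t : 'rV[R]_2 => cis (t 0 t1 * (2 * pi * d%:~R * t 0 t2 - theta (r,
  set_first 1 t))) *: G (r, t)).
move=> t ct; have ct1 := set_first_cube one01 ct.
have [g1 g2 g3 g4] := hG r t r01 ct; have [u1 u2] := th1 r _ r01 ct1; split.
- apply: cont_scale; last exact: cvg_pairl.
  apply: cont_cis; apply: cont_mulr; first exact: cont_coord.
  apply: cont_subr; first by apply: cont_mulr;
    [exact: cst_continuous | exact: cont_coord].
  apply: (cvg_comp (fun t => (r, set_first 1 t)) theta) u1.
  apply: (cvg_pairT (nbhs_filter _)); first exact: cvg_cst.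
  by apply: (cvg_set_first (nbhs_filter _)); [exact: cvg_cst | exact: cvg_id].
- by rewrite nrmZ normc_cis g2 mulr1.
- by rewrite (chart_scale chart) ?cis_neq0 ?neq0_of_nrm1.
- case=> [t0|[t0|t1']].
  + by rewrite t0 mul0r cis0 scale1r g4 //; left.
  + rewrite t0 mulr0 th0 // ?subrr ?mulr0 ?cis0 ?scale1r ?mxE // g4 //.
    by right; exists t2 => //; left.
  + have -> : set_first 1 t = ones.
      by apply/rowP => i; rewrite !mxE; case: (ord2P i) => ->.
    rewrite t1' mulr1 hr subrr mulr0 cis0 scale1r g4 //.
    by right; exists t2 => //; right.
- move=> t11; rewrite t11 mul1r.
  have tE : set_first 1 t = t by rewrite -t11 set_first_id.
  have [_ l2 _ _] := lamP r t r01 ct; rewrite tE in l2 u2 *.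
  by rewrite cisB u2 l2 scalerA divfK // -u2 cis_neq0.
Qed.

Lemma has_degree_eq (f g : 'rV[R]_2 -> X) d :
  (forall t, cube t -> f t = g t) -> has_degree f d -> has_degree g d.
Proof. by move=> fg [G hG]; exists G => t ct; have [] := hG t ct; rewrite fg. Qed.

Lemma homotopic_degree (f g : 'rV[R]_2 -> X) : homotopic x0 f g ->
  exists d, has_degree f d /\ has_degree g d.
Proof.
case=> h [hc h0 h1 hb].
pose c (q : R * 'rV[R]_2) := (clamp q.1, clamp_row q.2).
have cc : continuous c.
  move=> [r t]; apply: cvg_pairT.
    apply: (@cvg_clamp R _ (fst : R * 'rV[R]_2 -> R) (r, t)); exact: cvg_fst.
  by apply: (cvg_comp snd (@clamp_row R 2));
    [exact: cvg_snd | exact: continuous_clamp_row].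
have cE r t : 0 <= r <= 1 -> cube t -> c (r, t) = (r, t).
  by move=> r01 ct; rewrite /c /= clamp_id // clamp_row_id.
have [|r t r01 bt|d [d0 d1]] := @degree_family (h \o c).
- move=> r t _ _; apply: within_comp hc (r, t) => // q; split;
  last exact: clamp_row_cube.
  by rewrite /= in_itv /= clamp01.
- have [ct _] := bt; rewrite /= cE // hb //.
exists d; split; [apply: has_degree_eq d0 | apply: has_degree_eq d1] => t ct.
- by rewrite /= cE ?zero01 // h0.
- by rewrite /= cE ?one01 // h1.
Qed.

Lemma homotopic_refl n (f : 'rV[R]_n -> X) x : spheroid x f -> homotopic x f f.
Proof.
case=> fc fb; exists (fun q => f q.2); split=> //; last by move=> s t _; exact: fb.
apply: (@within_eq _ _ _ (fun q => f (clamp_row q.2))).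
  by move=> [r t] [_ ct]; rewrite /= clamp_row_id.
apply: within_at => -[r t] _.
apply: (within_comp (c := fun q : R * 'rV[R]_n => clamp_row q.2) _ _ fc).
  move=> [r' t']; apply: (cvg_comp snd (@clamp_row R n)); first exact: cvg_snd.
  exact: continuous_clamp_row.
by move=> q; exact: clamp_row_cube.
Qed.

(** Two lifts of f differ by a phase [mu] that is 1 on three sides and thus has an angle [eta]
    vanishing for t2 = 0 and t2 = 1. On the side t1 = 1 this angle can differ from 2 pi (d' - d) t2
    only by a constant, so d' = d. *)
Lemma has_degree_inj (f : 'rV[R]_2 -> X) d d' : has_degree f d -> has_degree f d' ->
  d = d'.
Proof.
move=> [G hG] [G' hG'].
pose mu t : R[i]^o := dot (G' t) (G t).
have muP t : cube t -> [/\ {for t, continuous mu},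
  G' t = mu t *: G t & normc (mu t) = 1].
  move=> ct; have [a1 a2 a3 _ _] := hG t ct; have [b1 b2 b3 _ _] := hG' t ct.
  have [e1 e2] := st_eq_colinear chart b2 a2 (etrans b3 (esym a3)); split=> //.
  exact: (cvg_dot (nbhs_filter t) b1 a1).
have mu1 t : cube t -> t 0 t1 = 0 \/ t 0 t2 = 0 \/ t 0 t2 = 1 -> mu t = 1.
  move=> ct ht; have [_ _ _ a4 _] := hG t ct; have [_ _ _ b4 _] := hG' t ct.
  by rewrite /mu a4 // b4 // dotxx psi01 expr1n.
have lc (s : R) t : 0 <= s <= 1 -> cube t -> cube (set_first (s * t 0 t1) t).
  by move=> s01 ct; apply: set_first_cube => //; exact: mul01.
have [|||eta heta] := @circle_lift R _ _ (fun q : R * 'rV[R]_2 =>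
  mu (set_first (q.1 * q.2 0 t1) q.2)) (@compact_cube R 2).
- move=> s t s01 ct; have [c1 _ _] := muP _ (lc s t s01 ct).
  apply: (cvg_comp (fun q : R * 'rV[R]_2 => set_first (q.1 * q.2 0 t1) q.2) mu) c1.
  have c2 : q.2 @[q --> ((s, t) : R * 'rV[R]_2)] --> t by apply: cvg_sndT;
    exact: cvg_id.
  apply: cvg_set_first => //; apply: cvgM; first by apply: cvg_fstT; exact: cvg_id.
  exact: cvg_coord.
- by move=> s t s01 ct; have [_ _] := muP _ (lc s t s01 ct).
- move=> t ct; apply: mu1; first exact: lc zero01 ct.
  by left; rewrite mxE eqxx mul0r.
have et1 t : cube t -> {for t, continuous eta} /\ cis (eta t) = mu t.
  move=> ct; have [c1 c2 _] := heta t ct; split=> //.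
  by rewrite c2 /= mul1r set_first_id.
have et0 t : cube t -> t 0 t2 = 0 \/ t 0 t2 = 1 -> eta t = 0.
  move=> ct ht; have [_ _ c3] := heta t ct; apply: c3 => s s01 /=.
  by apply: mu1; [exact: lc | rewrite !mxE /=; right].
pose path (r : R) : 'rV[R]_2 := set_coord t2 r (const_mx 1).
have pc r : 0 <= r <= 1 -> cube (path r).
  by move=> r01; apply: set_coord_cube => // i; rewrite mxE one01.
pose zeta r := eta (path r) - 2 * pi * (d' - d)%:~R * r.
have : zeta 0 = zeta 1.
  apply: cis_const => r r01.
    have [c1 _] := et1 _ (pc r r01); apply: cvgB.
      apply: (cvg_comp path eta) c1.
      by apply: (cvg_set_coord (nbhs_filter _)); [exact: cvg_id | exact: cvg_cst].
    by apply: cvgM; [exact: cvg_cst | exact: cvg_id].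
  have [_ c2] := et1 _ (pc r r01).
  have [_ _ _ _ a5] := hG _ (pc r r01); have [_ _ _ _ b5] := hG' _ (pc r r01).
  have p1 : path r 0 t1 = 1 by rewrite !mxE.
  have p2 : path r 0 t2 = r by rewrite !mxE eqxx.
  rewrite cisB c2 /mu a5 // b5 // p2 dotZl dotZr dotxx psi01 expr1n mulr1 -cis_conj
    -cisD.
  by rewrite -cisB -cis0; congr cis; rewrite rmorphB /=; ring.
have z0 : eta (path 0) = 0 by apply: et0; [exact: pc zero01 | rewrite !mxE eqxx; left].
have z1 : eta (path 1) = 0 by apply: et0; [exact: pc one01 | rewrite !mxE eqxx; right].
rewrite /zeta z0 z1 mulr0 mulr1 subr0.
move/eqP; rewrite sub0r eq_sym oppr_eq0 mulf_eq0 gt_eqF ?mulr_gt0 ?pi_gt0 //= intr_eq0.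
by rewrite subr_eq0 => /eqP.
Qed.

Lemma has_degree_spheroid f d : has_degree f d -> spheroid x0 f.
Proof.
move=> [G hG]; split.
  apply: (@within_eq _ _ _ (st \o G)); first by move=> t /hG[].
  apply: within_at => t ct; have [a1 a2 _ _ _] := hG t ct.
  by apply: (cvg_comp G st) (chart_cvg chart _) => //; exact: neq0_of_nrm1.
move=> t [ct [i hi]]; have [_ _ <- a4 a5] := hG t ct.
case: (ord2P i) hi => -> hi; last by rewrite a4 //; right.
case: hi => hi; first by rewrite a4 //; left.
by rewrite a5 // (chart_scale chart) ?cis_neq0 ?neq0_of_nrm1.
Qed.

(** The linear normal form on the side t1 = 1 makes the two lifts agree on the whole boundary. *)
Lemma homotopic_of_degree f g d : has_degree f d -> has_degree g d -> homotopic x0 f g.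
Proof.
move=> df dg; have [_ fb] := has_degree_spheroid df.
case: df dg => [u hu] [v hv]; apply: (@sphere_homotopic _ _ _ _ _ chart _ u v) => //.
- by move=> t /hu[].
- by move=> t /hv[].
- move=> t [ct [i hi]]; have [_ _ _ a4 a5] := hu t ct; have [_ _ _ b4 b5] := hv t ct.
  case: (ord2P i) hi => -> hi; last by rewrite a4 ?b4 //; right.
  case: hi => hi; first by rewrite a4 ?b4 //; left.
  by rewrite a5 // b5.
- by move=> t /hu[].
- by move=> t /hv[].
Qed.

(** The lift of g is rotated by cis (2 pi d t2) to start where the lift of f ends; on the last side
    the two phases multiply. *)
Lemma has_degree_concat f g d e : has_degree f d -> has_degree g e ->
  has_degree (concat f g) (d + e).
Proof.
move=> [u hu] [v hv].
pose a (t : 'rV[R]_2) := u (set_first (2 * t 0 t1) t).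
pose b (t : 'rV[R]_2) := cis (2 * pi * d%:~R * t 0 t2) *: v (set_first (2 * t 0 t1 -
  1) t).
have ca (t : 'rV[R]_2) : cube t -> t 0 t1 <= 2^-1 -> cube (set_first (2 * t 0 t1) t).
  move=> ct h; apply: set_first_cube => //; have /andP[h0 _] := ct t1.
  by apply/andP; split; lra.
have cb (t : 'rV[R]_2) : cube t -> 2^-1 <= t 0 t1 -> cube (set_first (2 * t 0 t1 - 1)
  t).
  move=> ct h; apply: set_first_cube => //; have /andP[_ h1] := ct t1.
  by apply/andP; split; lra.
have cisd (t : 'rV[R]_2) : t 0 t2 = 0 \/ t 0 t2 = 1 -> cis (2 * pi * d%:~R * t 0 t2)
  = 1.
  by case=> ->; rewrite ?mulr0 ?cis0 // mulr1 cis_int.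
have cd (t : 'rV[R]_2) : {for t, continuous (fun t : 'rV[R]_2 => 2 * t 0 t1)}.
  by apply: cont_mulr; [exact: cst_continuous | exact: cont_coord].
exists (fun t : 'rV[R]_2 => if t 0 t1 <= 2^-1 then a t else b t) => t ct; split.
- apply: continuous_at_if.
  + exact: coord_continuous.
  + move=> h; have [u1 _ _ _ _] := hu _ (ca t ct h).
    apply: (cvg_comp (fun t : 'rV[R]_2 => set_first (2 * t 0 t1) t) u) u1.
    apply: (cvg_set_first (nbhs_filter _)); last exact: cvg_id.
    exact: cd.
  + move=> h; have [v1 _ _ _ _] := hv _ (cb t ct h); apply: cont_scale.
      by apply: cont_cis; apply: cont_mulr; [exact: cst_continuous | exact: cont_coord].
    apply: (cvg_comp (fun t : 'rV[R]_2 => set_first (2 * t 0 t1 - 1) t) v) v1.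
    apply: (cvg_set_first (nbhs_filter _)); last exact: cvg_id.
    have c1 : {for t, continuous (fun t : 'rV[R]_2 => 2 * t 0 t1 - 1)}.
      by apply: cont_subr; [exact: cd | exact: cst_continuous].
    exact: c1.
  + move=> h; have h1 : t 0 t1 <= 2^-1 by rewrite h.
    have h2 : 2^-1 <= t 0 t1 by rewrite h.
    have [_ _ _ _ u5] := hu _ (ca t ct h1); have [_ _ _ v4 _] := hv _ (cb t ct h2).
    have s1 : set_first (2 * t 0 t1) t 0 t1 = 1 by rewrite mxE eqxx h; lra.
    have s2 : set_first (2 * t 0 t1 - 1) t 0 t1 = 0 by rewrite mxE eqxx h; lra.
    by rewrite /a /b u5 // v4; [rewrite mxE | left].
- case: ifPn => [h|]; first by have [_ -> _ _ _] := hu _ (ca t ct h).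
  rewrite -ltNge => /ltW h; have [_ v2 _ _ _] := hv _ (cb t ct h).
  by rewrite nrmZ normc_cis v2 mulr1.
- rewrite /concat; case: ifPn => [h|]; first by have [_ _ <- _ _] := hu _ (ca t ct h).
  rewrite -ltNge => /ltW h; have [_ v2 v3 _ _] := hv _ (cb t ct h).
  by rewrite -v3 (chart_scale chart) ?cis_neq0 ?neq0_of_nrm1.
- case: ifPn => [h|].
    have [_ _ _ u4 _] := hu _ (ca t ct h) => ht; apply: u4; rewrite !mxE /=.
    by case: ht => [->|?]; [left; rewrite mulr0 | right].
  rewrite -ltNge => h; have [_ _ _ v4 _] := hv _ (cb t ct (ltW h)).
  case=> [t0|ht]; first by exfalso; move: h; rewrite t0; lra.
  by rewrite /b cisd // scale1r v4 // !mxE /=; right.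
- move=> t11; have -> : (t 0 t1 <= 2^-1) = false by rewrite t11; apply/negbTE;
  rewrite -ltNge; lra.
  have h : 2^-1 <= t 0 t1 by rewrite t11; lra.
  have [_ _ _ _ v5] := hv _ (cb t ct h); rewrite /b v5 ?mxE ?eqxx ?t11 /=; last by lra.
  by rewrite scalerA -cisD -mulrDl -mulrDr -rmorphD.
Qed.

(** The lift is prescribed first: for each t2, a path from [psi0] to z [psi0] pushed off 0 along e.
    The push vanishes only for t1 = 0, t1 = 1 or z = 1, where the coefficient of [psi0] is nonzero;
    for z = 1 the path stays at [psi0]. *)
Lemma has_degree_surj (d : int) : exists f, has_degree f d.
Proof.
have [e e1 he] := chart_infdim chart [:: psi0].
have pe : dot psi0 e = 0 by apply: he; rewrite mem_head.
pose z (t : 'rV[R]_2) : R[i]^o := cis (2 * pi * d%:~R * t 0 t2).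
pose k (t : 'rV[R]_2) : R[i]^o := (t 0 t1 * (1 - t 0 t1))%:C * (1 - z t).
pose G (t : 'rV[R]_2) := ((1 - t 0 t1)%:C + (t 0 t1)%:C * z t) *: psi0 + k t *: e.
have zc (t : 'rV[R]_2) : {for t, continuous z}.
  by apply: cont_cis; apply: cont_mulr; [exact: cst_continuous | exact: cont_coord].
have c1 (t : 'rV[R]_2) : {for t, continuous (fun t : 'rV[R]_2 => 1 - t 0 t1)}.
  by apply: cont_subr; [exact: cst_continuous | exact: cont_coord].
have Gc (t : 'rV[R]_2) : {for t, continuous G}.
  apply: cont_add; apply: cont_scale; try exact: cst_continuous.
    apply: cont_addc; first by apply: cont_real_complex; exact: c1.
    apply: cont_mulc; last exact: zc.
    by apply: cont_real_complex; exact: cont_coord.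
  apply: cont_mulc; last by apply: cont_subc; [exact: cst_continuous | exact: zc].
  by apply: cont_real_complex; apply: cont_mulr; [exact: cont_coord | exact: c1].
have G0 (t : 'rV[R]_2) : G t != 0.
  apply/negP => /eqP h.
  have h1 : k t = 0.
    have : dot (G t) e = k t by rewrite dotDl !dotZl pe mulr0 add0r dotxx e1 expr1n
      mulr1.
    by rewrite h dot0l.
  have : (1 - t 0 t1)%:C + (t 0 t1)%:C * z t = 0.
    have : dot (G t) psi0 = (1 - t 0 t1)%:C + (t 0 t1)%:C * z t.
      by rewrite dotDl !dotZl h1 mul0r addr0 dotxx psi01 expr1n mulr1.
    by rewrite h dot0l.
  move/eqP: h1; rewrite mulf_eq0 subr_eq0 => /orP[/eqP h1|/eqP <-]; last first.
    by rewrite mulr1 -rmorphD subrK => /eqP; rewrite oner_eq0.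
  have /eqP : t 0 t1 * (1 - t 0 t1) = 0 by apply: (@complexI R); rewrite h1.
  rewrite mulf_eq0 subr_eq0 => /orP[/eqP ->|/eqP <-].
  - by rewrite subr0 mul0r addr0 => /eqP; rewrite oner_eq0.
  - by rewrite subrr add0r mul1r => /eqP; rewrite (negPf (cis_neq0 _)).
exists (fun t => st (unitv (G t))), (fun t => unitv (G t)) => t ct; split.
- exact: (cvg_unitv (nbhs_filter t) (G0 t) (Gc t)).
- exact: nrm_unitv.
- by [].
- move=> ht; suff -> : G t = psi0 by rewrite unitv1.
  rewrite /G /k; case: ht => [->|ht].
    by rewrite subr0 !mul0r scale0r !addr0 scale1r.
  have -> : z t = 1 by rewrite /z; case: ht => ->;
    rewrite ?mulr0 ?cis0 // mulr1 cis_int.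
  by rewrite subrr mulr0 scale0r addr0 mulr1 -rmorphD subrK scale1r.
- move=> t11; have -> : G t = z t *: psi0.
    by rewrite /G /k t11 subrr !mulr0 !mul0r scale0r addr0 add0r mul1r.
  by rewrite unitv1 // nrmZ normc_cis psi01 mulr1.
Qed.

Lemma has_degree_ex f : spheroid x0 f -> exists d, has_degree f d.
Proof. by move=> /homotopic_refl/homotopic_degree[d [hd _]]; exists d. Qed.

Lemma homotopy_classE f d : has_degree f d ->
  @homotopy_class R X 2 x0 f = [set g | has_degree g d].
Proof.
move=> df; apply/seteqP; split=> [g [sg /homotopic_degree[e [ef eg]]]|g dg] /=.
  by rewrite (has_degree_inj df ef).
by split; [exact: has_degree_spheroid dg | exact: homotopic_of_degree df dg].
Qed.

Lemma homotopy_group_iso_int : @homotopy_group_iso R X 1 x0 int.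
Proof.
(* On a homotopy class the default 0 is never chosen: every spheroid has a degree, common to its
   class. *)
pose phi (C : set ('rV[R]_2 -> X)) : int := xget 0 [set d | exists2 f,
  C f & has_degree f d].
have phiE (C : set ('rV[R]_2 -> X)) f d : C f -> (forall g,
  C g -> has_degree g d) -> phi C = d.
  move=> Cf Cd; rewrite /phi; case: xgetP => [e _ [g Cg ge]|/(_ d) []].
    by apply: has_degree_inj ge _; exact: Cd.
  by exists f => //; exact: Cd.
have clE C : @homotopy_group R X 2 x0 C -> exists2 d,
  C = [set g | has_degree g d] & phi C = d.
  move=> [f sf <-]; have [d fd] := has_degree_ex sf; exists d;
    first exact: homotopy_classE.
  by rewrite (homotopy_classE fd); apply: (phiE _ f).
exists phi; split.
  split=> // [C D /set_mem/clE[d -> ->] /set_mem/clE[e -> ->] ->//|d _].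
  have [f fd] := has_degree_surj d.
  exists (homotopy_class x0 f); last by rewrite (homotopy_classE fd); apply: (phiE _ f).
  by exists f => //; exact: has_degree_spheroid fd.
move=> C D /clE[d -> ->] /clE[e -> ->].
have [f fd] := has_degree_surj d; have [g ge] := has_degree_surj e.
apply: (phiE _ (concat f g)).
  exists f => //; exists g => //; rewrite (homotopy_classE (has_degree_concat fd ge)).
  exact: has_degree_concat.
move=> h [f' /= f'd [g' /= g'e]].
by rewrite (homotopy_classE (has_degree_concat f'd g'e)).
Qed.

End HomotopyGroups.

(** * The pure state space as the projective space of H *)

Section PureStateChart.
Variables (R : realType) (A : cstarAlgType R) (H : hilbertType R).
Variable phi : A -> H -> H.
Hypothesis hphi : star_iso_compact phi.
Local Notation normc := Normc.normc.
Local Notation "x %:C" := (x%:C)%C.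
Local Notation vec := (vec phi).
Local Notation X := (pure_states A).

Lemma vec_unit_scale (k : R[i]) (x : H) a : vec (k *: x) a = (normc k ^+ 2)%:C * vec
  x a.
Proof. by rewrite /vec (op_Z hphi) dotZl dotZr mulrA mulcJ. Qed.

Lemma vec_unitv (x : H) a : vec (unitv x) a = ((nrm x)^-1 ^+ 2)%:C * vec x a.
Proof. by rewrite vec_unit_scale normc_real ger0_norm // invr_ge0 nrm_ge0. Qed.

Lemma cvg_op (T : Type) (F : set_system T) (FF : Filter F) (f : T -> H) x a :
  f t @[t --> F] --> x -> phi a (f t) @[t --> F] --> phi a x.
Proof.
move=> hf; apply/cvg_nrmP => e e0.
have a1 : 0 < nrm a + 1 by rewrite ltr_wpDl ?nrm_ge0.
have /cvg_nrmP /(_ _ (divr_gt0 e0 a1)) := hf; apply: filterS => t.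
rewrite ltr_pdivlMr // -(op_B hphi) => h; apply: le_lt_trans (nrm_phi hphi _ _) _.
by apply: le_lt_trans h; rewrite mulrC ler_wpM2l ?nrm_ge0 // lerDl ler01.
Qed.

(** The topology of the pure states enters the homotopy computation through this chart alone: v goes
    to the vector state of v/|v|, and continuity is tested at each a. *)
Lemma pure_state_chart : infdim H -> exists st : H -> X,
  projective_chart st (pure_proj hphi).
Proof.
move=> Hinf; have [e e1 _] := Hinf [::].
pose mk psi (h : nrm psi = 1) : X := exist _ (vec psi) (mem_set (vec_pure hphi h)).
(* The state of [e] fills in the junk value at v = 0. *)
have hst v : exists w : X, v != 0 -> set_val w = vec (unitv v).
  have [v0|v0] := eqVneq v 0; first by exists (mk e e1).
  by exists (mk (unitv v) (nrm_unitv v0)).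
have [st hst'] := choice hst; exists st.
have st1 psi : nrm psi = 1 -> set_val (st psi) = vec psi.
  by move=> h; rewrite hst' ?unitv1 //; exact: neq0_of_nrm1.
split=> //.
- move=> x; exists (vector_of hphi x); first exact: nrm_vector_of.
  apply: val_inj; rewrite -!set_valE st1; last exact: nrm_vector_of.
  exact: vec_vector_of.
- move=> k v k0 v0; apply: val_inj;
  rewrite -!set_valE !hst' ?scaler_eq0 ?negb_or ?k0 //.
  apply/funext => a; rewrite !vec_unitv vec_unit_scale nrmZ mulrA -rmorphM /=.
  rewrite invfM exprMn mulrAC -exprMn mulVf ?expr1n ?mul1r //.
  by rewrite -nrm_normc nrm0_eq0.
- move=> v v0; apply: (cvg_pure (nbhs_filter v)) => a.
  have h : (vec (unitv v') a : R[i]^o) @[v' --> v] --> (vec (unitv v) a : R[i]^o).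
    have hu := cvg_unitv (nbhs_filter v) v0 (fun _ => id).
    by apply: cvg_dot => //; exact: cvg_op.
  rewrite hst' //; apply: cvg_trans h; apply: near_eq_cvg.
  have h0 : \forall v' \near v, v' != 0 by apply: (cvgr_neq0 _ _ v0);
    exact: (fun _ => id).
  by apply: filterS h0 => v' hv'; rewrite hst'.
- by move=> psi v h; rewrite (pure_projE hphi v h (st1 _ h)).
- move=> x v.
  have h1 : q.1 @[q --> ((x, v) : X * H)] --> x by apply: cvg_fstT; exact: cvg_id.
  have h2 : q.2 @[q --> ((x, v) : X * H)] --> v by apply: cvg_sndT; exact: cvg_id.
  exact: (cvg_pure_proj (nbhs_filter _) h1 h2).
Qed.

End PureStateChart.

Theorem proposition5p7 (R : realType) (A : cstarAlgType R)
    (infinite_dim : ~ finite_dimensional A) (elem : elementary A) :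
  (forall U : set (pure_states A), open U <-> norm_open U) /\
  eilenberg_maclane_Z2 R (pure_states A).
Proof.
have [H [phi hphi]] := elem; split; first exact: (weak_star_open_norm_open hphi).
have [st chart] := pure_state_chart hphi (infdim_of_infinite_dimensional hphi
  infinite_dim).
split; first exact: projective_path_connected chart.
- move=> x; have [psi psi1 ->] := chart_surj chart x.
  exact: (homotopy_group_iso_int chart psi1).
(* With the dimension written n.+1, the condition n.+1 != 2 is n != 1 by computation. *)
- move=> [//|n] x _ n1; have [psi psi1 ->] := chart_surj chart x.
  exact: (trivial_homotopy_group chart psi1 n1).
Qed.
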